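(* Let $k,n$ be positive integers. There exists a $C^k$ integrable almost complex structure $J$ on $\mathbb{R}^{2n}$ such that there is no $C^{k,1}$ complex coordinate chart $w=(w^1,\dots,w^n):U\subset\mathbb{R}^{2n}\to\mathbb{C}^n$, defined on a neighborhood $U$ of $0$, satisfying $J\frac{\partial}{\partial w^j}=i\frac{\partial}{\partial w^j}$ for $j=1,\dots,n$.
   Context: An almost complex structure is a bundle endomorphism $J:T\mathbb{R}^{2n}\to T\mathbb{R}^{2n}$ with $J^2=-\mathrm{id}$; it is $C^k$ if its coefficients are $C^k$ functions. $J$ is integrable if its Nijenhuis tensor $N_J(X,Y)=[JX,JY]-J[JX,Y]-J[X,JY]-[X,Y]$ vanishes; equivalently, the $i$-eigenbundle $\{v\in\mathbb{C}T_p\mathbb{R}^{2n}: J_pv=iv\}$ is closed under Lie brackets of complex vector fields. $C^{k,1}$ denotes functions whose derivatives up to order $k$ exist and the $k$-th derivatives are Lipschitz. *)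

(* Defs.v *)
From HB Require Import structures.
From mathcomp Require Import all_boot all_order all_algebra.
From mathcomp Require Import all_classical all_reals all_analysis.
From mathcomp Require Import complex.
Set Implicit Arguments. Unset Strict Implicit. Unset Printing Implicit Defensive.
Import Order.TTheory GRing.Theory Num.Theory numFieldNormedType.Exports.
Local Open Scope ring_scope.
Local Open Scope classical_set_scope.

Section Defs.
Variable R : realType.

Definition basisv (m : nat) (i : 'I_m) : 'rV[R]_m := delta_mx 0 i.

Definition partial (m : nat) (i : 'I_m) (f : 'rV[R]_m -> R) (x : 'rV[R]_m) : R :=
  'D_(basisv i) f x.

Fixpoint iter_partial (m : nat) (s : seq 'I_m) (f : 'rV[R]_m -> R) : 'rV[R]_m -> R :=
  match s with
  | [::] => f
  | i :: s' => partial i (iter_partial s' f)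
  end.

Fixpoint Ck_on (m : nat) (k : nat) (U : set 'rV[R]_m) (f : 'rV[R]_m -> R) : Prop :=
  match k with
  | 0 => forall x, U x -> {for x, continuous f}
  | k'.+1 => (forall x, U x -> {for x, continuous f}) /\
             forall i : 'I_m,
               (forall x, U x -> derivable f x (basisv i)) /\
               Ck_on k' U (partial i f)
  end.

Definition Ckl_on (m : nat) (k : nat) (U : set 'rV[R]_m) (f : 'rV[R]_m -> R) : Prop :=
  Ck_on k U f /\
  forall s : seq 'I_m, size s = k ->
    exists L : R, forall x y, U x -> U y ->
      `|iter_partial s f x - iter_partial s f y| <= L * `|x - y|.

(* An almost complex structure on R^N, given by its matrix field J(p) acting on
   column vectors of coordinates w.r.t. the basis d/dx^1..d/dx^N. *)
Definition almost_complex (N : nat) (J : 'rV[R]_N -> 'M[R]_N) : Prop :=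
  forall p, J p *m J p = - 1%:M.

Definition Ck_structure (N : nat) (k : nat) (J : 'rV[R]_N -> 'M[R]_N) : Prop :=
  forall a b : 'I_N, Ck_on k setT (fun p => J p a b).

Definition vfield (N : nat) := 'rV[R]_N -> 'cV[R]_N.

Definition C1_field (N : nat) (X : vfield N) : Prop :=
  forall c : 'I_N, Ck_on 1 setT (fun p => X p c 0).

Definition lie_bracket (N : nat) (X Y : vfield N) : vfield N :=
  fun p => \col_(c < N)
    \sum_(d < N) (X p d 0 * partial d (fun q => Y q c 0) p
                  - Y p d 0 * partial d (fun q => X q c 0) p).

Definition Jfield (N : nat) (J : 'rV[R]_N -> 'M[R]_N) (X : vfield N) : vfield N :=
  fun p => J p *m X p.

Definition nijenhuis (N : nat) (J : 'rV[R]_N -> 'M[R]_N) (X Y : vfield N) : vfield N :=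
  fun p => lie_bracket (Jfield J X) (Jfield J Y) p
         - J p *m lie_bracket (Jfield J X) Y p
         - J p *m lie_bracket X (Jfield J Y) p
         - lie_bracket X Y p.

Definition J_integrable (N : nat) (J : 'rV[R]_N -> 'M[R]_N) : Prop :=
  forall X Y : vfield N, C1_field X -> C1_field Y ->
    forall p, nijenhuis J X Y p = 0.

(* A complex map w = (w^1..w^n) : U -> C^n is given by real and imaginary parts
   w^j = u j + i v j.  Its real Jacobian (rows du^1..du^n, dv^1..dv^n): *)
Definition real_jacobian (n : nat) (u v : 'I_n -> 'rV[R]_(n + n) -> R)
    (p : 'rV[R]_(n + n)) : 'M[R]_(n + n) :=
  col_mx (\matrix_(j < n, a < n + n) partial a (u j) p)
         (\matrix_(j < n, a < n + n) partial a (v j) p).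

Definition Ckl_chart (n k : nat) (U : set 'rV[R]_(n + n))
    (u v : 'I_n -> 'rV[R]_(n + n) -> R) : Prop :=
  (forall j, Ckl_on k U (u j) /\ Ckl_on k U (v j)) /\
  {in U &, injective (fun p => (fun j => (u j p, v j p)))} /\
  (forall p, U p -> real_jacobian u v p \in unitmx).

(* complex matrix with rows dw^1..dw^n, d(conj w)^1..d(conj w)^n at p *)
Definition dw_matrix (n : nat) (u v : 'I_n -> 'rV[R]_(n + n) -> R)
    (p : 'rV[R]_(n + n)) : 'M[R[i]]_(n + n) :=
  col_mx (\matrix_(j < n, a < n + n) Complex (partial a (u j) p) (partial a (v j) p))
         (\matrix_(j < n, a < n + n) Complex (partial a (u j) p) (- partial a (v j) p)).

(* the coordinate vector field d/dw^j at p: the dual frame to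
   (dw^1..dw^n, dconj(w)^1..dconj(w)^n), i.e. the j-th column of the inverse *)
Definition d_dw (n : nat) (u v : 'I_n -> 'rV[R]_(n + n) -> R)
    (p : 'rV[R]_(n + n)) (j : 'I_n) : 'cV[R[i]]_(n + n) :=
  col (lshift n j) (invmx (dw_matrix u v p)).

Definition Jc (N : nat) (J : 'rV[R]_N -> 'M[R]_N) (p : 'rV[R]_N) : 'M[R[i]]_N :=
  map_mx (fun x : R => Complex x 0) (J p).

End Defs.

(* Main.v *)
(** On each pair of coordinates z = x + iy we use the structure w_zbar = mu w_z with
    mu = z^(k+2) ell'(t) / (1 + z^k t ell'(t)), t = |z|^2, where ell is a multiple of
    ln (1 + ln (1 + t^-k)).  It is of class C^k because t ell'(t) tends to 0 like
    1 / |ln t|, and it is chosen so that G = z^-k - k ell(t) is holomorphic for it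
    outside z = 0; equivalently G^(-1/k) = z + z^(k+1) ell + ... is a chart whose
    derivatives of order k+1 are unbounded.

    If a C^(k,1) chart existed, one of its components would give, on a coordinate plane,
    a holomorphic f = c z + ... with c <> 0 and a Taylor expansion with error
    O(|z|^(k+1)), so f^k is known up to O(|z|^(2k)).  The contour integral of
    f^k d(G^2) over |z| = r does not depend on r, since df and dG are proportional.
    But the Taylor polynomial integrates to zero against z^-2k, while the cross term
    -2k ell z^-k of G^2 contributes a nonzero multiple of ell(r^2), and everything else
    is bounded; this is absurd as ell(r^2) is unbounded.

    The integral is replaced by Riemann-Stieltjes sums over the N-th roots of unity:
    these kill the Taylor polynomial exactly, and for two radii they differ by O(1/N).
    Only first-order expansions with a quadratic error are needed, so f need not be
    twice differentiable. *)
Require Import Defs.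
From HB Require Import structures.
From mathcomp Require Import all_boot all_order all_algebra.
From mathcomp Require Import all_classical all_reals all_analysis.
From mathcomp Require Import complex.
From mathcomp Require Import ring lra zify.
Set Implicit Arguments. Unset Strict Implicit. Unset Printing Implicit Defensive.
Import Order.TTheory GRing.Theory Num.Theory numFieldNormedType.Exports.
Local Open Scope ring_scope.
Local Open Scope classical_set_scope.
Local Notation Re := (@complex.Re _).
Local Notation Im := (@complex.Im _).

(** Since [ell] depends on |z| only, it is constant on the contour, and the integral of f dG would
    see nothing but the pole z^-k. The square of G is the first power whose differential on the
    circle still involves [ell], through the cross term with z^-k. Detecting a multiple of z^-k
    needs an integrand starting with z^k, hence f^k; and the k-th power improves the error from
    degree k+1 to degree 2k, which is exactly what the pole z^-2k tolerates. The inner function is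
    ln (1 + t^-k) and not -k ln t because it is positive for every t > 0 and its derivative carries
    1 / (1 + t^k). This factor keeps |mu| < 1 on the whole plane, so the structure is global without
    a cutoff. Each 2 x 2 block of J depends on its own pair of variables. Integrability is therefore
    the automatic one of real dimension two, and the restriction of a chart component to a
    coordinate plane through 0 satisfies the equation of that plane. *)

Section DirectionalDerivatives.
Variables (R : realType) (V : normedModType R).
Implicit Types (f g : V -> R) (p v : V) (df dg a b : R).

Lemma is_derive_add f g p v df dg : is_derive p v f df -> is_derive p v g dg ->
  is_derive p v (fun q => f q + g q) (df + dg).
Proof. by move=> hf hg; exact: is_deriveD. Qed.

Lemma is_derive_mul f g p v df dg : is_derive p v f df -> is_derive p v g dg ->
  is_derive p v (fun q => f q * g q) (f p * dg + df * g p).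
Proof.
move=> hf hg; have := is_deriveM hf hg.
by rewrite /GRing.scale /= [g p * df]mulrC.
Qed.

Lemma is_derive_scale (c : R) f p v df : is_derive p v f df ->
  is_derive p v (fun q => c * f q) (c * df).
Proof. by move=> hf; exact: (@is_deriveZ _ _ _ f c p v df). Qed.

Lemma is_derive_inv f p v df : f p != 0 -> is_derive p v f df ->
  is_derive p v (fun q => (f q)^-1) (- (df * (f p)^-1 * (f p)^-1)).
Proof.
move=> f0 hf; have hd : derivable f p v by case: hf.
apply: DeriveDef; first exact: derivableV.
rewrite deriveV //; have -> : 'D_v f p = df by apply: derive_val.
by rewrite /GRing.scale /= expr2 invfM mulNr mulrC mulrA.
Qed.

Lemma is_derive_to f p v df :
  (exists dg, is_derive p v f dg /\ dg = df) -> is_derive p v f df.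
Proof. by case=> dg [h <-]. Qed.

(** Reduces directional derivatives to derivatives along a line, where the one-variable chain rule
    and the mean value theorem are available. *)
Lemma is_derive_along f p v df :
  is_derive p v f df <-> is_derive (0 : R) (1 : R) (fun h : R => f (h *: v + p)) df.
Proof.
have E : (fun h : R => h^-1 *: ((f \o shift p) (h *: v) - f p)) =
   (fun h : R => h^-1 *: (((fun h : R => f (h *: v + p)) \o shift 0)
      (h *: (1 : R)) - (fun h : R => f (h *: v + p)) 0)).
  by apply/funext => h /=; rewrite addr0 scale0r add0r /GRing.scale /= mulr1.
split=> -[h1 h2]; apply: DeriveDef.
- by rewrite /derivable -E.
- by rewrite -h2 /derive -E.
- by rewrite /derivable E.
- by rewrite -h2 /derive -E.
Qed.

Lemma is_derive_chain (phi : R -> R) f p v a b :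
  is_derive (f p) 1 phi a -> is_derive p v f b ->
  is_derive p v (fun q => phi (f q)) (a * b).
Proof.
move=> ha /is_derive_along hb; apply/is_derive_along.
apply: (@is_derive1_comp _ phi (fun h => f (h *: v + p))) => //.
by rewrite scale0r add0r.
Qed.

End DirectionalDerivatives.

(** * Functions of class C^k *)

Section CkAlgebra.
Variables (R : realType) (m : nat).
Local Notation V := 'rV[R]_m.
Implicit Types (f g : V -> R).

Lemma is_derive_coord (a : 'I_m) (p v : V) :
  is_derive p v (fun q : V => q 0 a) (v 0 a).
Proof.
have H : (fun h : R => h^-1 *: (((fun q : V => q 0 a) \o shift p) (h *: v) - p 0 a))
    @ 0^' --> v 0 a.
  apply: cvg_near_cst; near=> h.
  have h0 : h != 0 by near: h; exact: nbhs_dnbhs_neq.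
  by rewrite /= !mxE addrK /GRing.scale /= mulKf.
apply: DeriveDef; first by apply/cvg_ex; exists (v 0 a).
exact: cvg_lim.
Unshelve. all: by end_near.
Qed.

Lemma continuous_coord (a : 'I_m) : continuous (fun q : V => q 0 a).
Proof. by move=> p; exact: coord_continuous. Qed.

(** [partial] is total, so an explicit candidate [g] with its proof of derivability is easier to
    carry through inductions than [partial i f] itself. *)
Lemma Ck_onS k f :
  Ck_on k.+1 setT f <->
  continuous f /\ forall i, exists g, (forall p, is_derive p (basisv R i) f (g p))
     /\ Ck_on k setT g.
Proof.
split=> [[cf H]|[cf H]].
  split; first by move=> p; exact: cf.
  move=> i; have [d c] := H i; exists (partial i f); split=> // p.
  by apply: derivableP; exact: d.
split; first by move=> p _; exact: cf.
move=> i; have [g [dg cg]] := H i; split.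
  by move=> p _; have [] := dg p.
suff -> : partial i f = g by [].
by apply/funext => p; apply: derive_val.
Qed.

Lemma Ck_onW k f : Ck_on k.+1 setT f -> Ck_on k setT f.
Proof.
elim: k f => [f [cf _] //|k IH f /Ck_onS[cf H]].
apply/Ck_onS; split=> // i; have [g [dg cg]] := H i.
by exists g; split=> //; exact: IH.
Qed.

Lemma Ck_on_cst k (c : R) : Ck_on k setT (fun _ : V => c).
Proof.
elim: k c => [c p _|k IH c]; first exact: cst_continuous.
apply/Ck_onS; split=> [|i]; first exact: cst_continuous.
by exists (fun=> 0); split=> // p; exact: is_derive_cst.
Qed.

Lemma Ck_on_add k f g : Ck_on k setT f -> Ck_on k setT g ->
  Ck_on k setT (fun p => f p + g p).
Proof.
elim: k f g => [f g cf cg p _|k IH f g /Ck_onS[cf Hf] /Ck_onS[cg Hg]].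
  by apply: continuousD; [exact: cf|exact: cg].
apply/Ck_onS; split=> [p|i]; first by apply: continuousD; [exact: cf|exact: cg].
have [f' [df cf']] := Hf i; have [g' [dg cg']] := Hg i.
exists (fun p => f' p + g' p); split; last exact: IH.
by move=> p; exact: is_derive_add.
Qed.

Lemma Ck_on_mul k f g : Ck_on k setT f -> Ck_on k setT g ->
  Ck_on k setT (fun p => f p * g p).
Proof.
elim: k f g => [f g cf cg p _|k IH f g Hf0 Hg0].
  by apply: continuousM; [exact: cf|exact: cg].
have /Ck_onS[cf Hf] := Hf0; have /Ck_onS[cg Hg] := Hg0.
apply/Ck_onS; split=> [p|i]; first by apply: continuousM; [exact: cf|exact: cg].
have [f' [df cf']] := Hf i; have [g' [dg cg']] := Hg i.
exists (fun p => f p * g' p + f' p * g p); split.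
  by move=> p; exact: is_derive_mul.
by apply: Ck_on_add; apply: IH => //; exact: Ck_onW.
Qed.

Lemma Ck_on_opp k f : Ck_on k setT f -> Ck_on k setT (fun p => - f p).
Proof.
move=> H; have -> : (fun p => - f p) = (fun p => -1 * f p).
  by apply/funext => p; rewrite mulN1r.
by apply: Ck_on_mul => //; exact: Ck_on_cst.
Qed.

Lemma Ck_on_inv k f : (forall p, f p != 0) -> Ck_on k setT f ->
  Ck_on k setT (fun p => (f p)^-1).
Proof.
move=> f0; elim: k => [cf p _|k IH Hf0].
  by apply: continuousV => //; exact: cf.
have /Ck_onS[cf Hf] := Hf0.
have IH' := IH (Ck_onW Hf0).
apply/Ck_onS; split=> [p|i]; first by apply: continuousV => //; exact: cf.
have [f' [df cf']] := Hf i.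
exists (fun p => - (f' p * (f p)^-1 * (f p)^-1)); split.
  by move=> p; exact: is_derive_inv.
by apply: Ck_on_opp; apply: Ck_on_mul => //; exact: Ck_on_mul.
Qed.

End CkAlgebra.

(** * Flat functions and the regularity of the structure *)

Section Profile.
Variables (R : realType) (k : nat).
Hypothesis k_gt0 : (0 < k)%N.
Implicit Types (t h : R).

(* The factor [lam] tends to [0] so slowly that [lam t / t] is not integrable at [0];
   since [0^-1 = 0], the value at [0] must be set separately. *)
Definition lam t : R := if t == 0 then 0 else (1 + ln (1 + (t ^+ k)^-1))^-1.

(** The factor left by differentiation: the derivative of ln (1 + t^-k) is -k [damp t] / t. It tends
    to 1 at 0, and its decay at infinity keeps the structure elliptic. *)
Definition damp t : R := (1 + t ^+ k)^-1.

Lemma lam0 : lam 0 = 0. Proof. by rewrite /lam eqxx. Qed.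

Lemma lam_denom_gt1 t : 0 < t -> 1 < 1 + ln (1 + (t ^+ k)^-1).
Proof.
by move=> t0; rewrite ltrDl ln_gt0 // ltrDl invr_gt0 exprn_gt0.
Qed.

Lemma lam_ge0 t : 0 <= t -> 0 <= lam t.
Proof.
rewrite le_eqVlt => /orP[/eqP <-|t0]; first by rewrite lam0.
by rewrite /lam gt_eqF // invr_ge0 ltW // (lt_trans ltr01) // lam_denom_gt1.
Qed.

Lemma lam_lt1 t : 0 <= t -> lam t < 1.
Proof.
rewrite le_eqVlt => /orP[/eqP <-|t0]; first by rewrite lam0.
rewrite /lam gt_eqF // invf_lt1 ?lam_denom_gt1 //.
by rewrite (lt_trans ltr01) // lam_denom_gt1.
Qed.

Lemma damp_denom_gt0 t : 0 <= t -> 0 < 1 + t ^+ k.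
Proof. by move=> t0; rewrite ltr_pwDl // exprn_ge0. Qed.

Lemma damp_ge0 t : 0 <= t -> 0 <= damp t.
Proof. by move=> t0; rewrite invr_ge0 ltW // damp_denom_gt0. Qed.

Lemma damp_le1 t : 0 <= t -> damp t <= 1.
Proof.
by move=> t0; rewrite invf_le1 ?damp_denom_gt0 // lerDl exprn_ge0.
Qed.

Lemma lam_small e : 0 < e -> exists2 d : R, 0 < d &
  forall t, 0 <= t -> t < d -> lam t < e.
Proof.
(* Below exp (-1/e) one has 1/t > exp (1/e), and t^k <= t for t < 1, so the logarithm in [lam]
   exceeds 1/e. *)
move=> e0; exists (Num.min 1 (expR (- e^-1))).
  by rewrite lt_min ltr01 expR_gt0.
move=> t; rewrite le_eqVlt => /orP[/eqP <- _|t0]; first by rewrite lam0.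
rewrite lt_min => /andP[t1 te]; rewrite /lam gt_eqF //.
have tk : t ^+ k <= t.
  by rewrite -[leRHS]expr1 ler_wiXn2l // ltW.
have tinv : t^-1 <= (t ^+ k)^-1 by rewrite lef_pV2 // posrE exprn_gt0.
have H : e^-1 < ln (1 + (t ^+ k)^-1).
  have -> : e^-1 = ln (expR e^-1) by rewrite expRK.
  have tp : 0 < t^-1 by rewrite invr_gt0.
  have H1 : expR e^-1 < t^-1 by rewrite -[e^-1]opprK expRN ltf_pV2 // posrE expR_gt0.
  by rewrite ltr_ln ?posrE ?expR_gt0 //; lra.
rewrite invf_plt ?posrE //; first lra.
have := lam_denom_gt1 t0; lra.
Qed.

Lemma is_derive_exprn t n : is_derive t 1 (fun u : R => u ^+ n) (n%:R * t ^+ n.-1).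
Proof.
elim: n => [|n IH]; first by rewrite mul0r; exact: is_derive_cst.
have -> : (fun u : R => u ^+ n.+1) = (fun u => u * u ^+ n).
  by apply/funext => u; rewrite exprS.
apply: is_derive_to; eexists; split; first by apply: is_derive_mul IH; exact: is_derive_id.
by case: n {IH} => [|n]; rewrite /= ?exprS -?natr1; ring.
Qed.

Lemma is_derive_ln_profile t : 0 < t ->
  is_derive t 1 (fun u : R => ln (1 + (u ^+ k)^-1)) (- (k%:R * damp t / t)).
Proof.
move=> t0; have tk : t ^+ k != 0 by rewrite gt_eqF // exprn_gt0.
have p0 : 0 < 1 + (t ^+ k)^-1 by rewrite ltr_wpDr ?invr_ge0 ?exprn_ge0 // ltW.
have H : is_derive t 1 (fun u : R => 1 + (u ^+ k)^-1)
    (0 + - (k%:R * t ^+ k.-1 * (t ^+ k)^-1 * (t ^+ k)^-1)).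
  have A := @is_derive_inv _ _ (fun u : R => u ^+ k) t 1 _ tk (is_derive_exprn t k).
  by apply: is_derive_add.
have B := (@is_derive_chain _ _ (@ln R) (fun u : R => 1 + (u ^+ k)^-1) t 1 _ _ (is_derive1_ln p0) H).
refine (is_derive_eq B _).
rewrite /damp add0r.
have q0 : 1 + t ^+ k != 0 by rewrite gt_eqF // damp_denom_gt0 // ltW.
have tE : t ^+ k = t * t ^+ k.-1 by rewrite -exprS prednK.
have tp : t ^+ k.-1 != 0 by rewrite gt_eqF // exprn_gt0.
move: q0 p0 tk; rewrite tE => q0 p0 tk; field.
by rewrite tp q0 !gt_eqF //; move: q0; rewrite addrC.
Qed.

(** In the form t lam' = k damp lam^2 this says that the operator t d/dt keeps [lam] inside the
    algebra generated by [lam] and [damp]; the closure of [flat] under derivatives rests on it. *)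
Lemma is_derive_lam t : 0 < t ->
  is_derive t 1 lam (k%:R * damp t / t * (lam t * lam t)).
Proof.
move=> t0.
have H : is_derive t 1 (fun u : R => (1 + ln (1 + (u ^+ k)^-1))^-1)
     (k%:R * damp t / t * (lam t * lam t)).
  apply: is_derive_to; eexists; split.
    have A := is_derive_ln_profile t0.
    have B : is_derive t 1 (fun u : R => 1 + ln (1 + (u ^+ k)^-1))
      (0 + - (k%:R * damp t / t)) by apply: is_derive_add.
    by apply: is_derive_inv B; have := lam_denom_gt1 t0; lra.
  by rewrite /lam gt_eqF //; ring.
apply: near_eq_is_derive H.
near=> u; rewrite /lam gt_eqF //.
by near: u; exact: lt_nbhsr.
Unshelve. all: by end_near.
Qed.

Lemma is_derive_damp t : 0 <= t ->
  is_derive t 1 damp (- (k%:R * t ^+ k.-1 * (damp t * damp t))).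
Proof.
move=> t0; apply: is_derive_to; eexists; split.
  have A := is_derive_exprn t k.
  have B : is_derive t 1 (fun u : R => 1 + u ^+ k) (0 + k%:R * t ^+ k.-1).
    by apply: is_derive_add.
  by apply: is_derive_inv B; rewrite gt_eqF // damp_denom_gt0.
by rewrite /damp add0r; ring.
Qed.

End Profile.

Section FlatFunctions.
Variables (R : realType) (k : nat) (k_gt0 : (0 < k)%N) (m : nat) (a b : 'I_m).
Local Notation V := 'rV[R]_m.
Implicit Types (f g : V -> R) (p q v : V) (d : int).

Definition sqn p : R := p 0 a ^+ 2 + p 0 b ^+ 2.

Lemma sqn_ge0 p : 0 <= sqn p.
Proof. by rewrite addr_ge0 ?sqr_ge0. Qed.

Lemma sqn_eq0 p : sqn p = 0 -> p 0 a = 0 /\ p 0 b = 0.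
Proof.
move=> /eqP; rewrite /sqn paddr_eq0 ?sqr_ge0 // !sqrf_eq0.
by case/andP=> /eqP -> /eqP ->.
Qed.

(* Functions built from [lam] that are homogeneous of degree at least [d] near [sqn = 0],
   up to the bounded slowly varying factors [lam] and [damp]. *)
Inductive flat : int -> (V -> R) -> Prop :=
| flat_lam : flat 0 (fun p => lam k (sqn p))
| flat_x d f : flat d f -> flat (d + 1) (fun p => p 0 a * f p)
| flat_y d f : flat d f -> flat (d + 1) (fun p => p 0 b * f p)
| flat_xinv d f : flat d f -> flat (d - 1) (fun p => p 0 a / sqn p * f p)
| flat_yinv d f : flat d f -> flat (d - 1) (fun p => p 0 b / sqn p * f p)
| flat_damp d f : flat d f -> flat d (fun p => damp k (sqn p) * f p)
| flat_mullam d f : flat d f -> flat d (fun p => lam k (sqn p) * f p)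
| flat_scale d (c : R) f : flat d f -> flat d (fun p => c * f p)
| flat_add d f g : flat d f -> flat d g -> flat d (fun p => f p + g p)
| flat_weaken d f : flat (d + 1) f -> flat d f.

Lemma flat_eq d d' f : d = d' -> flat d f -> flat d' f.
Proof. by move=> ->. Qed.

Lemma flat_weakenn d (n : nat) f : flat (d + n%:Z) f -> flat d f.
Proof.
elim: n => [|n IH]; first by rewrite addr0.
by move=> H; apply: IH; apply: flat_weaken; apply: flat_eq H; lia.
Qed.

(** The generator [lam] vanishes on [sqn = 0], and every other constructor multiplies, adds or
    weakens, so this holds also in negative degree, where f may be unbounded nearby. *)
Lemma flat_vanish d f p : flat d f -> sqn p = 0 -> f p = 0.
Proof.
move=> H p0; elim: H => [|? ? _ ->|? ? _ ->|? ? _ ->|? ? _ ->|? ? _ ->|? ? _ ->|? ? ? _ ->|? ? ? _ -> _ ->|//];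
  by rewrite ?mulr0 ?addr0 // p0 lam0.
Qed.

Lemma flat_sqnX d f n : flat d f -> flat (d + (2 * n)%:Z) (fun p => sqn p ^+ n * f p).
Proof.
move=> H; elim: n => [|n IH].
  apply: (@flat_eq d); first by lia.
  by under eq_fun do rewrite mul1r.
have -> : (fun p => sqn p ^+ n.+1 * f p) =
   (fun p => p 0 a * (p 0 a * (sqn p ^+ n * f p)) + p 0 b * (p 0 b * (sqn p ^+ n * f p))).
  by apply/funext => p; rewrite exprS {1}/sqn; ring.
by apply: flat_add; [apply: (flat_eq _ (flat_x (flat_x IH)))
  |apply: (flat_eq _ (flat_y (flat_y IH)))]; lia.
Qed.

(** The l1 norm on the pair: comparable with the square root of [sqn], exactly homogeneous along
    lines, and usable with integer exponents of either sign. *)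
Definition nrm1 p : R := `|p 0 a| + `|p 0 b|.

Lemma nrm1_ge0 p : 0 <= nrm1 p. Proof. by rewrite addr_ge0. Qed.

Lemma sqn_nrm1 p : sqn p <= nrm1 p ^+ 2 <= 2 * sqn p.
Proof.
rewrite /sqn /nrm1 -(real_normK (num_real (p 0 a))) -(real_normK (num_real (p 0 b))).
have := normr_ge0 (p 0 a); have := normr_ge0 (p 0 b).
set u := `|p 0 a|; set w := `|p 0 b| => w0 u0.
have := sqr_ge0 (u - w); have := mulr_ge0 u0 w0.
have -> : (u - w) ^+ 2 = u ^+ 2 + w ^+ 2 - 2 * (u * w) by ring.
have -> : (u + w) ^+ 2 = u ^+ 2 + w ^+ 2 + 2 * (u * w) by ring.
by lra.
Qed.

Lemma nrm1_gt0 p : sqn p != 0 -> 0 < nrm1 p.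
Proof.
move=> p0; rewrite lt_neqAle nrm1_ge0 andbT; apply: contra p0 => /eqP n0.
by rewrite eq_le sqn_ge0 andbT; have /andP[h _] := sqn_nrm1 p; rewrite -n0 expr0n /= in h.
Qed.

Lemma coord_inv_bound (u : R) p : sqn p != 0 -> `|u| <= nrm1 p ->
  `|u / sqn p| <= 2 * (nrm1 p)^-1.
Proof.
move=> p0 hu; have n0 := nrm1_gt0 p0.
have s0 : 0 < sqn p by rewrite lt_neqAle sqn_ge0 eq_sym p0.
rewrite normrM normfV (ger0_norm (sqn_ge0 p)) ler_pdivrMr // mulrAC ler_pdivlMr //.
have /andP[_ h] := sqn_nrm1 p; apply: le_trans h; rewrite expr2.
by rewrite ler_pM2r.
Qed.

(** Each constructor changes the bound in the expected way; the restriction to [nrm1 p <= 1] serves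
    [flat_weaken]. The surviving factor [lam] turns each big O into a small o at [sqn = 0]. *)
Lemma flat_bound d f : flat d f -> exists2 C : R, 0 <= C &
  forall p, sqn p != 0 -> nrm1 p <= 1 -> `|f p| <= C * nrm1 p ^ d * lam k (sqn p).
Proof.
have hx p : `|p 0 a| <= nrm1 p by rewrite /nrm1 lerDl.
have hy p : `|p 0 b| <= nrm1 p by rewrite /nrm1 lerDr.
have up d' f' (u : V -> R) : (forall p, `|u p| <= nrm1 p) ->
  (exists2 C : R, 0 <= C & forall p, sqn p != 0 -> nrm1 p <= 1 ->
     `|f' p| <= C * nrm1 p ^ d' * lam k (sqn p)) ->
  (exists2 C : R, 0 <= C & forall p, sqn p != 0 -> nrm1 p <= 1 ->
     `|u p * f' p| <= C * nrm1 p ^ (d' + 1) * lam k (sqn p)).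
  move=> hu [C C0 H]; exists C => // p p0 p1; rewrite normrM.
  rewrite expfzDr ?gt_eqF ?nrm1_gt0 // expr1z.
  apply: le_trans (ler_pM _ _ (hu p) (H p p0 p1)) _ => //.
  by rewrite le_eqVlt; apply/orP; left; apply/eqP; ring.
have down d' f' (u : V -> R) : (forall p, `|u p| <= nrm1 p) ->
  (exists2 C : R, 0 <= C & forall p, sqn p != 0 -> nrm1 p <= 1 ->
     `|f' p| <= C * nrm1 p ^ d' * lam k (sqn p)) ->
  (exists2 C : R, 0 <= C & forall p, sqn p != 0 -> nrm1 p <= 1 ->
     `|u p / sqn p * f' p| <= C * nrm1 p ^ (d' - 1) * lam k (sqn p)).
  move=> hu [C C0 H]; exists (2 * C); first by rewrite mulr_ge0.
  move=> p p0 p1; rewrite normrM.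
  rewrite expfzDr ?gt_eqF ?nrm1_gt0 //.
  apply: le_trans (ler_pM _ _ (coord_inv_bound p0 (hu p)) (H p p0 p1)) _ => //.
  by rewrite exprN1 le_eqVlt; apply/orP; left; apply/eqP; ring.
elim=> [|{}d {}f _ IH|{}d {}f _ IH|{}d {}f _ IH|{}d {}f _ IH
  |{}d {}f _ [C C0 IH]|{}d {}f _ [C C0 IH]|{}d c {}f _ [C C0 IH]
  |{}d {}f g _ [C C0 H] _ [C' C0' H']|{}d {}f _ [C C0 IH]].
- by exists 1 => // p p0 p1; rewrite expr0z !mul1r ger0_norm // lam_ge0 // sqn_ge0.
- exact: up.
- exact: up.
- exact: down.
- exact: down.
- exists C => // p p0 p1; rewrite normrM -[leRHS]mul1r.
  rewrite ler_pM // ?IH // ger0_norm ?damp_le1 ?damp_ge0 ?sqn_ge0 //.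
- exists C => // p p0 p1; rewrite normrM -[leRHS]mul1r.
  by rewrite ler_pM // ?IH // ger0_norm ?lam_ge0 ?(ltW (lam_lt1 _ _)) ?sqn_ge0.
- exists (`|c| * C); first by rewrite mulr_ge0.
  by move=> p p0 p1; rewrite normrM -!mulrA ler_wpM2l // mulrA IH.
- exists (C + C'); first by rewrite addr_ge0.
  move=> p p0 p1; apply: le_trans (ler_normD _ _) _.
  by rewrite !mulrDl lerD // ?H ?H'.
- exists C => // p p0 p1; apply: le_trans (IH p p0 p1) _.
  rewrite ler_wpM2r ?lam_ge0 ?sqn_ge0 // ler_wpM2l //.
  by rewrite expfzDr ?gt_eqF ?nrm1_gt0 // expr1z ler_piMr // exprz_ge0 // nrm1_ge0.
Qed.

Lemma is_derive_sqn p v :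
  is_derive p v sqn (2 * (p 0 a * v 0 a + p 0 b * v 0 b)).
Proof.
have A := is_derive_mul (is_derive_coord a p v) (is_derive_coord a p v).
have B := is_derive_mul (is_derive_coord b p v) (is_derive_coord b p v).
have C := is_derive_add A B.
have -> : sqn = (fun p => p 0 a * p 0 a + p 0 b * p 0 b).
  by apply/funext => q; rewrite /sqn !expr2.
by refine (is_derive_eq C _); ring.
Qed.

(** Differentiating a generator returns combinations of generators, the loss of one degree coming
    from the logarithmic derivative of [sqn]. This is why the class contains x/|z|^2, y/|z|^2 and
    the factor [damp]. *)
Lemma flat_derive d f v : flat d f -> exists2 g, flat (d - 1) g &
  forall p, sqn p != 0 -> is_derive p v f (g p).
Proof.
(* The derivative of ln sqn along v, a combination of the two factors of degree -1. *)
pose dt p := 2 * (p 0 a / sqn p * v 0 a + p 0 b / sqn p * v 0 b).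
have mulE f' g' (u : V -> R) (du : R) p : is_derive p v u du -> is_derive p v f' (g' p) ->
  is_derive p v (fun p => u p * f' p) (u p * g' p + du * f' p).
  by move=> hu hf; exact: is_derive_mul.
have flat_dt d' f' : flat d' f' -> flat (d' - 1) (fun p => dt p * f' p).
  move=> h; have -> : (fun p => dt p * f' p) = (fun p => (2 * v 0 a) *
      (p 0 a / sqn p * f' p) + (2 * v 0 b) * (p 0 b / sqn p * f' p)).
    by apply/funext => p; rewrite /dt; ring.
  by apply: flat_add; apply: flat_scale; [exact: flat_xinv|exact: flat_yinv].
have Dlam p : sqn p != 0 -> is_derive p v (fun p => lam k (sqn p))
    (dt p * (k%:R * (damp k (sqn p) * (lam k (sqn p) * lam k (sqn p))))).
  move=> p0; have s0 : 0 < sqn p by rewrite lt_neqAle sqn_ge0 eq_sym p0.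
  refine (is_derive_eq (is_derive_chain (is_derive_lam k_gt0 s0) (is_derive_sqn p v)) _).
  by rewrite /dt; field.
have Ddamp p : sqn p != 0 -> is_derive p v (fun p => damp k (sqn p))
    (dt p * (- k%:R * (sqn p ^+ k * (damp k (sqn p) * damp k (sqn p))))).
  move=> p0; refine (is_derive_eq (is_derive_chain (is_derive_damp k (sqn_ge0 p)) (is_derive_sqn p v)) _).
  have -> : sqn p ^+ k = sqn p * sqn p ^+ k.-1 by rewrite -exprS prednK.
  by rewrite /dt; field.
have Dx p : is_derive p v (fun p => p 0 a) (v 0 a) by exact: is_derive_coord.
have Dy p : is_derive p v (fun p => p 0 b) (v 0 b) by exact: is_derive_coord.
have Dinv (c : 'I_m) p : sqn p != 0 -> is_derive p v (fun p => p 0 c / sqn p)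
    (v 0 c * ((p 0 a / sqn p) ^+ 2 + (p 0 b / sqn p) ^+ 2) - (p 0 c / sqn p) * dt p).
  move=> p0; have A := is_derive_inv p0 (is_derive_sqn p v).
  refine (is_derive_eq (is_derive_mul (is_derive_coord c p v) A) _).
  (* Writing 1/|z|^2 as this sum of squares expresses it by the factors allowed in [flat]. *)
  have E : (p 0 a / sqn p) ^+ 2 + (p 0 b / sqn p) ^+ 2 = (sqn p)^-1.
    have -> : (p 0 a / sqn p) ^+ 2 + (p 0 b / sqn p) ^+ 2 =
      (p 0 a ^+ 2 + p 0 b ^+ 2) / sqn p / sqn p by field.
    by rewrite -/(sqn p) divff // div1r.
  by rewrite E /dt; field.
have flat_sub1 d' f' : flat d' f' -> flat (d' + 1 - 1) f'.
  by apply: flat_eq; lia.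
have flatinv (c : 'I_m) d' f' g' : (c = a) \/ (c = b) -> flat d' f' -> flat (d' - 1) g' ->
   flat (d' - 1 - 1) (fun p => p 0 c / sqn p * g' p +
    (v 0 c * ((p 0 a / sqn p) ^+ 2 + (p 0 b / sqn p) ^+ 2) - (p 0 c / sqn p) * dt p) * f' p).
  move=> hc hf hg.
  have hcinv d'' f'' : flat d'' f'' -> flat (d'' - 1) (fun p => p 0 c / sqn p * f'' p).
    by case: hc => ->; [exact: flat_xinv|exact: flat_yinv].
  apply: flat_add; first exact: hcinv.
  have -> : (fun p => (v 0 c * ((p 0 a / sqn p) ^+ 2 + (p 0 b / sqn p) ^+ 2)
       - (p 0 c / sqn p) * dt p) * f' p) =
    (fun p => v 0 c * (p 0 a / sqn p * (p 0 a / sqn p * f' p)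
        + p 0 b / sqn p * (p 0 b / sqn p * f' p)) +
      -1 * (p 0 c / sqn p * (dt p * f' p))).
    by apply/funext => p; ring.
  apply: flat_add; apply: flat_scale; last by apply: hcinv; exact: flat_dt.
  by apply: flat_add; [do 2 apply: flat_xinv|do 2 apply: flat_yinv].
elim=> [|{}d {}f hf [g hg IH]|{}d {}f hf [g hg IH]|{}d {}f hf [g hg IH]|{}d {}f hf [g hg IH]
  |{}d {}f hf [g hg IH]|{}d {}f hf [g hg IH]|{}d c {}f hf [g hg IH]
  |{}d {}f g0 hf [g hg H] _ [g' hg' H']|{}d {}f hf [g hg IH]].
- eexists; last by move=> p p0; exact: Dlam.
  apply: flat_dt; apply: flat_scale; apply: flat_damp; apply: flat_mullam.
  exact: flat_lam.
- exists (fun p => p 0 a * g p + v 0 a * f p); last by move=> p p0; apply: mulE => //; exact: IH.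
  apply: flat_add; first by apply: (flat_eq _ (flat_x hg)); lia.
  by apply: flat_sub1; exact: flat_scale.
- exists (fun p => p 0 b * g p + v 0 b * f p); last by move=> p p0; apply: mulE => //; exact: IH.
  apply: flat_add; first by apply: (flat_eq _ (flat_y hg)); lia.
  by apply: flat_sub1; exact: flat_scale.
- eexists; last by move=> p p0; apply: mulE; [exact: Dinv|exact: IH].
  by apply: flatinv => //; left.
- eexists; last by move=> p p0; apply: mulE; [exact: Dinv|exact: IH].
  by apply: flatinv => //; right.
- eexists; last by move=> p p0; apply: mulE; [exact: Ddamp|exact: IH].
  apply: flat_add; first exact: flat_damp.
  have -> : (fun p => dt p * (- k%:R * (sqn p ^+ k * (damp k (sqn p) * damp k (sqn p)))) * f p)
    = (fun p => dt p * ((- k%:R) * (sqn p ^+ k * (damp k (sqn p) * (damp k (sqn p) * f p))))).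
    by apply/funext => p; ring.
  (* The factor sqn^k from the derivative of [damp] raises the degree by 2k; the surplus is given
     up. *)
  apply: flat_dt; apply: flat_scale; apply: (@flat_weakenn _ (2 * k)).
  by apply: flat_sqnX; do 2 apply: flat_damp.
- eexists; last by move=> p p0; apply: mulE; [exact: Dlam|exact: IH].
  apply: flat_add; first exact: flat_mullam.
  have -> : (fun p => dt p * (k%:R * (damp k (sqn p) * (lam k (sqn p) * lam k (sqn p)))) * f p)
    = (fun p => dt p * (k%:R * (damp k (sqn p) * (lam k (sqn p) * (lam k (sqn p) * f p))))).
    by apply/funext => p; ring.
  by apply: flat_dt; apply: flat_scale; apply: flat_damp; do 2 apply: flat_mullam.
- exists (fun p => c * g p); first exact: flat_scale.
  by move=> p p0; apply: is_derive_scale; exact: IH.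
- exists (fun p => g p + g' p); first exact: flat_add.
  by move=> p p0; apply: is_derive_add; [exact: H|exact: H'].
- by exists g => //; apply: flat_weaken; apply: flat_eq hg; lia.
Qed.

End FlatFunctions.

Section FlatRegularity.
Variables (R : realType) (k : nat) (k_gt0 : (0 < k)%N) (m : nat) (a b : 'I_m).
Local Notation V := 'rV[R]_m.
Implicit Types (f g : V -> R) (p q v : V) (d : int).

Lemma continuous_for_add f g p : {for p, continuous f} -> {for p, continuous g} ->
  {for p, continuous (fun q => f q + g q)}.
Proof. by move=> cf cg; exact: continuousD. Qed.

Lemma continuous_for_mul f g p : {for p, continuous f} -> {for p, continuous g} ->
  {for p, continuous (fun q => f q * g q)}.
Proof. by move=> cf cg; exact: continuousM. Qed.

Lemma continuous_for_comp (phi : R -> R) f p : {for p, continuous f} ->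
  {for f p, continuous phi} -> {for p, continuous (fun q => phi (f q))}.
Proof. by move=> cf cg; exact: continuous_comp. Qed.

Lemma continuous_sqn : continuous (sqn a b : V -> R).
Proof.
move=> p; have c (i : 'I_m) := @continuous_coord R m i p.
have -> : sqn a b = (fun p => p 0 a * p 0 a + p 0 b * p 0 b).
  by apply/funext => q; rewrite /sqn !expr2.
by apply: continuous_for_add; apply: continuous_for_mul; exact: c.
Qed.

Lemma continuous_nrm1 : continuous (nrm1 a b : V -> R).
Proof.
move=> p; have c (i : 'I_m) := @continuous_coord R m i p.
by apply: continuous_for_add; exact: (cvg_norm (c _)).
Qed.

Lemma is_derive1_continuous (phi : R -> R) (t dphi : R) :
  is_derive t 1 phi dphi -> {for t, continuous phi}.
Proof.
by case=> H _; apply: differentiable_continuous; apply/derivable1_diffP.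
Qed.

Lemma flat_continuous_off d f p : flat k a b d f -> sqn a b p != 0 -> {for p, continuous f}.
Proof.
move=> hf p0; have c (i : 'I_m) := @continuous_coord R m i p.
have s0 : 0 < sqn a b p by rewrite lt_neqAle sqn_ge0 eq_sym p0.
have cl : {for p, continuous (fun q => lam k (sqn a b q))}.
  apply: (@continuous_for_comp (lam k) (sqn a b)); first exact: continuous_sqn.
  by apply: is_derive1_continuous; exact: is_derive_lam.
have cd : {for p, continuous (fun q => damp k (sqn a b q))}.
  apply: (@continuous_for_comp (damp k) (sqn a b)); first exact: continuous_sqn.
  by apply: is_derive1_continuous; apply: is_derive_damp; exact: sqn_ge0.
have ci (i : 'I_m) : {for p, continuous (fun q : V => q 0 i / sqn a b q)}.
  by apply: continuous_for_mul; [exact: c|apply: continuousV => //; exact: continuous_sqn].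
elim: hf => [//|{}d {}f _ IH|{}d {}f _ IH|{}d {}f _ IH|{}d {}f _ IH
  |{}d {}f _ IH|{}d {}f _ IH|{}d e {}f _ IH|{}d {}f g _ IH _ IH'|//].
- by apply: continuous_for_mul => //; exact: c.
- by apply: continuous_for_mul => //; exact: c.
- by apply: continuous_for_mul => //; exact: ci.
- by apply: continuous_for_mul => //; exact: ci.
- exact: continuous_for_mul.
- exact: continuous_for_mul.
- by apply: continuous_for_mul => //; exact: cst_continuous.
- exact: continuous_for_add.
Qed.

Lemma sqn0_nrm1 p : sqn a b p = 0 -> nrm1 a b p = 0.
Proof. by move=> /sqn_eq0[h1 h2]; rewrite /nrm1 h1 h2 normr0 addr0. Qed.

Lemma continuous_near_lt f p (c : R) : {for p, continuous f} -> f p < c ->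
  \forall q \near p, f q < c.
Proof. by move=> cf h; exact: (@cvgr_lt _ _ (nbhs p) _ f (f p) cf c h). Qed.

(** In degree 0 the homogeneous bound gives no decay; continuity at [sqn = 0] comes from [lam]
    tending to 0 alone. *)
Lemma flat0_continuous f : flat k a b 0 f -> continuous f.
Proof.
move=> hf p; have [p0|] := eqVneq (sqn a b p) 0; last exact: (flat_continuous_off hf).
have [C C0 HC] := flat_bound hf.
apply: (proj2 (@cvgrPdist_lt R R V (nbhs p) _ f (f p))) => e e0.
have eC : 0 < e / (C + 1) by rewrite divr_gt0 // ltr_wpDl.
have [d d0 Hd] := lam_small k_gt0 eC.
near=> q; rewrite (flat_vanish hf p0) sub0r normrN.
have [q0|q0] := eqVneq (sqn a b q) 0; first by rewrite (flat_vanish hf q0) normr0.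
have q1 : nrm1 a b q <= 1.
  apply/ltW; near: q; apply: continuous_near_lt; first exact: continuous_nrm1.
  by rewrite sqn0_nrm1.
apply: le_lt_trans (HC q q0 q1) _; rewrite expr0z mulr1.
have l0 : lam k (sqn a b q) < e / (C + 1).
  apply: Hd; first exact: sqn_ge0.
  near: q; apply: continuous_near_lt; first exact: continuous_sqn.
  by rewrite p0.
have lp : 0 <= lam k (sqn a b q) by rewrite lam_ge0 // sqn_ge0.
by move: l0; rewrite ltr_pdivlMr ?ltr_wpDl //; nra.
Unshelve. all: by end_near.
Qed.

(** With p on the zero set, nrm1 (p + h v) = |h| nrm1 v, so a bound of degree 1 makes the difference
    quotient at most a constant times [lam], which tends to 0. *)
Lemma flat1_derive0 f p v : flat k a b 1 f -> sqn a b p = 0 -> is_derive p v f 0.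
Proof.
move=> hf p0; have [C C0 HC] := flat_bound hf.
have f0 := flat_vanish hf p0.
have [pa pb] := sqn_eq0 p0.
have H : (fun h : R => h^-1 *: ((f \o shift p) (h *: v) - f p)) @ 0^' --> (0 : R).
  apply/cvgrPdist_lt => e e0; pose B := nrm1 a b v.
  have B0 : 0 <= B := nrm1_ge0 a b v.
  have eC : 0 < e / (C * B + 1) by rewrite divr_gt0 // ltr_wpDl // mulr_ge0.
  have [d d0 Hd] := lam_small k_gt0 eC.
  have cc : continuous (fun h : R => h *: v + p).
    by move=> h; apply: cvgD; [exact: scalel_continuous|exact: cvg_cst].
  have c0 : (fun h : R => h *: v + p) @ (0 : R) --> (p : V).
    by have := cc 0; rewrite /continuous_at scale0r add0r.
  have N1 : \forall q \near p, nrm1 a b q < 1.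
    by apply: continuous_near_lt; [exact: continuous_nrm1|rewrite sqn0_nrm1].
  have N2 : \forall q \near p, sqn a b q < d.
    by apply: continuous_near_lt; [exact: continuous_sqn|rewrite p0].
  have M1 : \forall h \near (0 : R)^', nrm1 a b (h *: v + p) < 1.
    exact: (@nbhs_dnbhs _ (0 : R) _ (c0 _ N1)).
  have M2 : \forall h \near (0 : R)^', sqn a b (h *: v + p) < d.
    exact: (@nbhs_dnbhs _ (0 : R) _ (c0 _ N2)).
  near=> h.
  have h0 : h != 0 by near: h; exact: nbhs_dnbhs_neq.
  have q1 : nrm1 a b (h *: v + p) <= 1 by apply/ltW; near: h; exact: M1.
  have qd : sqn a b (h *: v + p) < d by near: h; exact: M2.
  move: q1 qd; set q := h *: v + p => q1 qd.
  rewrite sub0r normrN /= -/q f0 subr0 /GRing.scale /= normrM normfV mulrC.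
  have h1 : 0 < `|h| by rewrite normr_gt0.
  rewrite ltr_pdivrMr //.
  have [q0|q0] := eqVneq (sqn a b q) 0.
    by rewrite (flat_vanish hf q0) normr0 mulr_gt0.
  apply: le_lt_trans (HC q q0 q1) _; rewrite expr1z.
  have -> : nrm1 a b q = `|h| * B.
    by rewrite /nrm1 /q !mxE pa pb !addr0 !normrM -mulrDr.
  have l0 := Hd _ (sqn_ge0 a b q) qd.
  have lp : 0 <= lam k (sqn a b q) by rewrite lam_ge0 // sqn_ge0.
  have CB : 0 <= C * B by rewrite mulr_ge0.
  have -> : C * (`|h| * B) * lam k (sqn a b q) = (C * B * lam k (sqn a b q)) * `|h| by ring.
  rewrite ltr_pM2r //.
  by move: l0; rewrite ltr_pdivlMr ?ltr_wpDl //; nra.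
apply: DeriveDef; first by apply/cvg_ex; exists 0.
exact: cvg_lim.
Unshelve. all: by end_near.
Qed.

Lemma flat_Ck (n : nat) f : flat k a b n%:Z f -> Ck_on n setT f.
Proof.
elim: n f => [f hf p _|n IH f hf]; first exact: flat0_continuous.
apply/Ck_onS; split.
  by apply: flat0_continuous; apply: (flat_weakenn k_gt0 (n := n.+1)); apply: flat_eq hf; lia.
move=> i; have [g hg Hg] := flat_derive k_gt0 (basisv R i) hf.
have hg' : flat k a b n%:Z g by apply: flat_eq hg; lia.
exists g; split; last exact: IH.
(* On [sqn = 0] the formula for [g] takes the value 0 by [flat_vanish], and this is the true
   derivative there. *)
move=> p; have [p0|p0] := eqVneq (sqn a b p) 0; last exact: Hg.
rewrite (flat_vanish hg p0); apply: flat1_derive0 => //.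
by apply: (flat_weakenn k_gt0 (n := n)); apply: flat_eq hf; lia.
Qed.

End FlatRegularity.

Section SquaredNorm.
Variable R : realType.
Implicit Types z w : R[i].

Definition nsq z : R := Re z ^+ 2 + Im z ^+ 2.

Lemma nsq_ge0 z : 0 <= nsq z. Proof. by rewrite addr_ge0 ?sqr_ge0. Qed.

Lemma nsqM z w : nsq (z * w) = nsq z * nsq w.
Proof. by case: z w => [a b] [c d]; rewrite /nsq /=; ring. Qed.

Lemma nsqX z n : nsq (z ^+ n) = nsq z ^+ n.
Proof.
elim: n => [|n IH]; first by rewrite /nsq /= !expr0 /= expr1n expr0n /= addr0.
by rewrite !exprS nsqM IH.
Qed.

Lemma nsq_real (c : R) : nsq c%:C%C = c ^+ 2.
Proof. by rewrite /nsq /= expr0n addr0. Qed.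

End SquaredNorm.

(** * The almost complex structure *)

Section Structure.
Variables (R : realType) (k : nat).
Hypothesis k_gt0 : (0 < k)%N.
Implicit Types (x y : R).

Definition sq2 x y : R := x ^+ 2 + y ^+ 2.

(** This is t ell'(t) for the iterated logarithm [ell] introduced with the contour argument. *)
Definition psi x y : R := - (2^-1 * (damp k (sq2 x y) * lam k (sq2 x y))).

(* In the complex coordinate [z = x + i y] of a pair the structure is [w_{\bar z} = mu w_z] with [mu = Qb / (1 + qb)], where
   [qb = z^k psi], [Qb = z^(k+2) psi / |z|^2]. *)
Definition qb x y : R[i] := (Complex x y) ^+ k * (psi x y)%:C%C.

Definition Qb x y : R[i] :=
  Complex x y * (Complex (x / sq2 x y) (y / sq2 x y) * qb x y).

(** In real variables w_zbar = mu w_z reads [denJ] w_y = i [numJ] w_x. *)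
Definition numJ x y : R[i] := 1 + qb x y - Qb x y.
Definition denJ x y : R[i] := 1 + qb x y + Qb x y.

(** The real part of [numJ] times the conjugate of [denJ]; its positivity expresses |mu| < 1. *)
Definition detJ x y : R := nsq (1 + qb x y) - nsq (Qb x y).

(** Substitute w_y = i ([numJ]/[denJ]) w_x in w_x Jxx + w_y Jyx = i w_x, the first entry of dw J = i
    dw: the imaginary part gives [Jyx] and the real part [Jxx]; then [Jxy] follows from trace 0 and
    determinant 1. *)
Definition Jxx x y : R :=
  (Im (numJ x y) * Re (denJ x y) - Re (numJ x y) * Im (denJ x y)) / detJ x y.
Definition Jxy x y : R := - (nsq (numJ x y) / detJ x y).
Definition Jyx x y : R := nsq (denJ x y) / detJ x y.

(** The extra factor z^2/|z|^2 has modulus 1 off the origin, and is 0 at the origin by the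
    convention 0^-1 = 0. *)
Lemma nsq_Qb x y : nsq (Qb x y) <= nsq (qb x y).
Proof.
rewrite /Qb; move: (qb x y) => q; rewrite !nsqM mulrA.
have [s0|s0] := eqVneq (sq2 x y) 0.
  rewrite s0 !invr0 !mulr0 [nsq (Complex 0 0)]/nsq /= expr0n /= addr0 mulr0 mul0r.
  exact: nsq_ge0.
suff -> : nsq (Complex x y) * nsq (Complex (x / sq2 x y) (y / sq2 x y)) = 1.
  by rewrite mul1r.
rewrite /nsq /= -/(sq2 x y).
have -> : (x / sq2 x y) ^+ 2 + (y / sq2 x y) ^+ 2 = sq2 x y / sq2 x y / sq2 x y.
  by rewrite {3}/sq2; field.
by field.
Qed.

Lemma sq2_ge0 x y : 0 <= sq2 x y. Proof. by rewrite addr_ge0 ?sqr_ge0. Qed.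

(** |q|^2 is t^k damp^2 lam^2 / 4; the exponent k inside [damp] makes t^k damp^2 <= 1 for all t >=
    0, and [lam < 1] gives strictness. *)
Lemma nsq_qb x y : nsq (qb x y) < 4^-1.
Proof.
rewrite /qb nsqM nsqX nsq_real /psi /nsq /= -/(sq2 x y).
have t0 := sq2_ge0 x y; set t := sq2 x y in t0 *.
have l0 := lam_ge0 k t0; have l1 := lam_lt1 k t0.
have tk0 : 0 <= t ^+ k by rewrite exprn_ge0.
have ts : t ^+ k * damp k t ^+ 2 <= 1.
  have d0 : 0 < 1 + t ^+ k by rewrite damp_denom_gt0.
  rewrite /damp exprVn ler_pdivrMr ?exprn_gt0 // mul1r; nra.
have -> : t ^+ k * (- (2^-1 * (damp k t * lam k t))) ^+ 2 =
  (t ^+ k * damp k t ^+ 2) * lam k t ^+ 2 * 4^-1 by field.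
have l2 : lam k t ^+ 2 < 1 by rewrite expr2; nra.
have l3 : 0 <= lam k t ^+ 2 by rewrite sqr_ge0.
have m0 : 0 <= t ^+ k * damp k t ^+ 2 by rewrite mulr_ge0 // sqr_ge0.
have := ler_piMl l3 ts; lra.
Qed.

(** |Q| <= |q| < 1/2 < |1 + q|. *)
Lemma detJ_gt0 x y : 0 < detJ x y.
Proof.
have := nsq_Qb x y; have := nsq_qb x y; rewrite /detJ.
case: (qb x y) => q1 q2; set N := nsq (Qb x y).
rewrite /nsq /= !add0r => h1 h2; nra.
Qed.

Lemma detJE x y : Re (numJ x y) * Re (denJ x y) + Im (numJ x y) * Im (denJ x y) = detJ x y.
Proof.
rewrite /numJ /denJ /detJ; case: (qb x y) => q1 q2; case: (Qb x y) => u v.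
by rewrite /nsq /=; ring.
Qed.

Lemma Jsquare x y : Jxx x y ^+ 2 + Jxy x y * Jyx x y = -1.
Proof.
have d0 : detJ x y != 0 by rewrite gt_eqF // detJ_gt0.
rewrite /Jxx /Jxy /Jyx /nsq; move: (detJE x y).
set n1 := Re _; set n2 := Im _; set d1 := Re _; set d2 := Im _; set D := detJ x y.
move=> E; have -> : ((n2 * d1 - n1 * d2) / D) ^+ 2 +
  - ((n1 ^+ 2 + n2 ^+ 2) / D) * ((d1 ^+ 2 + d2 ^+ 2) / D) =
   - ((n1 * d1 + n2 * d2) / D) ^+ 2 by field.
by rewrite E divff // expr1n.
Qed.

Variable n : nat.
Local Notation V := 'rV[R]_(n + n).
Implicit Types (p : V) (j : 'I_n).

Definition xc p j : R := p 0 (lshift n j).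
Definition yc p j : R := p 0 (rshift n j).

(** The coordinates are ordered as all x followed by all y, so the 2 x 2 block of a pair is spread
    over four diagonal matrices. *)
Definition Jst p : 'M[R]_(n + n) := block_mx
  (diag_mx (\row_j Jxx (xc p j) (yc p j))) (diag_mx (\row_j Jxy (xc p j) (yc p j)))
  (diag_mx (\row_j Jyx (xc p j) (yc p j))) (diag_mx (\row_j - Jxx (xc p j) (yc p j))).

Lemma Jst_almost_complex : almost_complex Jst.
Proof.
move=> p; rewrite /Jst mulmx_block !mulmx_diag -!raddfD /=.
have -> : - 1%:M = block_mx (- 1%:M) 0 0 (- 1%:M) :> 'M[R]_(n + n).
  by rewrite (@scalar_mx_block _ n n 1) opp_block_mx !oppr0.
have D0 : diag_mx (0 : 'rV[R]_n) = 0 by rewrite raddf0.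
have D1 : diag_mx (\row_(j < n) (-1 : R)) = - 1%:M :> 'M[R]_n.
  by apply/matrixP => i j; rewrite !mxE mulNrn.
rewrite -D0 -D1; congr block_mx; congr diag_mx; apply/rowP => j; rewrite !mxE;
  have := Jsquare (xc p j) (yc p j); set a := Jxx _ _; set b := Jxy _ _; set c := Jyx _ _ => E.
- by rewrite -E expr2.
- by ring.
- by ring.
- by rewrite -E expr2; ring.
Qed.

Section CkEntries.
Variable j : 'I_n.
Let a := lshift n j.
Let b := rshift n j.
Local Notation fl := (flat k a b).

Lemma flat_zpow d (f : V -> R) m : fl d f ->
  fl (d + m%:Z) (fun p => Re (Complex (xc p j) (yc p j) ^+ m) * f p) /\
  fl (d + m%:Z) (fun p => Im (Complex (xc p j) (yc p j) ^+ m) * f p).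
Proof.
move=> hf; elim: m => [|m [IHr IHi]].
  split; first by under eq_fun do rewrite expr0 /= mul1r; rewrite addr0.
  by under eq_fun do rewrite expr0 /=; rewrite addr0; exact: flat_scale.
split.
  have -> : (fun p => Re (Complex (xc p j) (yc p j) ^+ m.+1) * f p) =
    (fun p => p 0 a * (Re (Complex (xc p j) (yc p j) ^+ m) * f p) +
       -1 * (p 0 b * (Im (Complex (xc p j) (yc p j) ^+ m) * f p))).
    apply/funext => p; rewrite exprS; case: (_ ^+ m) => u v /=.
    by rewrite /xc /yc -/a -/b; ring.
  apply: flat_add; last apply: flat_scale.
    by apply: (flat_eq _ (flat_x IHr)); lia.
  by apply: (flat_eq _ (flat_y IHi)); lia.
have -> : (fun p => Im (Complex (xc p j) (yc p j) ^+ m.+1) * f p) =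
  (fun p => p 0 a * (Im (Complex (xc p j) (yc p j) ^+ m) * f p) +
      p 0 b * (Re (Complex (xc p j) (yc p j) ^+ m) * f p)).
  apply/funext => p; rewrite exprS; case: (_ ^+ m) => u v /=.
  by rewrite /xc /yc -/a -/b; ring.
apply: flat_add.
  by apply: (flat_eq _ (flat_x IHi)); lia.
by apply: (flat_eq _ (flat_y IHr)); lia.
Qed.

Lemma flat_qb : fl k%:Z (fun p => Re (qb (xc p j) (yc p j))) /\
  fl k%:Z (fun p => Im (qb (xc p j) (yc p j))).
Proof.
have hf : fl 0 (fun p => - 2^-1 * (damp k (sqn a b p) * lam k (sqn a b p))).
  by apply: flat_scale; apply: flat_damp; exact: flat_lam.
have [h1 h2] := flat_zpow k hf; rewrite add0r in h1 h2.
split; [move: h1|move: h2]; congr flat; apply/funext => p;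
  rewrite /qb; case: (_ ^+ k) => u v /=; rewrite /psi /sqn /sq2 -/a -/b /xc /yc -/a -/b; ring.
Qed.

(** The factor z^2/|z|^2, discontinuous at 0, is split as z times z/|z|^2, of degrees 1 and -1, so
    no degree is lost. *)
Lemma flat_Qb : fl k%:Z (fun p => Re (Qb (xc p j) (yc p j))) /\
  fl k%:Z (fun p => Im (Qb (xc p j) (yc p j))).
Proof.
have [h1 h2] := flat_qb.
pose X (f : V -> R) p := p 0 a / sqn a b p * f p.
pose Y (f : V -> R) p := p 0 b / sqn a b p * f p.
have HX f : fl k%:Z f -> fl (k%:Z - 1) (X f) by exact: flat_xinv.
have HY f : fl k%:Z f -> fl (k%:Z - 1) (Y f) by exact: flat_yinv.
have fx d f : fl (d - 1) f -> fl d (fun p => p 0 a * f p).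
  by move=> h; apply: (flat_eq _ (flat_x h)); lia.
have fy d f : fl (d - 1) f -> fl d (fun p => p 0 b * f p).
  by move=> h; apply: (flat_eq _ (flat_y h)); lia.
have fB d f g : fl d f -> fl d g -> fl d (fun p => f p + -1 * g p).
  by move=> hf hg; apply: flat_add => //; exact: flat_scale.
set q1 := (fun p => Re _) in h1; set q2 := (fun p => Im _) in h2.
split.
  have := fB _ _ _ (fx _ _ (fB _ _ _ (HX _ h1) (HY _ h2)))
     (fy _ _ (flat_add (HX _ h2) (HY _ h1))).
  congr flat; apply/funext => p; rewrite /X /Y /q1 /q2 /Qb /sqn /sq2 /xc /yc -/a -/b.
  by case: (qb _ _) => u v /=; ring.
have := flat_add (fx _ _ (flat_add (HX _ h2) (HY _ h1)))
   (fy _ _ (fB _ _ _ (HX _ h1) (HY _ h2))).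
congr flat; apply/funext => p; rewrite /X /Y /q1 /q2 /Qb /sqn /sq2 /xc /yc -/a -/b.
by case: (qb _ _) => u v /=; ring.
Qed.

Lemma Ck_entries :
  Ck_on k setT (fun p => Jxx (xc p j) (yc p j)) /\
  Ck_on k setT (fun p => Jxy (xc p j) (yc p j)) /\
  Ck_on k setT (fun p => Jyx (xc p j) (yc p j)).
Proof.
have [/(flat_Ck k_gt0) q1 /(flat_Ck k_gt0) q2] := flat_qb.
have [/(flat_Ck k_gt0) Q1 /(flat_Ck k_gt0) Q2] := flat_Qb.
have C1 : Ck_on k setT (fun _ : V => 1 : R) := Ck_on_cst _ k 1.
have sq f : Ck_on k setT f -> Ck_on k setT (fun p : V => f p ^+ 2).
  by move=> h; under eq_fun do rewrite expr2; exact: Ck_on_mul.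
have CN := fun f (h : Ck_on k setT f) => @Ck_on_opp R (n + n) k f h.
have CD f g (h : Ck_on k setT f) (h' : Ck_on k setT g) := @Ck_on_add R (n + n) k f g h h'.
have n1 : Ck_on k setT (fun p => Re (numJ (xc p j) (yc p j))).
  have := CD _ _ (CD _ _ C1 q1) (CN _ Q1); congr Ck_on; apply/funext => p.
  by rewrite /numJ; case: (qb _ _) => ? ?; case: (Qb _ _) => ? ?.
have n2 : Ck_on k setT (fun p => Im (numJ (xc p j) (yc p j))).
  have := CD _ _ q2 (CN _ Q2); congr Ck_on; apply/funext => p.
  by rewrite /numJ; case: (qb _ _) => ? ?; case: (Qb _ _) => ? ? /=; rewrite add0r.
have d1 : Ck_on k setT (fun p => Re (denJ (xc p j) (yc p j))).
  have := CD _ _ (CD _ _ C1 q1) Q1; congr Ck_on; apply/funext => p.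
  by rewrite /denJ; case: (qb _ _) => ? ?; case: (Qb _ _) => ? ?.
have d2 : Ck_on k setT (fun p => Im (denJ (xc p j) (yc p j))).
  have := CD _ _ q2 Q2; congr Ck_on; apply/funext => p.
  by rewrite /denJ; case: (qb _ _) => ? ?; case: (Qb _ _) => ? ? /=; rewrite add0r.
have D : Ck_on k setT (fun p => detJ (xc p j) (yc p j)).
  under eq_fun do rewrite -detJE.
  by apply: CD; apply: Ck_on_mul.
have Di : Ck_on k setT (fun p => (detJ (xc p j) (yc p j))^-1).
  by apply: Ck_on_inv D => p; rewrite gt_eqF // detJ_gt0.
split; [|split].
- apply: Ck_on_mul Di; apply: CD; first exact: Ck_on_mul.
  by apply: CN; exact: Ck_on_mul.
- by apply: CN; apply: Ck_on_mul Di; apply: CD; exact: sq.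
- by apply: Ck_on_mul Di; apply: CD; exact: sq.
Qed.

End CkEntries.

Lemma Jst_Ck : Ck_structure k Jst.
Proof.
have diagC (f : V -> 'I_n -> R) : (forall j, Ck_on k setT (f ^~ j)) ->
    forall i j, Ck_on k setT (fun p => diag_mx (\row_l f p l) i j).
  move=> H i j; have -> : (fun p => diag_mx (\row_l f p l) i j) =
     (fun p => f p j * (i == j)%:R).
    by apply/funext => p; rewrite !mxE; case: eqP => [->|_]; rewrite ?mulr1 ?mulr0.
  by apply: Ck_on_mul => //; exact: Ck_on_cst.
move=> a b; rewrite /Jst; case: (split_ordP a) => i ->; case: (split_ordP b) => j ->.
- under eq_fun do rewrite block_mxEul.
  by apply: diagC => l; case: (Ck_entries l).
- under eq_fun do rewrite block_mxEur.
  by apply: diagC => l; case: (Ck_entries l) => _ [].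
- under eq_fun do rewrite block_mxEdl.
  by apply: diagC => l; case: (Ck_entries l) => _ [].
- under eq_fun do rewrite block_mxEdr.
  by apply: diagC => l; apply: Ck_on_opp; case: (Ck_entries l).
Qed.

End Structure.

(** * Integrability *)

Section Integrability.
Variables (R : realType) (k n : nat).
Hypothesis k_gt0 : (0 < k)%N.
Local Notation V := 'rV[R]_(n + n).
Local Notation J := (@Jst R k n).
Implicit Types (f g h : V -> R) (X Y Z : vfield R (n + n)) (p : V) (j : 'I_n).

Definition dirD Z f p : R := \sum_d Z p d 0 * partial d f p.

Definition pderivable f p := forall d, derivable f p (basisv R d).

Lemma partial_is_derive f p d df : is_derive p (basisv R d) f df -> partial d f p = df.
Proof. by move=> H; apply: derive_val. Qed.

Lemma dirD_mul Z f g p : pderivable f p -> pderivable g p ->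
  dirD Z (fun q => f q * g q) p = f p * dirD Z g p + dirD Z f p * g p.
Proof.
move=> hf hg; rewrite /dirD mulr_sumr mulr_suml -big_split; apply: eq_bigr => d _ /=.
have H := is_derive_mul (derivableP (hf d)) (derivableP (hg d)).
by rewrite (partial_is_derive H) /partial; ring.
Qed.

Lemma dirD_add Z f g p : pderivable f p -> pderivable g p ->
  dirD Z (fun q => f q + g q) p = dirD Z f p + dirD Z g p.
Proof.
move=> hf hg; rewrite /dirD -big_split; apply: eq_bigr => d _ /=.
have H := is_derive_add (derivableP (hf d)) (derivableP (hg d)).
by rewrite (partial_is_derive H) /partial; ring.
Qed.

Lemma dirD_opp Z f p : pderivable f p -> dirD Z (fun q => - f q) p = - dirD Z f p.
Proof.
move=> hf; rewrite /dirD -sumrN; apply: eq_bigr => d _ /=.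
have H := is_derive_scale (-1) (derivableP (hf d)).
have -> : (fun q => - f q) = (fun q => -1 * f q) by apply/funext => q; rewrite mulN1r.
by rewrite (partial_is_derive H) /partial; ring.
Qed.

Lemma pderivable_mul f g p : pderivable f p -> pderivable g p ->
  pderivable (fun q => f q * g q) p.
Proof.
by move=> hf hg d; case: (is_derive_mul (derivableP (hf d)) (derivableP (hg d))).
Qed.

Lemma pderivable_opp f p : pderivable f p -> pderivable (fun q => - f q) p.
Proof. by move=> hf d; apply: derivableN. Qed.

Lemma dirD_comb Z f1 g1 f2 g2 p : pderivable f1 p -> pderivable g1 p ->
  pderivable f2 p -> pderivable g2 p ->
  dirD Z (fun q => f1 q * g1 q + f2 q * g2 q) p =
  f1 p * dirD Z g1 p + dirD Z f1 p * g1 p + (f2 p * dirD Z g2 p + dirD Z f2 p * g2 p).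
Proof.
move=> h1 h2 h3 h4.
rewrite (dirD_add Z (pderivable_mul h1 h2) (pderivable_mul h3 h4)).
by rewrite (dirD_mul Z h1 h2) (dirD_mul Z h3 h4).
Qed.

Lemma lie_bracketE X Y p c : lie_bracket X Y p c 0 =
  dirD X (fun q => Y q c 0) p - dirD Y (fun q => X q c 0) p.
Proof. by rewrite mxE sumrB. Qed.

Lemma Jst_mul_l p (W : 'cV[R]_(n + n)) j : (J p *m W) (lshift n j) 0 =
  Jxx k (xc p j) (yc p j) * W (lshift n j) 0 + Jxy k (xc p j) (yc p j) * W (rshift n j) 0.
Proof.
rewrite mxE big_split_ord /= (bigD1 j) //= [in X in _ + X](bigD1 j) //=.
rewrite !big1 ?addr0 => [|i /negbTE ij|i /negbTE ij].
- by rewrite /Jst block_mxEul block_mxEur !mxE eqxx !mulr1n.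
- by rewrite /Jst block_mxEur !mxE eq_sym ij mulr0n mul0r.
- by rewrite /Jst block_mxEul !mxE eq_sym ij mulr0n mul0r.
Qed.

Lemma Jst_mul_r p (W : 'cV[R]_(n + n)) j : (J p *m W) (rshift n j) 0 =
  Jyx k (xc p j) (yc p j) * W (lshift n j) 0 + - Jxx k (xc p j) (yc p j) * W (rshift n j) 0.
Proof.
rewrite mxE big_split_ord /= (bigD1 j) //= [in X in _ + X](bigD1 j) //=.
rewrite !big1 ?addr0 => [|i /negbTE ij|i /negbTE ij].
- by rewrite /Jst block_mxEdl block_mxEdr !mxE eqxx !mulr1n.
- by rewrite /Jst block_mxEdr !mxE eq_sym ij mulr0n mul0r.
- by rewrite /Jst block_mxEdl !mxE eq_sym ij mulr0n mul0r.
Qed.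

Lemma dirD_pair Z (phi : R -> R -> R) p j :
  dirD Z (fun q => phi (xc q j) (yc q j)) p =
  Z p (lshift n j) 0 * partial (lshift n j) (fun q => phi (xc q j) (yc q j)) p +
  Z p (rshift n j) 0 * partial (rshift n j) (fun q => phi (xc q j) (yc q j)) p.
Proof.
rewrite /dirD (bigD1 (lshift n j)) //= (bigD1 (rshift n j)) /=; last first.
  by rewrite eq_sym eq_lrshift.
rewrite addrA big1 ?addr0 // => d /andP[dl dr].
suff -> : partial d (fun q => phi (xc q j) (yc q j)) p = 0 by rewrite mulr0.
apply: partial_is_derive; apply/is_derive_along.
have -> : (fun h : R => phi (xc (h *: basisv R d + p) j) (yc (h *: basisv R d + p) j))
  = cst (phi (xc p j) (yc p j)); last exact: is_derive_cst.
apply/funext => h; rewrite /cst /xc /yc !mxE eqxx /=.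
by rewrite ![_ == d]eq_sym (negbTE dl) (negbTE dr) !mulr0 !add0r.
Qed.

Lemma nijenhuis_algebra (a b c al ar bl br cl cr xl xr yl yr
  JXYl JXYr JYXl JYXr XYl XYr YXl YXr : R) :
  a ^+ 2 + b * c = -1 ->
  a * al + al * a + (b * cl + bl * c) = 0 ->
  a * ar + ar * a + (b * cr + br * c) = 0 ->
  let jxl := a * xl + b * xr in let jxr := c * xl + - a * xr in
  let jyl := a * yl + b * yr in let jyr := c * yl + - a * yr in
  let D u w fl fr := u * fl + w * fr in
  let P u w Yl Yr := a * Yl + D u w al ar * yl + (b * Yr + D u w bl br * yr) in
  let Q u w Yl Yr := c * Yl + D u w cl cr * yl + (- a * Yr + - D u w al ar * yr) in
  let P' u w Xl Xr := a * Xl + D u w al ar * xl + (b * Xr + D u w bl br * xr) in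
  let Q' u w Xl Xr := c * Xl + D u w cl cr * xl + (- a * Xr + - D u w al ar * xr) in
  let JXJYl := P jxl jxr JXYl JXYr - P' jyl jyr JYXl JYXr in
  let JXJYr := Q jxl jxr JXYl JXYr - Q' jyl jyr JYXl JYXr in
  let l1 := JXYl - P' yl yr YXl YXr in let r1 := JXYr - Q' yl yr YXl YXr in
  let l2 := P xl xr XYl XYr - JYXl in let r2 := Q xl xr XYl XYr - JYXr in
  JXJYl - (a * l1 + b * r1) - (a * l2 + b * r2) - (XYl - YXl) = 0 /\
  JXJYr - (c * l1 + - a * r1) - (c * l2 + - a * r2) - (XYr - YXr) = 0.
Proof.
move=> E El Er.
(* [c = 0] would force a^2 = -1. So b and its two derivatives can be solved for, and the claim
   becomes an identity of rational functions. *)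
have c0 : c != 0.
  by apply/eqP => c0; move: E; rewrite c0 mulr0 addr0; have := sqr_ge0 a; lra.
have bE : b = (-1 - a ^+ 2) / c by rewrite -E; field.
have blE : bl = - (2 * a * al + b * cl) / c.
  have -> : - (2 * a * al + b * cl) = bl * c - (a * al + al * a + (b * cl + bl * c)) by ring.
  by rewrite El subr0; field.
have brE : br = - (2 * a * ar + b * cr) / c.
  have -> : - (2 * a * ar + b * cr) = br * c - (a * ar + ar * a + (b * cr + br * c)) by ring.
  by rewrite Er subr0; field.
by rewrite blE brE bE => /=; split; field.
Qed.

Lemma Ck_on_pderivable m f p : (0 < m)%N -> Ck_on m setT f -> pderivable f p.
Proof. by case: m => // m _ [_ H] d; have [Hd _] := H d; exact: Hd. Qed.

(** The directional derivatives of X and Y run over all coordinates, but those of the entries of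
    block j reduce to the pair j by [dirD_pair], which leaves the two-dimensional identity. *)
Lemma Jst_integrable : J_integrable J.
Proof.
move=> X Y hX hY p; apply/colP => c.
have dX d : pderivable (fun q => X q d 0) p := @Ck_on_pderivable 1 _ p isT (hX d).
have dY d : pderivable (fun q => Y q d 0) p := @Ck_on_pderivable 1 _ p isT (hY d).
have [j hj] : exists j, (c = lshift n j) \/ (c = rshift n j).
  by case: (split_ordP c) => j ->; exists j; [left|right].
have [Ca [Cb Cc]] := @Ck_entries R k k_gt0 n j.
have da := @Ck_on_pderivable k _ p k_gt0 Ca.
have db := @Ck_on_pderivable k _ p k_gt0 Cb.
have dc := @Ck_on_pderivable k _ p k_gt0 Cc.
have dna := pderivable_opp da.
pose l := lshift n j; pose r := rshift n j.
have El (Z : vfield R (n + n)) : (fun q => Jfield J Z q l 0) =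
   (fun q => Jxx k (xc q j) (yc q j) * Z q l 0 + Jxy k (xc q j) (yc q j) * Z q r 0).
  by apply/funext => q; rewrite /Jfield Jst_mul_l.
have Er (Z : vfield R (n + n)) : (fun q => Jfield J Z q r 0) =
   (fun q => Jyx k (xc q j) (yc q j) * Z q l 0 + - Jxx k (xc q j) (yc q j) * Z q r 0).
  by apply/funext => q; rewrite /Jfield Jst_mul_r.
(* Differentiating the constant a^2 + bc = -1 yields the linear relation [rel] between the
   derivatives of the entries. *)
have dcst d : partial d (fun q : V => Jxx k (xc q j) (yc q j) * Jxx k (xc q j) (yc q j)
   + Jxy k (xc q j) (yc q j) * Jyx k (xc q j) (yc q j)) p = 0.
  apply: partial_is_derive.
  have -> : (fun q : V => Jxx k (xc q j) (yc q j) * Jxx k (xc q j) (yc q j)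
   + Jxy k (xc q j) (yc q j) * Jyx k (xc q j) (yc q j)) = cst (-1).
    by apply/funext => q; rewrite -expr2 Jsquare.
  exact: is_derive_cst.
have rel d : Jxx k (xc p j) (yc p j) * partial d (fun q => Jxx k (xc q j) (yc q j)) p
  + partial d (fun q => Jxx k (xc q j) (yc q j)) p * Jxx k (xc p j) (yc p j) +
  (Jxy k (xc p j) (yc p j) * partial d (fun q => Jyx k (xc q j) (yc q j)) p
   + partial d (fun q => Jxy k (xc q j) (yc q j)) p * Jyx k (xc p j) (yc p j)) = 0.
  have A := is_derive_mul (derivableP (da d)) (derivableP (da d)).
  have B := is_derive_mul (derivableP (db d)) (derivableP (dc d)).
  have C := partial_is_derive (is_derive_add A B).
  by rewrite dcst in C; rewrite [RHS]C.
have := @nijenhuis_algebra (Jxx k (xc p j) (yc p j)) (Jxy k (xc p j) (yc p j))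
  (Jyx k (xc p j) (yc p j)) _ _ _ _ _ _ (X p l 0) (X p r 0) (Y p l 0) (Y p r 0)
  (dirD (Jfield J X) (fun q => Y q l 0) p) (dirD (Jfield J X) (fun q => Y q r 0) p)
  (dirD (Jfield J Y) (fun q => X q l 0) p) (dirD (Jfield J Y) (fun q => X q r 0) p)
  (dirD X (fun q => Y q l 0) p) (dirD X (fun q => Y q r 0) p)
  (dirD Y (fun q => X q l 0) p) (dirD Y (fun q => X q r 0) p)
  (Jsquare k _ _) (rel l) (rel r).
have JXl Z : Jfield J Z p l 0 = Jxx k (xc p j) (yc p j) * Z p l 0 + Jxy k (xc p j) (yc p j) * Z p r 0.
  exact: Jst_mul_l.
have JXr Z : Jfield J Z p r 0 = Jyx k (xc p j) (yc p j) * Z p l 0 + - Jxx k (xc p j) (yc p j) * Z p r 0.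
  exact: Jst_mul_r.
move=> /= [Nl Nr].
have col4 (A B C D : 'cV[R]_(n + n)) e : (A - B - C - D) e 0 = A e 0 - B e 0 - C e 0 - D e 0.
  by rewrite !mxE.
have DX (Z W : vfield R (n + n)) (f g : V -> R) :
    (forall d, pderivable (fun q => W q d 0) p) -> pderivable f p -> pderivable g p ->
    dirD Z (fun q => f q * W q l 0 + g q * W q r 0) p =
    f p * dirD Z (fun q => W q l 0) p + dirD Z f p * W p l 0 +
    (g p * dirD Z (fun q => W q r 0) p + dirD Z g p * W p r 0).
  by move=> hW hf hg; exact: dirD_comb hf (hW l) hg (hW r).
have Pa Z := dirD_pair Z (Jxx k) p j.
have Pb Z := dirD_pair Z (Jxy k) p j.
have Pc Z := dirD_pair Z (Jyx k) p j.
have Pn Z : dirD Z (fun q => - Jxx k (xc q j) (yc q j)) p =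
   - dirD Z (fun q => Jxx k (xc q j) (yc q j)) p := dirD_opp Z da.
have DL Z W hW := DX Z W _ _ hW da db.
have DR Z W hW := DX Z W _ _ hW dc dna.
case: hj => ->.
- rewrite /nijenhuis col4 !Jst_mul_l !lie_bracketE -/l -/r !El !Er.
  rewrite (DL _ _ dX) (DL _ _ dY) (DL _ _ dX) (DL _ _ dY) (DR _ _ dX) (DR _ _ dY).
  by rewrite !Pn !Pa !Pb !Pc -/l -/r !JXl !JXr [RHS]mxE; exact: Nl.
- rewrite /nijenhuis col4 !Jst_mul_r !lie_bracketE -/l -/r !El !Er.
  rewrite (DR _ _ dX) (DR _ _ dY) (DR _ _ dX) (DR _ _ dY) (DL _ _ dX) (DL _ _ dY).
  by rewrite !Pn !Pa !Pb !Pc -/l -/r !JXl !JXr [RHS]mxE; exact: Nr.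
Qed.

End Integrability.

(** * Taylor expansions *)

Section Taylor.
Variable R : realType.
Implicit Types (x y c C : R) (g h u : R -> R -> R).

Definition box (d : R) x y := `|x| < d /\ `|y| < d.

(* Polynomials with all monomials of degree at least [m], plus [O(r^d)]. *)
Inductive taylor (m d : nat) : (R -> R -> R) -> Prop :=
| taylor_mono (c : R) (a b : nat) : (m <= a + b)%N ->
    taylor m d (fun x y => c * (x ^+ a * y ^+ b))
| taylor_O g (C e : R) : 0 < e ->
    (forall x y, box e x y -> `|g x y| <= C * (`|x| + `|y|) ^+ d) -> taylor m d g
| taylor_add g h : taylor m d g -> taylor m d h -> taylor m d (fun x y => g x y + h x y).

Lemma mvt_bound (phi dphi : R -> R) (a b K : R) :
  (forall s, Num.min a b <= s <= Num.max a b -> is_derive s 1 phi (dphi s) /\ `|dphi s| <= K) ->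
  `|phi b - phi a| <= K * `|b - a|.
Proof.
wlog ab : a b / a <= b => [W|H].
  move=> H; have [ab|/ltW ba] := leP a b; first exact: W.
  by rewrite distrC [`|b - a|]distrC; apply: W => // s; rewrite minC maxC; exact: H.
rewrite (min_idPl ab) (max_idPr ab) in H.
have [||c cab ->] := @MVT_segment R phi dphi a b ab.
- by move=> s; rewrite in_itv /= => /andP[/ltW h1 /ltW h2]; case: (H s _) => //; rewrite h1.
- apply: derivable_within_continuous => s; rewrite in_itv /= => h.
  by case: (H s h) => -[].
by rewrite normrM ler_wpM2r //; case: (H c) => //; rewrite in_itv in cab.
Qed.

Lemma taylor_ext m d g h : taylor m d g -> (forall x y, g x y = h x y) -> taylor m d h.
Proof. by move=> H E; have -> : h = g by apply/funext => x; apply/funext => y. Qed.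

Lemma taylor_weaken m m' d g : (m' <= m)%N -> taylor m d g -> taylor m' d g.
Proof.
move=> mm; elim=> [c a b ab|{}g C e e0 H|{}g h _ H1 _ H2].
- by apply: taylor_mono; exact: leq_trans ab.
- exact: taylor_O e0 H.
- exact: taylor_add.
Qed.

Lemma box_min (d d' : R) x y : box (Num.min d d') x y -> box d x y /\ box d' x y.
Proof. by rewrite /box !lt_min => -[/andP[-> ->] /andP[-> ->]]. Qed.

Lemma nrm_ge0 x y : 0 <= `|x| + `|y|. Proof. by rewrite addr_ge0. Qed.

Lemma taylor0 m d : taylor m d (fun _ _ => 0).
Proof.
apply: (@taylor_O _ _ _ 0 1) => // x y _.
by rewrite normr0 mul0r.
Qed.

(** Only the polynomial part p of g is integrated; the O-terms, about whose continuity nothing is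
    known, are left in the bound for g - p. *)
Lemma taylor_prim_y m d g : taylor m d g -> exists (V p : R -> R -> R) (C e : R),
  [/\ taylor m.+1 d.+1 V, forall x y, is_derive y 1 (V x) (p x y), forall x, V x 0 = 0,
   0 < e & forall x y, box e x y -> `|g x y - p x y| <= C * (`|x| + `|y|) ^+ d].
Proof.
elim=> [c a b ab|{}g C e e0 H|{}g h _ [V [p [C [e [h1 h2 h3 h4 h5]]]]] _ [V' [p' [C' [e' [h1' h2' h3' h4' h5']]]]]].
- exists (fun x y => c / b.+1%:R * (x ^+ a * y ^+ b.+1)), (fun x y => c * (x ^+ a * y ^+ b)), 0, 1.
  split; [|move=> x y|move=> x|exact: ltr01|move=> x y _].
  + by apply: taylor_mono; rewrite addnS ltnS.
  + have A := is_derive_scale (c / b.+1%:R) (is_derive_scale (x ^+ a) (is_derive_exprn y b.+1)).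
    by refine (is_derive_eq A _) => /=; field; rewrite nat1r pnatr_eq0.
  + by rewrite expr0n /= !mulr0.
  + by rewrite subrr normr0 mul0r.
- exists (fun _ _ => 0), (fun _ _ => 0), C, e.
  split; [exact: taylor0|by move=> x y; exact: is_derive_cst|by []|exact: e0|].
  by move=> x y bxy; rewrite subr0; exact: H.
- exists (fun x y => V x y + V' x y), (fun x y => p x y + p' x y), (C + C'), (Num.min e e').
  split.
  + exact: taylor_add.
  + by move=> x y; apply: is_derive_add.
  + by move=> x; rewrite h3 h3' addr0.
  + by rewrite lt_min h4.
  + move=> x y /box_min[b1 b2]; rewrite opprD addrACA mulrDl.
    by apply: le_trans (ler_normD _ _) _; rewrite lerD ?h5 ?h5'.
Qed.

Lemma taylor_prim_x m d g : taylor m d g -> exists (V p : R -> R) (C e : R),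
  [/\ taylor m.+1 d.+1 (fun x _ => V x), forall x, is_derive x 1 V (p x), V 0 = 0,
   0 < e & forall x, `|x| < e -> `|g x 0 - p x| <= C * `|x| ^+ d].
Proof.
elim=> [c a b ab|{}g C e e0 H|{}g h _ [V [p [C [e [h1 h2 h3 h4 h5]]]]] _ [V' [p' [C' [e' [h1' h2' h3' h4' h5']]]]]].
(* A monomial containing y vanishes on the axis y = 0, so its contribution to V is 0. *)
- have [b0|b0] := posnP b; last first.
    exists (fun=> 0), (fun=> 0), 0, 1.
    split; [exact: taylor0|by move=> x; exact: is_derive_cst|by []|exact: ltr01|].
    by move=> x _; rewrite expr0n gtn_eqF //= !mulr0 subr0 normr0 mul0r.
  exists (fun x => c / a.+1%:R * x ^+ a.+1), (fun x => c * x ^+ a), 0, 1.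
  split; [|move=> x| |exact: ltr01|move=> x _].
  + have := @taylor_mono m.+1 d.+1 (c / a.+1%:R) a.+1 0; rewrite addn0 ltnS.
    rewrite b0 addn0 in ab; move=> /(_ ab) h; apply: taylor_ext h _ => x y.
    by rewrite expr0 mulr1.
  + have A := is_derive_scale (c / a.+1%:R) (is_derive_exprn x a.+1).
    by refine (is_derive_eq A _) => /=; field; rewrite nat1r pnatr_eq0.
  + by rewrite expr0n /= !mulr0.
  + by rewrite b0 expr0 mulr1 subrr normr0 mul0r.
- exists (fun=> 0), (fun=> 0), C, e.
  split; [exact: taylor0|by move=> x; exact: is_derive_cst|by []|exact: e0|].
  move=> x xe; rewrite subr0; have := H x 0; rewrite normr0 addr0; apply.
  by split; rewrite ?normr0.
- exists (fun x => V x + V' x), (fun x => p x + p' x), (C + C'), (Num.min e e').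
  split.
  + exact: taylor_add.
  + by move=> x; apply: is_derive_add.
  + by rewrite h3 h3' addr0.
  + by rewrite lt_min h4.
  + move=> x; rewrite lt_min => /andP[b1 b2]; rewrite opprD addrACA mulrDl.
    by apply: le_trans (ler_normD _ _) _; rewrite lerD ?h5 ?h5'.
Qed.

Lemma between0 s y : Num.min 0 y <= s <= Num.max 0 y -> `|s| <= `|y|.
Proof.
have [y0|y0] := leP 0 y; first by case/andP=> h1 h2; rewrite !ger0_norm.
by case/andP=> h1 h2; rewrite !ler0_norm ?lerN2 // ltW.
Qed.

(** The path goes from 0 to (x, y) along the x-axis and then vertically: after subtracting the
    polynomial primitive of the derivative on each leg, the mean value theorem turns the error
    O(r^d) into O(r^(d+1)). *)
Lemma taylor_step m d u ux uy e : 0 < e ->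
  (forall x y, box e x y -> is_derive x 1 (u ^~ y) (ux x y)) ->
  (forall x y, box e x y -> is_derive y 1 (u x) (uy x y)) ->
  taylor m d ux -> taylor m d uy ->
  taylor m.+1 d.+1 (fun x y => u x y - u 0 0).
Proof.
move=> e0 hx hy /taylor_prim_x[W [p [C [e1 [W1 W2 W3 W4 W5]]]]]
  /taylor_prim_y[V [q [C' [e2 [V1 V2 V3 V4 V5]]]]].
have H1 : taylor m.+1 d.+1 (fun x y => u x 0 - u 0 0 - W x).
  apply: (@taylor_O _ _ _ `|C| (Num.min e e1)); first by rewrite lt_min e0.
  move=> x y /box_min[[be _] [b1 _]].
  have -> : u x 0 - u 0 0 - W x = (u x 0 - W x) - (u 0 0 - W 0) by rewrite W3; ring.
  apply: le_trans (@mvt_bound (fun s => u s 0 - W s) (fun s => ux s 0 - p s) 0 x (`|C| * `|x| ^+ d) _) _.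
    move=> s /between0 sx; split.
      have A : is_derive s 1 (u ^~ 0) (ux s 0).
        by apply: hx; split; rewrite ?normr0 //; exact: le_lt_trans be.
      by apply: is_deriveB.
    apply: le_trans (W5 s _) _; first exact: le_lt_trans b1.
    apply: le_trans (_ : `|C| * `|s| ^+ d <= _); first by rewrite ler_wpM2r ?exprn_ge0 // ler_norm.
    by rewrite ler_wpM2l // lerXn2r // nnegrE.
  rewrite subr0 -mulrA -exprSr ler_wpM2l // lerXn2r // ?nnegrE ?nrm_ge0 //.
  by rewrite lerDl.
have H2 : taylor m.+1 d.+1 (fun x y => u x y - u x 0 - V x y).
  apply: (@taylor_O _ _ _ `|C'| (Num.min e e2)); first by rewrite lt_min e0.
  move=> x y /box_min[[bx by_] [b1 b2]].
  have -> : u x y - u x 0 - V x y = (u x y - V x y) - (u x 0 - V x 0) by rewrite V3; ring.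
  apply: le_trans (@mvt_bound (fun s => u x s - V x s) (fun s => uy x s - q x s) 0 y (`|C'| * (`|x| + `|y|) ^+ d) _) _.
    move=> s /between0 sx; split.
      have A : is_derive s 1 (u x) (uy x s).
        by apply: hy; split => //; exact: le_lt_trans by_.
      by apply: is_deriveB.
    apply: le_trans (V5 x s _) _; first by split=> //; exact: le_lt_trans b2.
    apply: le_trans (_ : `|C'| * (`|x| + `|s|) ^+ d <= _).
      by rewrite ler_wpM2r ?exprn_ge0 ?nrm_ge0 // ler_norm.
    by rewrite ler_wpM2l // lerXn2r ?nnegrE ?nrm_ge0 // lerD2l.
  rewrite subr0 -mulrA ler_wpM2l // exprSr ler_wpM2l ?exprn_ge0 ?nrm_ge0 //.
  by rewrite lerDr.
apply: taylor_ext (taylor_add (taylor_add H1 W1) (taylor_add H2 V1)) _ => x y.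
by ring.
Qed.

End Taylor.

(** * Restriction of functions to a coordinate plane through the origin *)

Section Slice.
Variables (R : realType) (m : nat) (l r : 'I_m).
Local Notation V := 'rV[R]_m.
Implicit Types (x y : R) (f : V -> R) (U : set V).

Definition slice x y : V := x *: basisv R l + y *: basisv R r.

Definition lip_near (u : R -> R -> R) := exists e L : R, [/\ 0 < e, 0 <= L &
  forall x y x' y', box e x y -> box e x' y' ->
    `|u x y - u x' y'| <= L * (`|x - x'| + `|y - y'|)].

Definition quad_near (u ux uy : R -> R -> R) := exists e L : R, [/\ 0 < e, 0 <= L &
  forall x y x' y', box e x y -> box e x' y' ->
    `|u x' y' - u x y - ux x y * (x' - x) - uy x y * (y' - y)|
      <= L * (`|x' - x| + `|y' - y|) ^+ 2].

Definition partials_near (u ux uy : R -> R -> R) := exists e : R, 0 < e /\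
  forall x y, box e x y -> is_derive x 1 (u ^~ y) (ux x y) /\ is_derive y 1 (u x) (uy x y).

Lemma between_box (e a b s : R) : `|a| < e -> `|b| < e ->
  Num.min a b <= s <= Num.max a b -> `|s| < e.
Proof.
rewrite !ltr_norml => /andP[a1 a2] /andP[b1 b2] /andP[h1 h2].
apply/andP; split; first by apply: lt_le_trans h1; rewrite lt_min a1.
by apply: le_lt_trans h2 _; rewrite gt_max a2.
Qed.

Lemma between_dist (a b s : R) : Num.min a b <= s <= Num.max a b -> `|s - a| <= `|b - a|.
Proof.
have [ab|ab] := leP a b; case/andP=> h1 h2.
  by rewrite !ger0_norm ?subr_ge0 // lerB.
by rewrite !ler0_norm ?subr_le0 ?(ltW ab) // lerN2 lerB.
Qed.

Lemma lip_near_bounded u : lip_near u -> exists e B : R, [/\ 0 < e, 0 <= B &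
  forall x y, box e x y -> `|u x y| <= B].
Proof.
case=> e [L [e0 L0 H]]; exists e, (`|u 0 0| + L * (e + e)); split=> //.
  by rewrite addr_ge0 // mulr_ge0 // addr_ge0 // ltW.
move=> x y b; have b0 : box e 0 0 by split; rewrite normr0.
have -> : u x y = u 0 0 + (u x y - u 0 0) by ring.
apply: le_trans (ler_normD _ _) _; rewrite lerD2l.
apply: le_trans (H _ _ _ _ b b0) _; rewrite ler_wpM2l // !subr0.
by case: b => /ltW h1 /ltW h2; rewrite lerD.
Qed.

Lemma partials_lip u ux uy : partials_near u ux uy -> lip_near ux -> lip_near uy ->
  lip_near u.
Proof.
case=> e [e0 H] /lip_near_bounded[e1 [B1 [e10 B10 H1]]] /lip_near_bounded[e2 [B2 [e20 B20 H2]]].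
exists (Num.min e (Num.min e1 e2)), (B1 + B2); split; first by rewrite !lt_min e0 e10.
  by rewrite addr_ge0.
move=> x y x' y' [bx by_] [bx' by'].
have S1 : `|u x y - u x' y| <= B1 * `|x - x'|.
  apply: (@mvt_bound R (u ^~ y) (ux ^~ y)) => s hs.
  have /box_min[b /box_min[b1 b2]] : box (Num.min e (Num.min e1 e2)) s y.
    by split=> //; exact: between_box hs.
  by split; [case: (H _ _ b)|exact: H1].
have S2 : `|u x' y - u x' y'| <= B2 * `|y - y'|.
  apply: (@mvt_bound R (u x') (uy x')) => s hs.
  have /box_min[b /box_min[b1 b2]] : box (Num.min e (Num.min e1 e2)) x' s.
    by split=> //; exact: between_box hs.
  by split; [case: (H _ _ b)|exact: H2].
have -> : u x y - u x' y' = (u x y - u x' y) + (u x' y - u x' y') by ring.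
apply: le_trans (ler_normD _ _) _.
apply: le_trans (lerD S1 S2) _; rewrite mulrDl !mulrDr.
by rewrite lerD // ?lerDl ?lerDr mulr_ge0.
Qed.

(** On each of the two legs, u minus its linear part at the base point has a derivative bounded by a
    Lipschitz constant times the displacement. *)
Lemma partials_quad u ux uy : partials_near u ux uy -> lip_near ux -> lip_near uy ->
  quad_near u ux uy.
Proof.
case=> e [e0 H] [e1 [L1 [e10 L10 H1]]] [e2 [L2 [e20 L20 H2]]].
exists (Num.min e (Num.min e1 e2)), (L1 + L2); split; first by rewrite !lt_min e0 e10.
  by rewrite addr_ge0.
move=> x y x' y' b b'.
have /box_min[_ /box_min[c1 c2]] := b.
case: (b) (b') => [bx by_] [bx' by'].
set dx := `|x' - x|; set dy := `|y' - y|.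
have S1 : `|(u x' y - ux x y * x') - (u x y - ux x y * x)| <= L1 * dx * dx.
  apply: (@mvt_bound R (fun s => u s y - ux x y * s) (fun s => ux s y - ux x y)) => s hs.
  have /box_min[bs /box_min[b1 b2]] : box (Num.min e (Num.min e1 e2)) s y.
    by split=> //; exact: between_box hs.
  split.
    have [A _] := H _ _ bs.
    have B := is_derive_scale (ux x y) (is_derive_id s (1 : R)).
    rewrite mulr1 in B; exact: is_deriveB.
  apply: le_trans (H1 _ _ _ _ b1 c1) _; rewrite subrr normr0 addr0 ler_wpM2l //.
  exact: between_dist.
have S2 : `|(u x' y' - uy x y * y') - (u x' y - uy x y * y)| <= L2 * (dx + dy) * dy.
  apply: (@mvt_bound R (fun s => u x' s - uy x y * s) (fun s => uy x' s - uy x y)) => s hs.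
  have /box_min[bs /box_min[b1 b2]] : box (Num.min e (Num.min e1 e2)) x' s.
    by split=> //; exact: between_box hs.
  split.
    have [_ A] := H _ _ bs.
    have B := is_derive_scale (uy x y) (is_derive_id s (1 : R)).
    rewrite mulr1 in B; exact: is_deriveB.
  apply: le_trans (H2 _ _ _ _ b2 c2) _; rewrite ler_wpM2l // lerD2l.
  exact: between_dist.
have -> : u x' y' - u x y - ux x y * (x' - x) - uy x y * (y' - y) =
  ((u x' y - ux x y * x') - (u x y - ux x y * x)) +
  ((u x' y' - uy x y * y') - (u x' y - uy x y * y)) by ring.
apply: le_trans (ler_normD _ _) _; apply: le_trans (lerD S1 S2) _.
have dx0 : 0 <= dx by exact: normr_ge0.
have dy0 : 0 <= dy by exact: normr_ge0.
rewrite mulrDl lerD // -mulrA ler_wpM2l // expr2.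
  by rewrite ler_pM // lerDl.
by rewrite ler_wpM2l ?addr_ge0 // lerDr.
Qed.

Lemma slice_near U : open U -> U 0 ->
  exists2 e : R, 0 < e & forall x y, box e x y -> U (slice x y).
Proof.
move=> oU U0; have /nbhs_ballP[e e0 He] : nbhs (0 : V) U by exact: open_nbhs_nbhs.
have nl (i : 'I_m) (a : R) (j : 'I_m) : `|(a *: basisv R i) 0 j| <= `|a|.
  rewrite !mxE eqxx normrM ler_piMr //=.
  by case: (_ == _); rewrite ?normr1 ?normr0.
exists (e / 2) => [|x y [bx by_]]; first by rewrite divr_gt0.
apply: He; split=> // i j; rewrite ord1 /ball /= mxE sub0r normrN /slice mxE.
apply: le_lt_trans (ler_normD _ _) _.
by have := nl l x j; have := nl r y j; lra.
Qed.

Lemma slice_partials U f : open U -> U 0 ->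
  (forall d p, U p -> derivable f p (basisv R d)) ->
  partials_near (fun x y => f (slice x y)) (fun x y => partial l f (slice x y))
     (fun x y => partial r f (slice x y)).
Proof.
move=> oU U0 hd; have [e e0 He] := slice_near oU U0.
exists e; split=> // x y b; have Us := He _ _ b.
have Hl := derivableP (hd l _ Us); have Hr := derivableP (hd r _ Us).
split.
  apply/(@is_derive_along R R (fun s : R => f (slice s y)) x 1 _).
  have -> : (fun h : R => f (slice (h *: (1 : R) + x) y)) =
     (fun h : R => f (h *: basisv R l + slice x y)).
    by apply/funext => h; rewrite /slice [h *: 1]mulr1 scalerDl addrA.
  exact: (proj1 (@is_derive_along R V f (slice x y) (basisv R l) _) Hl).
apply/(@is_derive_along R R (fun s : R => f (slice x s)) y 1 _).
have -> : (fun h : R => f (slice x (h *: (1 : R) + y))) =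
   (fun h : R => f (h *: basisv R r + slice x y)).
  by apply/funext => h; rewrite /slice [h *: 1]mulr1 scalerDl addrCA.
exact: (proj1 (@is_derive_along R V f (slice x y) (basisv R r) _) Hr).
Qed.

Lemma iter_partial_rcons (s : seq 'I_m) i f :
  iter_partial (rcons s i) f = iter_partial s (partial i f).
Proof. by elim: s => //= a s ->. Qed.

Lemma Ckl_on_partial k U f i : Ckl_on k.+1 U f -> Ckl_on k U (partial i f).
Proof.
case=> -[_ H] HL; split; first by case: (H i).
by move=> s sk; rewrite -iter_partial_rcons; apply: HL; rewrite size_rcons sk.
Qed.

Lemma Ckl_on_derivable k U f d p : Ckl_on k.+1 U f -> U p -> derivable f p (basisv R d).
Proof. by case=> -[_ H] _ Up; case: (H d) => h _; exact: h. Qed.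

Lemma slice00 : slice 0 0 = 0. Proof. by rewrite /slice !scale0r addr0. Qed.

Lemma slice_lip U f : open U -> U 0 -> Ckl_on 0 U f -> lip_near (fun x y => f (slice x y)).
Proof.
move=> oU U0 [_ /(_ [::] erefl)[L HL]].
have [e e0 Us] := slice_near oU U0.
pose B := `|basisv R l : V| + `|basisv R r : V|.
exists e, (`|L| * B); split=> //; first by rewrite mulr_ge0 // addr_ge0.
move=> x y x' y' b b'.
apply: le_trans (HL _ _ (Us _ _ b) (Us _ _ b')) _.
apply: le_trans (_ : `|L| * `|slice x y - slice x' y'| <= _).
  by rewrite ler_wpM2r // ler_norm.
rewrite -mulrA ler_wpM2l //.
have -> : slice x y - slice x' y' = (x - x') *: basisv R l + (y - y') *: basisv R r.
  by rewrite /slice !scalerBl opprD addrACA.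
apply: le_trans (ler_normD _ _) _; rewrite !normrZ mulrDr.
by rewrite lerD // [leLHS]mulrC ler_wpM2r // /B ?lerDl ?lerDr.
Qed.

Lemma slice_taylor1 k U f : open U -> U 0 -> Ckl_on k U f ->
  lip_near (fun x y => f (slice x y)) /\
  taylor 1 k.+1 (fun x y => f (slice x y) - f 0).
Proof.
move=> oU U0; elim: k f => [|k IH] f hf.
  have HL := slice_lip oU U0 hf; split=> //.
  case: HL => e [L [e0 L0 H]]; apply: (@taylor_O _ _ _ _ L e) => // x y b.
  have b0 : box e 0 0 by split; rewrite normr0.
  by have := H _ _ _ _ b b0; rewrite slice00 !subr0 expr1.
have [Ll Tl] := IH _ (Ckl_on_partial l hf).
have [Lr Tr] := IH _ (Ckl_on_partial r hf).
have P := slice_partials oU U0 (fun d p => @Ckl_on_derivable k U f d p hf).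
split; first exact: partials_lip P Ll Lr.
(* Restoring the constant g(0) lowers the order to 0: the integration step takes the full partial
   derivatives. *)
have up (g : V -> R) : taylor 1 k.+1 (fun x y => g (slice x y) - g 0) ->
   taylor 0 k.+1 (fun x y => g (slice x y)).
  move=> h; have := taylor_add (taylor_weaken (leq0n 1) h)
    (@taylor_mono R 0 k.+1 (g 0) 0 0 isT).
  by move/taylor_ext; apply => x y; rewrite !expr0 !mulr1 subrK.
have [e [e0 He]] := P.
rewrite -[in X in taylor _ _ X]slice00.
apply: (@taylor_step R 0 k.+1 (fun x y => f (slice x y)) _ _ e e0 _ _ (up _ Tl) (up _ Tr)).
  by move=> x y b; case: (He _ _ b).
by move=> x y b; case: (He _ _ b).
Qed.

(** The partial derivatives of f minus its linear part are the partials minus their values at 0, of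
    order 1 by [slice_taylor1]; one more integration gives order 2. *)
Lemma slice_taylor2 k U f : open U -> U 0 -> Ckl_on k.+1 U f ->
  quad_near (fun x y => f (slice x y)) (fun x y => partial l f (slice x y))
    (fun x y => partial r f (slice x y)) /\
  (lip_near (fun x y => partial l f (slice x y)) /\
   lip_near (fun x y => partial r f (slice x y))) /\
  taylor 2 k.+2 (fun x y => f (slice x y) - f 0 - partial l f 0 * x - partial r f 0 * y).
Proof.
move=> oU U0 hf.
have [Ll Tl] := slice_taylor1 oU U0 (Ckl_on_partial l hf).
have [Lr Tr] := slice_taylor1 oU U0 (Ckl_on_partial r hf).
have P := slice_partials oU U0 (fun d p => @Ckl_on_derivable k U f d p hf).
split; first exact: partials_quad.
split=> //; have [e [e0 He]] := P.
pose u x y := f (slice x y) - f 0 - partial l f 0 * x - partial r f 0 * y.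
have D1 (c c' c'' s : R) (phi : R -> R) dphi : is_derive s 1 phi dphi ->
    is_derive s 1 (fun s => phi s - c - c' * s - c'') (dphi - c').
  move=> A; have B := is_derive_scale c' (is_derive_id s (1 : R)).
  rewrite mulr1 in B.
  have C := is_deriveB (is_deriveB (is_deriveB A (is_derive_cst c s 1)) B) (is_derive_cst c'' s 1).
  by refine (is_derive_eq C _); rewrite !subr0.
suff H : taylor 2 k.+2 (fun x y => u x y - u 0 0).
  by apply: taylor_ext H _ => x y; rewrite /u slice00; ring.
apply: (@taylor_step R 1 k.+1 u _ _ e e0 _ _ Tl Tr) => x y b; have [A B] := He _ _ b.
  exact: (D1 (f 0) (partial l f 0) (partial r f 0 * y) x _ _ A).
have := D1 (f 0) (partial r f 0) 0 y _ _ (D1 (partial l f 0 * x) 0 0 y _ _ B).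
rewrite subr0 => C; have -> : u x = (fun s => f (slice x s) - partial l f 0 * x - 0 * s - 0
   - f 0 - partial r f 0 * s - 0).
  by apply/funext => s; rewrite /u; ring.
exact: C.
Qed.

End Slice.

(** * Discrete contour integrals *)

Section ComplexNorm.
Variable R : realType.
Implicit Types (z w : R[i]) (a b : R).
Local Notation nc := (@Normc.normc R).

Lemma normc_ge0 z : 0 <= nc z. Proof. by case: z => a b; exact: sqrtr_ge0. Qed.

Lemma normcD z w : nc (z + w) <= nc z + nc w. Proof. exact: (@le_normcD R z w). Qed.

Lemma normcNE z : nc (- z) = nc z. Proof. exact: (@normcN R z). Qed.

Lemma normcB z w : nc (z - w) <= nc z + nc w.
Proof. by apply: le_trans (normcD _ _) _; rewrite normcNE. Qed.

Lemma normcX z n : nc (z ^+ n) = nc z ^+ n.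
Proof. by elim: n => [|n IH]; [exact: Normc.normc1|rewrite !exprS Normc.normcM IH]. Qed.

Lemma normc_real a : nc a%:C%C = `|a|.
Proof. by rewrite /= expr0n addr0 sqrtr_sqr. Qed.

Lemma normc_i : nc (Complex 0 1) = 1.
Proof. by rewrite /= expr0n add0r expr1n sqrtr1. Qed.

Lemma normc_sqr z : nc z ^+ 2 = nsq z.
Proof. by case: z => a b; rewrite /nsq /= sqr_sqrtr // addr_ge0 ?sqr_ge0. Qed.

Lemma normc_le a b : nc (Complex a b) <= `|a| + `|b|.
Proof.
have -> : Complex a b = a%:C%C + Complex 0 1 * b%:C%C.
  by apply/eqP; rewrite eq_complex /= !(mul0r, mulr0, mul1r, subr0, addr0, add0r) !eqxx.
by apply: le_trans (normcD _ _) _; rewrite Normc.normcM normc_i mul1r !normc_real.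
Qed.

Lemma normc_sum n (F : 'I_n -> R[i]) : nc (\sum_i F i) <= \sum_i nc (F i).
Proof.
elim: n F => [|n IH] F; first by rewrite !big_ord0 Normc.normc0.
by rewrite !big_ord_recl; apply: le_trans (normcD _ _) _; rewrite lerD2l.
Qed.

End ComplexNorm.

(** * First-order expansions with uniform quadratic error *)

Section QuadraticApproximation.
Variable R : realType.
Local Notation nc := (@Normc.normc R).
Implicit Types (A : R -> R -> Prop) (F G : R -> R -> R[i]) (x y C : R).

Definition dist1 x y x' y' : R := `|x' - x| + `|y' - y|.

Definition lin F1 F2 x y (u v : R) : R[i] := F1 x y * u%:C%C + F2 x y * v%:C%C.

(** The estimates hold for any two points of A, with one constant. Since A will be part of an
    annulus, segments may leave it; the closure lemmas below therefore rest on exact identities and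
    on two-point inequalities for ln. *)
Definition quad_on A F F1 F2 := exists C : R, 0 <= C /\
  forall x y x' y', A x y -> A x' y' ->
  [/\ nc (F x y) <= C, nc (F1 x y) <= C, nc (F2 x y) <= C,
      nc (F x' y' - F x y) <= C * dist1 x y x' y' &
      nc (F x' y' - F x y - lin F1 F2 x y (x' - x) (y' - y)) <= C * dist1 x y x' y' ^+ 2].

Lemma dist1_ge0 x y x' y' : 0 <= dist1 x y x' y'. Proof. by rewrite addr_ge0. Qed.

Lemma lin_bound F1 F2 x y (u v C : R) : nc (F1 x y) <= C -> nc (F2 x y) <= C ->
  nc (lin F1 F2 x y u v) <= C * (`|u| + `|v|).
Proof.
move=> h1 h2; apply: le_trans (normcD _ _) _.
by rewrite !Normc.normcM !normc_real mulrDr lerD // ler_wpM2r.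
Qed.

Lemma quad_on_ext A F F1 F2 G G1 G2 : quad_on A F F1 F2 ->
  (forall x y, A x y -> [/\ G x y = F x y, G1 x y = F1 x y & G2 x y = F2 x y]) ->
  quad_on A G G1 G2.
Proof.
case=> C [C0 H] E; exists C; split=> // x y x' y' a a'.
have [-> e1 e2] := E _ _ a; have [-> _ _] := E _ _ a'.
by rewrite /lin e1 e2; exact: H.
Qed.

Lemma quad_on_cst A (c : R[i]) : quad_on A (fun _ _ => c) (fun _ _ => 0) (fun _ _ => 0).
Proof.
exists (nc c); split; first exact: normc_ge0.
move=> x y x' y' _ _; rewrite /lin !mul0r addr0 !subr0 subrr Normc.normc0.
have h := normc_ge0 c; have d := dist1_ge0 x y x' y'.
by split=> //; rewrite mulr_ge0 // exprn_ge0.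
Qed.

Lemma quad_on_add A F F1 F2 G G1 G2 : quad_on A F F1 F2 -> quad_on A G G1 G2 ->
  quad_on A (fun x y => F x y + G x y) (fun x y => F1 x y + G1 x y)
    (fun x y => F2 x y + G2 x y).
Proof.
case=> C [C0 H] [C' [C0' H']]; exists (C + C'); split; first by rewrite addr_ge0.
move=> x y x' y' a a'; have [h1 h2 h3 h4 h5] := H _ _ _ _ a a'.
have [h1' h2' h3' h4' h5'] := H' _ _ _ _ a a'.
have T (u v : R[i]) p q : nc u <= p -> nc v <= q -> nc (u + v) <= p + q.
  by move=> hu hv; apply: le_trans (normcD _ _) _; exact: lerD.
split; [exact: T|exact: T|exact: T| |].
  have -> : F x' y' + G x' y' - (F x y + G x y) = (F x' y' - F x y) + (G x' y' - G x y) by ring.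
  by rewrite mulrDl; exact: T.
rewrite mulrDl.
have -> : F x' y' + G x' y' - (F x y + G x y) - lin (fun x y => F1 x y + G1 x y)
   (fun x y => F2 x y + G2 x y) x y (x' - x) (y' - y) =
  (F x' y' - F x y - lin F1 F2 x y (x' - x) (y' - y)) +
  (G x' y' - G x y - lin G1 G2 x y (x' - x) (y' - y)) by rewrite /lin; ring.
exact: T.
Qed.

Lemma quad_on_mul A F F1 F2 G G1 G2 : quad_on A F F1 F2 -> quad_on A G G1 G2 ->
  quad_on A (fun x y => F x y * G x y) (fun x y => F1 x y * G x y + F x y * G1 x y)
    (fun x y => F2 x y * G x y + F x y * G2 x y).
Proof.
case=> C [C0 H] [C' [C0' H']]; exists (3 * (C * C')); split; first by rewrite !mulr_ge0.
move=> x y x' y' a a'; have [h1 h2 h3 h4 h5] := H _ _ _ _ a a'.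
have [h1' h2' h3' h4' h5'] := H' _ _ _ _ a a'.
have [g1' _ _ _ _] := H' _ _ _ _ a' a.
have CC : 0 <= C * C' by rewrite mulr_ge0.
have M (u v : R[i]) p q : nc u <= p -> nc v <= q -> nc (u * v) <= p * q.
  by move=> hu hv; rewrite Normc.normcM ler_pM // normc_ge0.
have T (u v : R[i]) p q : nc u <= p -> nc v <= q -> nc (u + v) <= p + q.
  by move=> hu hv; apply: le_trans (normcD _ _) _; exact: lerD.
set d := dist1 x y x' y'; have d0 : 0 <= d by exact: dist1_ge0.
have CCd : 0 <= C * C' * d by rewrite mulr_ge0.
have L := @lin_bound F1 F2 x y (x' - x) (y' - y) C h2 h3.
split.
- by apply: le_trans (M _ _ _ _ h1 h1') _; lra.
- by apply: le_trans (T _ _ _ _ (M _ _ _ _ h2 h1') (M _ _ _ _ h1 h2')) _; lra.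
- by apply: le_trans (T _ _ _ _ (M _ _ _ _ h3 h1') (M _ _ _ _ h1 h3')) _; lra.
- have -> : F x' y' * G x' y' - F x y * G x y =
    (F x' y' - F x y) * G x' y' + F x y * (G x' y' - G x y) by ring.
  by apply: le_trans (T _ _ _ _ (M _ _ _ _ h4 g1') (M _ _ _ _ h1 h4')) _; rewrite -/d; lra.
- have -> : F x' y' * G x' y' - F x y * G x y -
     lin (fun x y => F1 x y * G x y + F x y * G1 x y)
       (fun x y => F2 x y * G x y + F x y * G2 x y) x y (x' - x) (y' - y) =
     (F x' y' - F x y - lin F1 F2 x y (x' - x) (y' - y)) * G x' y' +
     lin F1 F2 x y (x' - x) (y' - y) * (G x' y' - G x y) +
     F x y * (G x' y' - G x y - lin G1 G2 x y (x' - x) (y' - y)) by rewrite /lin; ring.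
  apply: le_trans (T _ _ _ _ (T _ _ _ _ (M _ _ _ _ h5 g1') (M _ _ _ _ L h4'))
    (M _ _ _ _ h1 h5')) _.
  rewrite -/(dist1 x y x' y') -/d le_eqVlt; apply/orP; left; apply/eqP; ring.
Qed.

Lemma quad_on_pow A F F1 F2 n : quad_on A F F1 F2 ->
  quad_on A (fun x y => F x y ^+ n) (fun x y => n%:R * F x y ^+ n.-1 * F1 x y)
    (fun x y => n%:R * F x y ^+ n.-1 * F2 x y).
Proof.
move=> H; elim: n => [|n IH].
  apply: quad_on_ext (quad_on_cst A 1) _ => x y _.
  by rewrite expr0 !mul0r.
apply: quad_on_ext (quad_on_mul H IH) _ => x y _; rewrite exprS.
by split=> //; case: n {IH} => [|n]; rewrite /= ?exprS -?natr1; ring.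
Qed.

(** The remainder of 1/F is exactly -rem(F)/F^2 + (F' - F)^2/(F^2 F'), where F' is the value at the
    second point; the lower bound c controls the denominators. *)
Lemma quad_on_inv A F F1 F2 (c : R) : 0 < c -> (forall x y, A x y -> c <= nc (F x y)) ->
  quad_on A F F1 F2 ->
  quad_on A (fun x y => (F x y)^-1) (fun x y => - (F1 x y * (F x y)^-1 ^+ 2))
    (fun x y => - (F2 x y * (F x y)^-1 ^+ 2)).
Proof.
move=> c0 Hc [C [C0 H]].
pose K := c^-1 + C * c^-1 ^+ 2 + C * C * c^-1 ^+ 3.
have ci : 0 < c^-1 by rewrite invr_gt0.
have k1 : 0 <= C * c^-1 ^+ 2 by rewrite mulr_ge0 ?exprn_ge0 // ltW.
have k2 : 0 <= C * C * c^-1 ^+ 3 by rewrite !mulr_ge0 ?exprn_ge0 // ltW.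
exists K; split; first by rewrite /K; lra.
have ne x y : A x y -> F x y != 0.
  move=> a; apply/eqP => F0; have := Hc _ _ a.
  by rewrite F0 Normc.normc0 leNgt c0.
have I x y : A x y -> nc (F x y)^-1 <= c^-1.
  move=> a; rewrite Normc.normcV lef_pV2 ?posrE ?Hc //.
  exact: lt_le_trans (Hc _ _ a).
have M (u v : R[i]) p q : nc u <= p -> nc v <= q -> nc (u * v) <= p * q.
  by move=> hu hv; rewrite Normc.normcM ler_pM // normc_ge0.
move=> x y x' y' a a'; have [h1 h2 h3 h4 h5] := H _ _ _ _ a a'.
set d := dist1 x y x' y'; have d0 : 0 <= d by exact: dist1_ge0.
have I1 := I _ _ a; have I2 := I _ _ a'.
have I12 : nc ((F x y)^-1 ^+ 2) <= c^-1 ^+ 2 by rewrite !expr2; exact: M.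
have n1 := ne _ _ a; have n2 := ne _ _ a'.
split.
- by apply: le_trans I1 _; rewrite /K; lra.
- by rewrite normcNE; apply: le_trans (M _ _ _ _ h2 I12) _; rewrite /K; lra.
- by rewrite normcNE; apply: le_trans (M _ _ _ _ h3 I12) _; rewrite /K; lra.
- have -> : (F x' y')^-1 - (F x y)^-1 = - ((F x' y' - F x y) * ((F x y)^-1 * (F x' y')^-1)).
    by field; rewrite n1 n2.
  rewrite normcNE; apply: le_trans (M _ _ _ _ h4 (M _ _ _ _ I1 I2)) _.
  have -> : C * dist1 x y x' y' * (c^-1 * c^-1) = (C * c^-1 ^+ 2) * d by rewrite /d; ring.
  by rewrite ler_wpM2r // /K; lra.
- have -> : (F x' y')^-1 - (F x y)^-1 - lin (fun x y => - (F1 x y * (F x y)^-1 ^+ 2))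
     (fun x y => - (F2 x y * (F x y)^-1 ^+ 2)) x y (x' - x) (y' - y) =
     - ((F x' y' - F x y - lin F1 F2 x y (x' - x) (y' - y)) * (F x y)^-1 ^+ 2) +
     (F x' y' - F x y) * (F x' y' - F x y) * ((F x y)^-1 ^+ 2 * (F x' y')^-1).
    by rewrite /lin; field; rewrite n1 n2.
  apply: le_trans (normcD _ _) _; rewrite normcNE.
  apply: le_trans (lerD (M _ _ _ _ h5 I12) (M _ _ _ _ (M _ _ _ _ h4 h4) (M _ _ _ _ I12 I2))) _.
  have -> : C * dist1 x y x' y' ^+ 2 * c^-1 ^+ 2 +
    C * dist1 x y x' y' * (C * dist1 x y x' y') * (c^-1 ^+ 2 * c^-1) =
    (C * c^-1 ^+ 2 + C * C * c^-1 ^+ 3) * d ^+ 2 by rewrite /d; ring.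
  by rewrite ler_wpM2r ?exprn_ge0 // /K; lra.
Qed.

Lemma ln_bounds (a b : R) : 0 < a -> 0 < b -> (b - a) / b <= ln b - ln a <= (b - a) / a.
Proof.
have U (u v : R) : 0 < u -> 0 < v -> ln v - ln u <= (v - u) / u.
  move=> u0 v0; rewrite -ln_div ?posrE //.
  have -> : v / u = 1 + (v - u) / u by field; rewrite gt_eqF.
  apply: le_ln1Dx; rewrite mulrBl divff ?gt_eqF //.
  have : 0 < v / u by exact: divr_gt0.
  lra.
move=> a0 b0; rewrite U // andbT.
by have := U b a b0 a0; rewrite -opprB -[a - b]opprB mulNr lerN2.
Qed.

(** The upper and lower bounds of [ln_bounds] differ by (b - a)^2/(ab), which bounds the distance of
    ln b - ln a from either of them. *)
Lemma ln_quad (a b c : R) : 0 < c -> c <= a -> c <= b ->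
  `|ln b - ln a| <= `|b - a| * c^-1 /\
  `|ln b - ln a - (b - a) * a^-1| <= (b - a) ^+ 2 * c^-1 ^+ 2.
Proof.
move=> c0 ca cb; have a0 := lt_le_trans c0 ca; have b0 := lt_le_trans c0 cb.
have /andP[h1 h2] := ln_bounds a0 b0.
have I (v w : R) : c <= w -> `|v / w| <= `|v| * c^-1.
  move=> cw; have w0 := lt_le_trans c0 cw.
  by rewrite normrM normfV ler_wpM2l // (gtr0_norm w0) lef_pV2 ?posrE.
have := I (b - a) _ ca; have := I (b - a) _ cb; rewrite !ler_norml.
move=> /andP[i1 i2] /andP[i3 i4]; split; first by lra.
have E : (b - a) / a - (b - a) / b = (b - a) ^+ 2 * (a^-1 * b^-1).
  by field; rewrite !gt_eqF.
have J : (b - a) ^+ 2 * (a^-1 * b^-1) <= (b - a) ^+ 2 * c^-1 ^+ 2.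
  by rewrite ler_wpM2l ?sqr_ge0 // expr2 ler_pM ?invr_ge0 ?(ltW a0) ?(ltW b0) // lef_pV2 ?posrE.
have J0 : 0 <= (b - a) ^+ 2 * (a^-1 * b^-1).
  by rewrite mulr_ge0 ?sqr_ge0 // mulr_ge0 // invr_ge0 ltW.
by apply/andP; split; lra.
Qed.

Lemma quad_on_ln A (u : R -> R -> R) F1 F2 (c : R) : 0 < c ->
  (forall x y, A x y -> c <= u x y) ->
  quad_on A (fun x y => (u x y)%:C%C) F1 F2 ->
  quad_on A (fun x y => (ln (u x y))%:C%C) (fun x y => F1 x y * ((u x y)^-1)%:C%C)
    (fun x y => F2 x y * ((u x y)^-1)%:C%C).
Proof.
move=> c0 Hc [C [C0 H]].
have ci : 0 < c^-1 by rewrite invr_gt0.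
pose K := (`|ln c| + (C + c) * c^-1) + (C * c^-1 + C * C * c^-1 ^+ 2).
have k1 : 0 <= C * c^-1 by rewrite mulr_ge0 // ltW.
have k2 : 0 <= C * C * c^-1 ^+ 2 by rewrite !mulr_ge0 ?exprn_ge0 // ltW.
have k3 : 0 <= `|ln c| by [].
have k4 : 0 <= (C + c) * c^-1 by rewrite mulr_ge0 ?addr_ge0 // ltW.
exists K; split; first by rewrite /K; lra.
have M (p q : R[i]) a b : nc p <= a -> nc q <= b -> nc (p * q) <= a * b.
  by move=> hu hv; rewrite Normc.normcM ler_pM // normc_ge0.
have I x y : A x y -> nc ((u x y)^-1)%:C%C <= c^-1.
  move=> a; have u0 := lt_le_trans c0 (Hc _ _ a).
  by rewrite normc_real ger0_norm ?invr_ge0 ?(ltW u0) // lef_pV2 ?posrE ?Hc.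
move=> x y x' y' a a'; have [h1 h2 h3 h4 h5] := H _ _ _ _ a a'.
set d := dist1 x y x' y'; have d0 : 0 <= d by exact: dist1_ge0.
have uc := Hc _ _ a; have uc' := Hc _ _ a'.
have [l1 l2] := ln_quad c0 uc uc'.
have dE (v w : R) : (v%:C - w%:C = (v - w)%:C)%C by rewrite rmorphB.
rewrite dE normc_real in h4.
split.
- rewrite normc_real; have [m1 _] := ln_quad c0 (lexx c) uc.
  have -> : ln (u x y) = ln c + (ln (u x y) - ln c) by ring.
  apply: le_trans (ler_normD _ _) _.
  have m2 : `|u x y - c| <= C + c.
    rewrite normc_real in h1; apply: le_trans (ler_normB _ _) _.
    by rewrite (gtr0_norm c0) lerD2r.
  have := ler_wpM2r (ltW ci) m2; rewrite /K; lra.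
- by apply: le_trans (M _ _ _ _ h2 (I _ _ a)) _; rewrite /K; lra.
- by apply: le_trans (M _ _ _ _ h3 (I _ _ a)) _; rewrite /K; lra.
- rewrite dE normc_real; apply: le_trans l1 _.
  have := ler_wpM2r (ltW ci) h4; rewrite -/d => m.
  apply: le_trans m _; rewrite mulrAC ler_wpM2r // /K; lra.
- have -> : (ln (u x' y'))%:C%C - (ln (u x y))%:C%C -
     lin (fun x y => F1 x y * ((u x y)^-1)%:C%C) (fun x y => F2 x y * ((u x y)^-1)%:C%C)
       x y (x' - x) (y' - y) =
     (ln (u x' y') - ln (u x y) - (u x' y' - u x y) * (u x y)^-1)%:C%C +
     ((u x' y')%:C%C - (u x y)%:C%C - lin F1 F2 x y (x' - x) (y' - y)) * ((u x y)^-1)%:C%C.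
    by rewrite /lin !(rmorphB, rmorphM) /=; ring.
  apply: le_trans (normcD _ _) _; rewrite normc_real.
  apply: le_trans (lerD l2 (M _ _ _ _ h5 (I _ _ a))) _.
  have sq : (u x' y' - u x y) ^+ 2 <= (C * d) ^+ 2.
    by rewrite -[leLHS]real_normK ?num_real // lerXn2r ?nnegrE // mulr_ge0.
  have := ler_wpM2r (exprn_ge0 2 (ltW ci)) sq => m.
  apply: le_trans (lerD m (lexx _)) _.
  have -> : (C * d) ^+ 2 * c^-1 ^+ 2 + C * dist1 x y x' y' ^+ 2 * c^-1 =
    (C * C * c^-1 ^+ 2 + C * c^-1) * d ^+ 2 by rewrite /d; ring.
  by rewrite ler_wpM2r ?exprn_ge0 // /K; lra.
Qed.

End QuadraticApproximation.

(** * A discrete Stokes theorem on annuli *)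

Section DiscreteStokes.
Variable R : realType.
Local Notation nc := (@Normc.normc R).
Implicit Types (F G : R -> R -> R[i]) (x y C : R).

Lemma lin_add F1 F2 x y (u v u' v' : R) :
  lin F1 F2 x y (u + u') (v + v') = lin F1 F2 x y u v + lin F1 F2 x y u' v'.
Proof. by rewrite /lin !rmorphD /=; ring. Qed.

Lemma approx_mul (X Y a b : R[i]) (A B e1 e2 : R) :
  nc a <= A -> nc b <= B -> nc (X - a) <= e1 -> nc (Y - b) <= e2 ->
  nc (X * Y - a * b) <= A * e2 + e1 * (B + e2).
Proof.
move=> ha hb h1 h2.
have -> : X * Y - a * b = a * (Y - b) + (X - a) * (b + (Y - b)) by ring.
apply: le_trans (normcD _ _) _; rewrite !Normc.normcM lerD //.
  by rewrite ler_pM // normc_ge0.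
rewrite ler_pM ?normc_ge0 //; apply: le_trans (normcD _ _) _; exact: lerD.
Qed.

(* The four points are [P], [P1 = P + a], [P2 = P + b], [P3 = P + a + b + e], the corners
   of a cell; to leading order the sum is the exterior product of the two
   differentials evaluated on [(a, b)]. *)
Lemma cell_bound (A : R -> R -> Prop) F F1 F2 H H1 H2 :
  quad_on A F F1 F2 -> quad_on A H H1 H2 ->
  (forall x y, A x y -> F1 x y * H2 x y = F2 x y * H1 x y) ->
  exists K : R, 0 <= K /\ forall (x y ax ay bx by_ ex ey d : R),
    A x y -> A (x + ax) (y + ay) -> A (x + bx) (y + by_) ->
    A (x + ax + (bx + ex)) (y + ay + (by_ + ey)) ->
    0 <= d -> d <= 1 -> `|ax| + `|ay| <= d -> `|bx| + `|by_| <= d -> `|ex| + `|ey| <= d ^+ 2 ->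
    nc ((F (x + ax) (y + ay) - F x y) *
          (H (x + ax + (bx + ex)) (y + ay + (by_ + ey)) - H (x + ax) (y + ay))
      - (F (x + bx) (y + by_) - F x y) *
          (H (x + ax + (bx + ex)) (y + ay + (by_ + ey)) - H (x + bx) (y + by_)))
    <= K * d ^+ 3.
Proof.
(* The increments of H ending at the far corner have error 11 C' d^2: 9 from that corner, at
   distance at most 3d, 1 from the near corner and 1 from e. The 12 is 11 plus 1 for the linear
   part, after d^2 <= d. *)
case=> C [C0 HF] [C' [C0' HH]] W; pose K1 := C * (11 * C') + C * (12 * C').
exists (2 * K1); split.
  by rewrite /K1 mulr_ge0 // addr_ge0 // mulr_ge0 // mulr_ge0.
move=> x y ax ay bx by_ ex ey d a0 a1 a2 a3 d0 d1 ha hb he.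
have d2 : d ^+ 2 <= d by rewrite expr2 ler_piMl.
have cx (u v : R) : u + v - u = v by rewrite addrC addKr.
set x3 := x + ax + (bx + ex); set y3 := y + ay + (by_ + ey).
have [_ f1 f2 _ Q1] := HF _ _ _ _ a0 a1.
have [_ _ _ _ Q2] := HF _ _ _ _ a0 a2.
have [_ g1 g2 _ R1] := HH _ _ _ _ a0 a1.
have [_ _ _ _ R2] := HH _ _ _ _ a0 a2.
have [_ _ _ _ R3] := HH _ _ _ _ a0 a3.
rewrite !cx in Q1 Q2 R1 R2.
have D1 : dist1 x y (x + ax) (y + ay) <= d by rewrite /dist1 !cx.
have D2 : dist1 x y (x + bx) (y + by_) <= d by rewrite /dist1 !cx.
have D3 : dist1 x y x3 y3 <= 3 * d.
  have -> : 3 * d = d + d + d by ring.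
  rewrite /dist1 /x3 /y3.
  have -> : x + ax + (bx + ex) - x = ax + bx + ex by ring.
  have -> : y + ay + (by_ + ey) - y = ay + by_ + ey by ring.
  have := ler_normD (ax + bx) ex; have := ler_normD ax bx.
  have := ler_normD (ay + by_) ey; have := ler_normD ay by_; lra.
have sq (c t s : R) : 0 <= c -> 0 <= t -> t <= s -> c * t ^+ 2 <= c * s ^+ 2.
  by move=> c0 t0 ts; rewrite ler_wpM2l // lerXn2r // nnegrE // (le_trans t0).
have {}Q1 := le_trans Q1 (sq _ _ _ C0 (dist1_ge0 _ _ _ _) D1).
have {}Q2 := le_trans Q2 (sq _ _ _ C0 (dist1_ge0 _ _ _ _) D2).
have {}R1 := le_trans R1 (sq _ _ _ C0' (dist1_ge0 _ _ _ _) D1).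
have {}R2 := le_trans R2 (sq _ _ _ C0' (dist1_ge0 _ _ _ _) D2).
have {}R3 := le_trans R3 (sq _ _ _ C0' (dist1_ge0 _ _ _ _) D3).
pose LF := lin F1 F2 x y; pose LH := lin H1 H2 x y.
have LFa : nc (LF ax ay) <= C * d.
  by apply: le_trans (lin_bound _ _ f1 f2) _; rewrite ler_wpM2l.
have LFb : nc (LF bx by_) <= C * d.
  by apply: le_trans (lin_bound _ _ f1 f2) _; rewrite ler_wpM2l.
have LHa : nc (LH ax ay) <= C' * d.
  by apply: le_trans (lin_bound _ _ g1 g2) _; rewrite ler_wpM2l.
have LHb : nc (LH bx by_) <= C' * d.
  by apply: le_trans (lin_bound _ _ g1 g2) _; rewrite ler_wpM2l.
have LHe : nc (LH ex ey) <= C' * d ^+ 2.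
  by apply: le_trans (lin_bound _ _ g1 g2) _; rewrite ler_wpM2l.
have e3x : x3 - x = ax + (bx + ex) by rewrite /x3; ring.
have e3y : y3 - y = ay + (by_ + ey) by rewrite /y3; ring.
rewrite -/x3 -/y3 e3x e3y !lin_add -/LH in R3.
have B (p q r : R[i]) (s t u : R) : nc p <= s -> nc q <= t -> nc r <= u ->
    nc (p - q + r) <= s + t + u.
  move=> hp hq hr; apply: le_trans (normcD _ _) _; rewrite lerD //.
  by apply: le_trans (normcB _ _) _; exact: lerD.
have S1 : nc (H x3 y3 - H (x + ax) (y + ay) - LH bx by_) <= 11 * C' * d ^+ 2.
  have -> : H x3 y3 - H (x + ax) (y + ay) - LH bx by_ =
    (H x3 y3 - H x y - (LH ax ay + (LH bx by_ + LH ex ey))) -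
    (H (x + ax) (y + ay) - H x y - LH ax ay) + LH ex ey by ring.
  by apply: le_trans (B _ _ _ _ _ _ R3 R1 LHe) _; rewrite le_eqVlt; apply/orP; left; apply/eqP; ring.
have S2 : nc (H x3 y3 - H (x + bx) (y + by_) - LH ax ay) <= 11 * C' * d ^+ 2.
  have -> : H x3 y3 - H (x + bx) (y + by_) - LH ax ay =
    (H x3 y3 - H x y - (LH ax ay + (LH bx by_ + LH ex ey))) -
    (H (x + bx) (y + by_) - H x y - LH bx by_) + LH ex ey by ring.
  by apply: le_trans (B _ _ _ _ _ _ R3 R2 LHe) _; rewrite le_eqVlt; apply/orP; left; apply/eqP; ring.
have P1 := approx_mul LFa LHb Q1 S1.
have P2 := approx_mul LFb LHa Q2 S2.
(* dF and dH are proportional, so their exterior product on (a, b) is 0 and the leading terms of the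
   two products agree. *)
have Wab : LF ax ay * LH bx by_ = LF bx by_ * LH ax ay.
  rewrite /LF /LH /lin; apply/eqP; rewrite -subr_eq0; apply/eqP.
  have -> : forall a b c e (f g h i : R[i]),
    (a * f + b * g) * (c * h + e * i) - (a * h + b * i) * (c * f + e * g) =
    (a * e - b * c) * (f * i - g * h) by move=> *; ring.
  by rewrite (W _ _ a0) subrr mul0r.
have -> : (F (x + ax) (y + ay) - F x y) * (H x3 y3 - H (x + ax) (y + ay)) -
  (F (x + bx) (y + by_) - F x y) * (H x3 y3 - H (x + bx) (y + by_)) =
  ((F (x + ax) (y + ay) - F x y) * (H x3 y3 - H (x + ax) (y + ay)) - LF ax ay * LH bx by_) -
  ((F (x + bx) (y + by_) - F x y) * (H x3 y3 - H (x + bx) (y + by_)) - LF bx by_ * LH ax ay).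
  by rewrite Wab; ring.
apply: le_trans (normcB _ _) _.
apply: le_trans (lerD P1 P2) _.
have E : C * d * (11 * C' * d ^+ 2) + C * d ^+ 2 * (C' * d + 11 * C' * d ^+ 2) <= K1 * d ^+ 3.
  have T : C * d ^+ 2 * (C' * d + 11 * C' * d ^+ 2) <= C * d ^+ 2 * (C' * d + 11 * C' * d).
    by rewrite ler_wpM2l ?mulr_ge0 ?exprn_ge0 // lerD2l ler_wpM2l // mulr_ge0.
  have -> : K1 * d ^+ 3 = C * d * (11 * C' * d ^+ 2) + C * d ^+ 2 * (C' * d + 11 * C' * d).
    by rewrite /K1; ring.
  by rewrite lerD2l.
apply: le_trans (lerD E E) _.
by rewrite le_eqVlt; apply/orP; left; apply/eqP; ring.
Qed.

Definition px (r t : R) := r * cos t.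
Definition py (r t : R) := r * sin t.

Lemma cos_lip (s t : R) : `|cos t - cos s| <= `|t - s|.
Proof.
rewrite -[leRHS]mul1r; apply: (@mvt_bound R _ (fun u => - sin u)) => u _.
by split; [exact: is_derive_cos|rewrite normrN sin_max].
Qed.

Lemma sin_lip (s t : R) : `|sin t - sin s| <= `|t - s|.
Proof.
rewrite -[leRHS]mul1r; apply: (@mvt_bound R _ (fun u => cos u)) => u _.
by split; [exact: is_derive_sin|rewrite cos_max].
Qed.

Definition angle (N j : nat) : R := j%:R * (2 * pi / N%:R).

Definition circ_sum F H (N : nat) (r : R) : R[i] :=
  \sum_(j < N) F (px r (angle N j)) (py r (angle N j)) *
    (H (px r (angle N j.+1)) (py r (angle N j.+1)) - H (px r (angle N j)) (py r (angle N j))).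

Lemma angleS N j : angle N j.+1 - angle N j = 2 * pi / N%:R.
Proof. by rewrite /angle -natr1; ring. Qed.

Lemma angle_period N : (0 < N)%N -> cos (angle N N) = 1 /\ sin (angle N N) = 0.
Proof.
move=> N0; have -> : angle N N = pi *+ 2.
  by rewrite /angle mulrC divfK ?pnatr_eq0 -?lt0n // mulr_natl.
by rewrite cos2pi sin2pi.
Qed.

Lemma angle0 N : angle N 0 = 0. Proof. by rewrite /angle mul0r. Qed.

(** The difference of two circle sums is the sum of the cell terms up to the contribution [g] of the
    radial edges, which telescopes around the closed circle. *)
Lemma circ_sum_step F H (N : nat) (r r' K : R) : (0 < N)%N ->
  (forall j : nat,
     let X s i := px s (angle N i) in let Y s i := py s (angle N i) in
     nc ((F (X r' j) (Y r' j) - F (X r j) (Y r j)) *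
          (H (X r' j.+1) (Y r' j.+1) - H (X r' j) (Y r' j))
      - (F (X r j.+1) (Y r j.+1) - F (X r j) (Y r j)) *
          (H (X r' j.+1) (Y r' j.+1) - H (X r j.+1) (Y r j.+1))) <= K) ->
  nc (circ_sum F H N r' - circ_sum F H N r) <= N%:R * K.
Proof.
move=> N0 HK; rewrite /circ_sum -sumrB.
pose g j := F (px r (angle N j)) (py r (angle N j)) *
  (H (px r (angle N j)) (py r (angle N j)) - H (px r' (angle N j)) (py r' (angle N j))).
have T : \sum_(j < N) (g j.+1 - g j) = 0.
  rewrite -(big_mkord xpredT (fun j => g j.+1 - g j)) telescope_sumr //.
  have [c s] := angle_period N0.
  by rewrite /g /px /py c s angle0 cos0 sin0 subrr.
rewrite -[X in nc X]addr0 -[X in nc (_ + X)]T -big_split /=.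
apply: le_trans (normc_sum _) _.
rewrite -[N in N%:R * K]card_ord -sum1_card natr_sum mulr_suml; apply: ler_sum => j _.
rewrite mul1r; apply: le_trans (HK j) => /=; rewrite le_eqVlt; apply/orP; left.
by apply/eqP; congr nc; rewrite /g; ring.
Qed.

(** N radial and N angular steps cut the annulus into N^2 cells, each contributing O(N^-3). *)
Lemma circ_sum_stokes (A : R -> R -> Prop) F F1 F2 H H1 H2 (r0 r1 : R) :
  0 < r0 -> r0 <= r1 -> r1 <= 1 ->
  (forall r t, r0 <= r -> r <= r1 -> A (px r t) (py r t)) ->
  quad_on A F F1 F2 -> quad_on A H H1 H2 ->
  (forall x y, A x y -> F1 x y * H2 x y = F2 x y * H1 x y) ->
  exists C : R, 0 <= C /\ forall N : nat, (16 <= N)%N ->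
    nc (circ_sum F H N r0 - circ_sum F H N r1) <= C / N%:R.
Proof.
move=> r00 r01 r11 HA QF QH W.
have [K [K0 HK]] := cell_bound QF QH W.
exists (K * 16 ^+ 3); split=> [|N N16]; first by rewrite mulr_ge0.
have N0 : (0 < N)%N by exact: leq_trans N16.
have Np : 0 < N%:R :> R by rewrite ltr0n.
pose rho i : R := r1 - i%:R * ((r1 - r0) / N%:R).
have rho0 : rho 0%N = r1 by rewrite /rho mul0r subr0.
have rhoN : rho N = r0 by rewrite /rho mulrC divfK ?gt_eqF // subKr.
have rhob i : (i <= N)%N -> r0 <= rho i <= r1.
  move=> iN; have h0 : 0 <= (r1 - r0) / N%:R by rewrite divr_ge0 // subr_ge0.
  have h1 : i%:R * ((r1 - r0) / N%:R) <= N%:R * ((r1 - r0) / N%:R) by rewrite ler_wpM2r // ler_nat.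
  have h2 : 0 <= i%:R * ((r1 - r0) / N%:R) by rewrite mulr_ge0.
  have h3 : N%:R * ((r1 - r0) / N%:R) = r1 - r0 by rewrite mulrC divfK // gt_eqF.
  by rewrite /rho; apply/andP; split; lra.
(* An angular step is 2 pi / N <= 8 / N and displaces each coordinate by at most that much, so 16 /
   N bounds the sum of both; N >= 16 makes d <= 1. *)
pose d : R := 16 / N%:R.
have d0 : 0 <= d by rewrite divr_ge0.
have d1 : d <= 1 by rewrite ler_pdivrMr // mul1r ler_nat.
have pi4 : (pi : R) <= 4.
  by have := @pihalf_lt2 R; lra.
have step i : (i < N)%N -> nc (circ_sum F H N (rho i.+1) - circ_sum F H N (rho i)) <= N%:R * (K * d ^+ 3).
  move=> iN; apply: circ_sum_step => // j /=.
  set r := rho i; set r' := rho i.+1; set t := angle N j; set t' := angle N j.+1.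
  have /andP[ra rb] := rhob i (ltnW iN); have /andP[ra' rb'] := rhob i.+1 iN.
  rewrite -/r in ra rb; rewrite -/r' in ra' rb'.
  have dt : `|t' - t| <= 8 / N%:R.
    rewrite angleS ger0_norm ?divr_ge0 ?mulr_ge0 ?pi_ge0 //.
    rewrite ler_pM2r ?invr_gt0 //; lra.
  have dr : `|r' - r| <= N%:R^-1.
    have -> : r' - r = - ((r1 - r0) / N%:R) by rewrite /r /r' /rho -natr1; ring.
    rewrite normrN ger0_norm ?divr_ge0 ?subr_ge0 // ler_piMl ?invr_ge0 //; lra.
  have rp : 0 <= r <= 1 by apply/andP; split; lra.
  have P0 : A (px r t) (py r t) by exact: HA.
  have P1 : A (px r' t) (py r' t) by exact: HA.
  have P2 : A (px r t') (py r t') by exact: HA.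
  have P3 : A (px r' t') (py r' t') by exact: HA.
  have := HK (px r t) (py r t) (px r' t - px r t) (py r' t - py r t)
    (px r t' - px r t) (py r t' - py r t)
    ((r' - r) * (cos t' - cos t)) ((r' - r) * (sin t' - sin t)) d P0.
  have E1 (u v : R) : u + (v - u) = v by rewrite addrC subrK.
  have E2 : px r' t + (px r t' - px r t + (r' - r) * (cos t' - cos t)) = px r' t' by rewrite /px; ring.
  have E3 : py r' t + (py r t' - py r t + (r' - r) * (sin t' - sin t)) = py r' t' by rewrite /py; ring.
  rewrite !E1 E2 E3; apply=> //.
  - have -> : px r' t - px r t = (r' - r) * cos t by rewrite /px; ring.
    have -> : py r' t - py r t = (r' - r) * sin t by rewrite /py; ring.
    rewrite !normrM; have h1 := ler_pM (normr_ge0 _) (normr_ge0 _) dr (cos_max t).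
    have h2 := ler_pM (normr_ge0 _) (normr_ge0 _) dr (sin_max t).
    have : 0 <= N%:R^-1 :> R by rewrite invr_ge0.
    rewrite /d; lra.
  - have -> : px r t' - px r t = r * (cos t' - cos t) by rewrite /px; ring.
    have -> : py r t' - py r t = r * (sin t' - sin t) by rewrite /py; ring.
    case/andP: rp => rp0 rp1; rewrite !normrM (ger0_norm rp0).
    have h1 := ler_pM rp0 (normr_ge0 _) rp1 (le_trans (cos_lip t t') dt).
    have h2 := ler_pM rp0 (normr_ge0 _) rp1 (le_trans (sin_lip t t') dt).
    rewrite /d; lra.
  - rewrite !normrM.
    have h1 := ler_pM (normr_ge0 _) (normr_ge0 _) dr (le_trans (cos_lip t t') dt).
    have h2 := ler_pM (normr_ge0 _) (normr_ge0 _) dr (le_trans (sin_lip t t') dt).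
    apply: le_trans (lerD h1 h2) _.
    have -> : N%:R^-1 * (8 / N%:R) + N%:R^-1 * (8 / N%:R) = 16 * N%:R^-1 ^+ 2 :> R by ring.
    rewrite /d exprMn ler_wpM2r ?exprn_ge0 ?invr_ge0 //; lra.
have sum i : (i <= N)%N -> nc (circ_sum F H N (rho i) - circ_sum F H N r1) <= i%:R * (N%:R * (K * d ^+ 3)).
  elim: i => [|i IH] iN; first by rewrite rho0 subrr Normc.normc0 mul0r.
  have -> : circ_sum F H N (rho i.+1) - circ_sum F H N r1 =
    (circ_sum F H N (rho i) - circ_sum F H N r1) +
    (circ_sum F H N (rho i.+1) - circ_sum F H N (rho i)) by ring.
  apply: le_trans (normcD _ _) _; rewrite -natr1 mulrDl mul1r lerD ?step //.
  by apply: IH; exact: ltnW.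
have := sum N (leqnn N); rewrite rhoN => h; apply: le_trans h _.
rewrite /d exprMn le_eqVlt; apply/orP; left; apply/eqP; field.
by rewrite gt_eqF.
Qed.

End DiscreteStokes.

(** * Products and powers of Taylor expansions *)

Section TaylorProducts.
Variable R : realType.
Implicit Types (g h : R -> R -> R) (x y : R).

Lemma box_half (e x y : R) : box (Num.min e 2^-1) x y -> box e x y /\ `|x| + `|y| <= 1.
Proof. by case/box_min=> b [/ltW h1 /ltW h2]; split=> //; lra. Qed.

Lemma mono_bound (c x y : R) a b : `|c * (x ^+ a * y ^+ b)| <= `|c| * (`|x| + `|y|) ^+ (a + b).
Proof.
rewrite !normrM !normrX ler_wpM2l // exprD ler_pM ?exprn_ge0 // lerXn2r ?nnegrE ?addr_ge0 //.
  by rewrite lerDl.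
by rewrite lerDr.
Qed.

Lemma taylor_bound m d g : (m <= d)%N -> taylor m d g -> exists e C : R, [/\ 0 < e, 0 <= C &
  forall x y, box e x y -> `|g x y| <= C * (`|x| + `|y|) ^+ m].
Proof.
move=> md; elim=> [c a b ab|{}g C e e0 H|{}g h _ [e [C [e0 C0 H]]] _ [e' [C' [e0' C0' H']]]].
- exists (Num.min 1 2^-1), `|c|; split=> [||x y /box_half[_ xy]]; [|by []|].
    by rewrite lt_min ltr01 invr_gt0 ltr0n.
  apply: le_trans (mono_bound _ _ _ _ _) _; rewrite ler_wpM2l //.
  by rewrite ler_wiXn2l // nrm_ge0.
- exists (Num.min e 2^-1), `|C|; split=> [||x y /box_half[b xy]]; [|by []|].
    by rewrite lt_min e0 invr_gt0 ltr0n.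
  apply: le_trans (H _ _ b) _.
  apply: le_trans (_ : `|C| * (`|x| + `|y|) ^+ d <= _).
    by rewrite ler_wpM2r ?exprn_ge0 ?nrm_ge0 // ler_norm.
  by rewrite ler_wpM2l // ler_wiXn2l // nrm_ge0.
- exists (Num.min e e'), (C + C'); split=> [||x y /box_min[b b']].
  + by rewrite lt_min e0.
  + by rewrite addr_ge0.
  + by rewrite mulrDl; apply: le_trans (ler_normD _ _) _; rewrite lerD ?H ?H'.
Qed.

Lemma taylor_O_mul (g h : R -> R -> R) (C C' e e' : R) d m' D m : 0 < e -> 0 < e' -> 0 <= C' ->
  (forall x y, box e x y -> `|g x y| <= C * (`|x| + `|y|) ^+ d) ->
  (forall x y, box e' x y -> `|h x y| <= C' * (`|x| + `|y|) ^+ m') ->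
  (D <= d + m')%N -> taylor m D (fun x y => g x y * h x y).
Proof.
move=> e0 e0' C0' H H' Dd.
apply: (@taylor_O _ _ _ _ (`|C| * C') (Num.min (Num.min e e') 2^-1)).
  by rewrite !lt_min e0 e0' invr_gt0 ltr0n.
move=> x y /box_half[/box_min[b b'] xy]; rewrite normrM.
have h1 : `|g x y| <= `|C| * (`|x| + `|y|) ^+ d.
  by apply: le_trans (H _ _ b) _; rewrite ler_wpM2r ?exprn_ge0 ?nrm_ge0 // ler_norm.
apply: le_trans (ler_pM _ _ h1 (H' _ _ b')) _ => //.
rewrite mulrACA -exprD ler_wpM2l ?mulr_ge0 // ler_wiXn2l // nrm_ge0.
Qed.

(** An error of degree d in one factor is multiplied by the other factor, of order m'; so the
    accuracy is limited by d + m' and d' + m. *)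
Lemma taylor_mul m d m' d' D g h : (m <= d)%N -> (m' <= d')%N ->
  (D <= d + m')%N -> (D <= d' + m)%N ->
  taylor m d g -> taylor m' d' h -> taylor (m + m') D (fun x y => g x y * h x y).
Proof.
move=> md md' D1 D2 Tg; elim: Tg h => [c a b ab|{}g C e e0 H|{}g g' _ IH _ IH'] h Th.
- elim: Th => [c' a' b' ab'|{}h C' e' e0' H'|{}h h' _ IH _ IH'].
  + have := @taylor_mono R (m + m') D (c * c') (a + a') (b + b').
    rewrite addnACA leq_add // => /(_ isT) T; apply: taylor_ext T _ => x y.
    by rewrite !exprD; ring.
  + have [e [C [e0 C0 H]]] := taylor_bound md (@taylor_mono R m d c a b ab).
    apply: taylor_ext (@taylor_O_mul _ _ C' C e' e d' m D (m + m') e0' e0 C0 H' H D2) _.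
    by move=> x y; rewrite mulrC.
  + by apply: taylor_ext (taylor_add IH IH') _ => x y; rewrite mulrDr.
- have [e' [C' [e0' C0' H']]] := taylor_bound md' Th.
  exact: taylor_O_mul e0 e0' C0' H H' D1.
- by apply: taylor_ext (taylor_add (IH _ Th) (IH' _ Th)) _ => x y; rewrite mulrDl.
Qed.

Lemma taylor_scale m d (c : R) g : taylor m d g -> taylor m d (fun x y => c * g x y).
Proof.
elim=> [c' a b ab|{}g C e e0 H|{}g h _ IH _ IH'].
- by apply: taylor_ext (taylor_mono d (c * c') ab) _ => x y; ring.
- apply: (@taylor_O _ _ _ _ (`|c| * C) e) => // x y b.
  by rewrite normrM -mulrA ler_wpM2l // H.
- by apply: taylor_ext (taylor_add IH IH') _ => x y; rewrite mulrDr.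
Qed.

Definition ctaylor m d (F : R -> R -> R[i]) :=
  taylor m d (fun x y => Re (F x y)) /\ taylor m d (fun x y => Im (F x y)).

Lemma ctaylor_add m d F G : ctaylor m d F -> ctaylor m d G ->
  ctaylor m d (fun x y => F x y + G x y).
Proof.
case=> f1 f2 [g1 g2]; split; [apply: taylor_ext (taylor_add f1 g1) _
  |apply: taylor_ext (taylor_add f2 g2) _] => x y; by case: (F x y) (G x y) => ? ? [].
Qed.

Lemma ctaylor_mul m d m' d' D F G : (m <= d)%N -> (m' <= d')%N ->
  (D <= d + m')%N -> (D <= d' + m)%N ->
  ctaylor m d F -> ctaylor m' d' G -> ctaylor (m + m') D (fun x y => F x y * G x y).
Proof.
move=> md md' D1 D2 [f1 f2] [g1 g2].
have M := @taylor_mul m d m' d' D _ _ md md' D1 D2.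
split.
  apply: taylor_ext (taylor_add (M _ _ f1 g1) (taylor_scale (-1) (M _ _ f2 g2))) _ => x y.
  by case: (F x y) (G x y) => ? ? [? ?] /=; rewrite mulN1r.
apply: taylor_ext (taylor_add (M _ _ f1 g2) (M _ _ f2 g1)) _ => x y.
by case: (F x y) (G x y) => ? ? [? ?].
Qed.

Lemma ctaylor_weaken m m' d F : (m' <= m)%N -> ctaylor m d F -> ctaylor m' d F.
Proof. by move=> mm [h1 h2]; split; exact: taylor_weaken mm _. Qed.

Lemma ctaylor_ext m d F G : ctaylor m d F -> (forall x y, F x y = G x y) -> ctaylor m d G.
Proof. by move=> H E; have -> : G = F by apply/funext => x; apply/funext => y. Qed.

Lemma ctaylor_cst d (c : R[i]) : ctaylor 0 d (fun _ _ => c).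
Proof.
split; [have T := @taylor_mono R 0 d (Re c) 0 0 isT|have T := @taylor_mono R 0 d (Im c) 0 0 isT];
by apply: taylor_ext T _ => x y; rewrite !expr0 !mulr1.
Qed.

Lemma ctaylor_z d : ctaylor 1 d (fun x y => Complex x y).
Proof.
split; [have T := @taylor_mono R 1 d 1 1 0 isT|have T := @taylor_mono R 1 d 1 0 1 isT];
by apply: taylor_ext T _ => x y; rewrite /= !expr0 !expr1 ?mulr1 ?mul1r.
Qed.

Lemma ctaylor_zX d n : (n <= d)%N -> ctaylor n d (fun x y => Complex x y ^+ n).
Proof.
elim: n => [|n IH] nd; first exact: ctaylor_cst.
have d1 : (1 <= d)%N by lia.
have := ctaylor_mul (D := d) d1 (ltnW nd) (leq_addr _ _) (leq_addr _ _) (ctaylor_z d) (IH (ltnW nd)).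
by move/ctaylor_ext; apply => x y; rewrite exprS.
Qed.

(* If [F = c z + O(2)] is known up to degree [k], then [F ^ j] is known up to degree
   [j + k - 1]: powers of [F] gain accuracy. *)
Lemma ctaylor_pow k F (c : R[i]) j : (0 < k)%N -> (0 < j)%N ->
  ctaylor 2 k.+1 (fun x y => F x y - c * Complex x y) ->
  ctaylor j.+1 (k + j) (fun x y => F x y ^+ j - c ^+ j * Complex x y ^+ j).
Proof.
move=> k0 + HF; elim: j => // -[_ _|j IH _].
  by rewrite addn1; apply: ctaylor_ext HF _ => x y; rewrite !expr1.
have {IH} H := IH isT.
have cM m d (G : R -> R -> R[i]) (e : R[i]) : (m <= d)%N -> ctaylor m d G ->
    ctaylor m d (fun x y => e * G x y).
  move=> md T; have := ctaylor_mul (D := d) (leq0n d) md (leq_addr _ _) _ (ctaylor_cst d e) T.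
  by rewrite add0n addn0 leqnn; apply.
(* The product (cz + E)((cz)^(j+1) + E') is expanded, E and E' being the two errors: all three error
   products have order at least j + 3 and accuracy k + j + 2. *)
have T1 : ctaylor j.+3 (k + j.+2) (fun x y => (c * Complex x y) *
    (F x y ^+ j.+1 - c ^+ j.+1 * Complex x y ^+ j.+1)).
  by apply: (@ctaylor_mul 1 k j.+2 (k + j.+1)); [lia|lia|lia|lia|exact: cM (ctaylor_z k)|exact: H].
have T2 : ctaylor j.+3 (k + j.+2) (fun x y => (F x y - c * Complex x y) *
    (c ^+ j.+1 * Complex x y ^+ j.+1)).
  apply: (@ctaylor_mul 2 k.+1 j.+1 (k + j.+1)); [lia|lia|lia|lia|exact: HF|].
  by apply: cM; [lia|apply: ctaylor_zX; lia].
have T3 : ctaylor j.+3 (k + j.+2) (fun x y => (F x y - c * Complex x y) *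
    (F x y ^+ j.+1 - c ^+ j.+1 * Complex x y ^+ j.+1)).
  apply: (@ctaylor_weaken (2 + j.+2)); first lia.
  by apply: (@ctaylor_mul 2 k.+1 j.+2 (k + j.+1)); [lia|lia|lia|lia|exact: HF|exact: H].
apply: ctaylor_ext (ctaylor_add (ctaylor_add T1 T2) T3) _ => x y.
by rewrite !(exprS _ j.+1); ring.
Qed.

End TaylorProducts.

(** * Asymptotics of the contour sums *)

Section RootsOfUnity.
Variable R : realType.
Local Notation nc := (@Normc.normc R).

Definition cis (t : R) : R[i] := Complex (cos t) (sin t).

Lemma cisD s t : cis (s + t) = cis s * cis t.
Proof. by rewrite /cis cosD sinD; apply/eqP; rewrite eq_complex /= eqxx addrC eqxx. Qed.

Lemma cis0 : cis 0 = 1.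
Proof. by rewrite /cis cos0 sin0. Qed.

Lemma cisX t n : cis t ^+ n = cis (n%:R * t).
Proof.
elim: n => [|n IH]; first by rewrite expr0 mul0r cis0.
by rewrite exprS IH -cisD -nat1r mulrDl mul1r.
Qed.

Lemma normc_cis t : nc (cis t) = 1.
Proof. by rewrite /= cos2Dsin2 sqrtr1. Qed.

Lemma cisNK t : cis (- t) * cis t = 1.
Proof. by rewrite -cisD addNr cis0. Qed.

Lemma normc_cisB1 t : nc (cis t - 1) <= 2 * `|t|.
Proof.
have -> : cis t - 1 = Complex (cos t - cos 0) (sin t - sin 0).
  by rewrite cos0 sin0 subr0; apply/eqP; rewrite eq_complex /= subr0 !eqxx.
apply: le_trans (normc_le _ _) _.
have := cos_lip 0 t; have := sin_lip 0 t; rewrite subr0; lra.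
Qed.

Lemma normc_expB1 (u : R[i]) m : nc u = 1 -> nc (u ^+ m - 1) <= m%:R * nc (u - 1).
Proof.
move=> u1; elim: m => [|m IH]; first by rewrite expr0 subrr Normc.normc0 mul0r.
have -> : u ^+ m.+1 - 1 = u * (u ^+ m - 1) + (u - 1) by rewrite exprS; ring.
apply: le_trans (normcD _ _) _; rewrite Normc.normcM u1 mul1r -natr1 mulrDl mul1r.
by rewrite lerD2r.
Qed.

Lemma cis_neq1 (t : R) : 0 < t -> t < 2 * pi -> cis t != 1.
Proof.
move=> t0 t1; apply/eqP => /eqP; rewrite eq_complex /= => /andP[/eqP c _].
have s0 : 0 < sin (t / 2) by apply: sin_gt0_pi; apply/andP; split; lra.
have : cos t = 1 - sin (t / 2) ^+ 2 *+ 2.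
  have {1}-> : t = (t / 2) *+ 2 by rewrite mulr2n; lra.
  by rewrite cos_mulr2n cos2sin2; rewrite !mulr2n; ring.
rewrite c => /eqP; rewrite -subr_eq0 opprB addrCA subrr addr0 mulrn_eq0 /= sqrf_eq0.
by rewrite gt_eqF.
Qed.

Variable N : nat.
Hypothesis N_gt0 : (0 < N)%N.

Definition om : R[i] := cis (2 * pi / N%:R).
Definition omV : R[i] := cis (- (2 * pi / N%:R)).

Lemma omVK : omV * om = 1. Proof. exact: cisNK. Qed.

Lemma omV_exp m : omV ^+ m = (cis (m%:R * (2 * pi / N%:R)))^-1.
Proof.
rewrite /omV cisX mulrN.
have h := cisNK (m%:R * (2 * pi / N%:R)).
have ne : cis (m%:R * (2 * pi / N%:R)) != 0.
  by apply/eqP => z; have := normc_cis (m%:R * (2 * pi / N%:R)); rewrite z Normc.normc0 => /eqP; rewrite eq_sym oner_eq0.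
by apply: (mulIf ne); rewrite h mulVf.
Qed.

Lemma omV_N : omV ^+ N = 1.
Proof.
rewrite omV_exp mulrC divfK ?pnatr_eq0 -?lt0n //.
by rewrite mulr_natl /cis cos2pi sin2pi invr1.
Qed.

Lemma omV_neq1 m : (0 < m < N)%N -> omV ^+ m != 1.
Proof.
case/andP=> m0 mN; rewrite omV_exp invr_eq1; apply: cis_neq1.
  by rewrite mulr_gt0 ?ltr0n // divr_gt0 ?ltr0n // mulr_gt0 // pi_gt0.
have -> : m%:R * (2 * pi / N%:R) = 2 * pi * (m%:R / N%:R) :> R by ring.
by rewrite gtr_pMr ?mulr_gt0 ?pi_gt0 // ltr_pdivrMr ?ltr0n // mul1r ltr_nat.
Qed.

Lemma sum_omV m : (0 < m < N)%N -> \sum_(j < N) omV ^+ (m * j) = 0.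
Proof.
move=> mN; have h := omV_neq1 mN.
apply: (mulfI (_ : omV ^+ m - 1 != 0)); first by rewrite subr_eq0.
rewrite mulr0; under eq_bigr do rewrite exprM.
by rewrite -subrX1 -exprM mulnC exprM omV_N expr1n subrr.
Qed.

Lemma point_om (r : R) j :
  Complex (px r (angle R N j)) (py r (angle R N j)) = r%:C%C * om ^+ j.
Proof.
rewrite /om cisX -/(angle R N j) /px /py /cis.
by apply/eqP; rewrite eq_complex /= !mul0r subr0 addr0 !eqxx.
Qed.

Lemma cos_om j : (cos (angle R N j))%:C%C = (om ^+ j + omV ^+ j) / 2.
Proof.
rewrite /om /omV !cisX mulrN -/(angle R N j) /cis cosN sinN.
by apply/eqP; rewrite eq_complex; apply/andP; split; apply/eqP; rewrite -?mulr2n /=; field.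
Qed.

Lemma sin_om j : (sin (angle R N j))%:C%C = (om ^+ j - omV ^+ j) / (2 * Complex 0 1).
Proof.
rewrite /om /omV !cisX mulrN -/(angle R N j) /cis cosN sinN.
have i2 : (2 * Complex 0 1 : R[i]) = Complex 0 2.
  by apply/eqP; rewrite eq_complex /=; apply/andP; split; apply/eqP; ring.
have i0 : (2 * Complex 0 1 : R[i]) != 0.
  by rewrite i2 eq_complex /= negb_and pnatr_eq0 orbT.
apply: (mulIf i0); rewrite divfK // i2.
by apply/eqP; rewrite eq_complex /=; apply/andP; split; apply/eqP; ring.
Qed.

Lemma om_omV j l : om ^+ j * omV ^+ (l.+1 * j) = omV ^+ (l * j).
Proof.
rewrite mulSn exprD mulrA -exprMn [om * _]mulrC omVK expr1n mul1r //.
Qed.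

(** Each factor cos or sin shifts the frequency by +1 or -1, so only frequencies between l - (a + b)
    and l + (a + b) occur; the hypotheses place them strictly between 0 and N, where no aliasing
    arises. *)
Lemma sum_mono_om (r : R) a b l : (a + b < l)%N -> (l + (a + b) < N)%N ->
  \sum_(j < N) ((px r (angle R N j)) ^+ a * (py r (angle R N j)) ^+ b)%:C%C * omV ^+ (l * j) = 0.
Proof.
elim: a l => [|a IH] l.
  elim: b l => [|b IH] l h1 h2.
    under eq_bigr do rewrite !expr0 mulr1 mul1r.
    by apply: sum_omV; lia.
  case: l h1 h2 => // l h1 h2.
  pose f m (j : 'I_N) := (px r (angle R N j) ^+ 0 * py r (angle R N j) ^+ b)%:C%C * omV ^+ (m * j).
  have E : forall j : 'I_N, (px r (angle R N j) ^+ 0 * py r (angle R N j) ^+ b.+1)%:C%C * omV ^+ (l.+1 * j)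
     = r%:C%C / (2 * Complex 0 1) * (f l j - f l.+2 j).
    move=> j; rewrite /f -(om_omV j l) exprS {1}/py !rmorphM /= sin_om.
    by rewrite (mulSn l.+1 j) exprD; ring.
  rewrite (eq_bigr _ (fun j _ => E j)) -mulr_sumr sumrB.
  by rewrite !IH ?subrr ?mulr0 //; lia.
move=> h1 h2; case: l h1 h2 => // l h1 h2.
pose f m (j : 'I_N) := (px r (angle R N j) ^+ a * py r (angle R N j) ^+ b)%:C%C * omV ^+ (m * j).
have E : forall j : 'I_N, (px r (angle R N j) ^+ a.+1 * py r (angle R N j) ^+ b)%:C%C * omV ^+ (l.+1 * j)
   = r%:C%C / 2 * (f l j + f l.+2 j).
  move=> j; rewrite /f -(om_omV j l) exprS {1}/px !rmorphM /= cos_om.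
  by rewrite (mulSn l.+1 j) exprD; ring.
rewrite (eq_bigr _ (fun j _ => E j)) -mulr_sumr big_split /=.
by rewrite !IH ?addr0 ?mulr0 //; lia.
Qed.

End RootsOfUnity.

Section Asymptotics.
Variables (R : realType) (k : nat).
Hypothesis k_gt0 : (0 < k)%N.
Local Notation nc := (@Normc.normc R).
Implicit Types (x y r : R).

(* [psi x y = t * ell^`() t] at [t = x^2 + y^2], which makes [Gk] holomorphic for the
   structure away from [0]. *)
Definition ell (t : R) : R := ln (1 + ln (1 + (t ^+ k)^-1)) / (2 * k%:R).

Definition Gk x y : R[i] := (Complex x y)^-1 ^+ k - (k%:R * ell (sq2 x y))%:C%C.
Definition Hk x y : R[i] := Gk x y ^+ 2.

Lemma ell_ge0 t : 0 < t -> 0 <= ell t.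
Proof.
move=> t0; rewrite divr_ge0 ?mulr_ge0 // ln_ge0 //.
by apply/ltW; exact: lam_denom_gt1.
Qed.

Lemma exprD1_ge (u : R) n : (0 < n)%N -> 0 <= u -> 1 + u ^+ n <= (1 + u) ^+ n.
Proof.
move=> + u0; elim: n => // -[_ _|n IH _]; first by rewrite !expr1.
have := IH isT; rewrite ![_ ^+ n.+2]exprS => h.
have p0 : 0 <= u ^+ n.+1 by rewrite exprn_ge0.
have := ler_wpM2l (addr_ge0 ler01 u0) h; nra.
Qed.

(** From ln (1 + s) <= s, used for each logarithm, and 1 + r^(-2k) <= (1 + 1/r)^(2k), which brings
    the exponent out. It absorbs [ell] where an error has one power of r to spare. *)
Lemma ell_mul_le1 r : 0 < r -> ell (r ^+ 2) * r <= 1.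
Proof.
move=> r0; have k0 : 0 < k%:R :> R by rewrite ltr0n.
have ri : 0 < r^-1 by rewrite invr_gt0.
have h1 : ln (1 + ((r ^+ 2) ^+ k)^-1) <= 2 * k%:R * r^-1.
  have -> : ((r ^+ 2) ^+ k)^-1 = r^-1 ^+ (2 * k) by rewrite -exprM exprVn.
  apply: le_trans (_ : ln ((1 + r^-1) ^+ (2 * k)) <= _).
    rewrite ler_ln ?posrE.
    - by apply: exprD1_ge; [lia|exact: ltW].
    - by rewrite ltr_pwDl // exprn_ge0 // ltW.
    - by rewrite exprn_gt0 // addr_gt0.
  rewrite lnXn ?addr_gt0 //.
  have -> : ln (1 + r^-1) *+ (2 * k) = 2 * k%:R * ln (1 + r^-1) by rewrite -[LHS]mulr_natl natrM.
  rewrite ler_wpM2l ?mulr_ge0 //.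
  by apply: le_ln1Dx; lra.
have h2 : ln (1 + ln (1 + ((r ^+ 2) ^+ k)^-1)) <= 2 * k%:R * r^-1.
  apply: le_trans h1; apply: le_ln1Dx; apply: lt_le_trans (ltrN10 R) _.
  by apply: ln_ge0; rewrite lerDl invr_ge0 !exprn_ge0 // ltW.
rewrite /ell mulrAC ler_pdivrMr ?mulr_gt0 // mul1r.
by have := ler_wpM2r (ltW r0) h2; rewrite mulfVK // gt_eqF.
Qed.

Lemma ell_unbounded (B : R) : exists2 d : R, 0 < d & forall t, 0 < t -> t < d -> B < ell t.
Proof.
have k0 : 0 < k%:R :> R by rewrite ltr0n.
(* The two exponentials undo the two logarithms of [ell], and 2k compensates its denominator. *)
exists (Num.min 1 (expR (- expR (2 * k%:R * B)))).
  by rewrite lt_min ltr01 expR_gt0.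
move=> t t0; rewrite lt_min => /andP[t1 te].
have tk : t ^+ k <= t by rewrite -[leRHS]expr1 ler_wiXn2l // ltW.
have tinv : t^-1 <= (t ^+ k)^-1 by rewrite lef_pV2 // posrE exprn_gt0.
have e1 : 0 < expR (2 * k%:R * B) by rewrite expR_gt0.
have h1 : expR (2 * k%:R * B) < ln (1 + (t ^+ k)^-1).
  rewrite -[ltLHS]expRK ltr_ln ?posrE ?expR_gt0 //.
    have : expR (expR (2 * k%:R * B)) < t^-1.
      by rewrite -[expR (2 * k%:R * B)]opprK expRN ltf_pV2 // posrE expR_gt0.
    lra.
  by rewrite ltr_wpDr ?invr_ge0 ?exprn_ge0 // ltW.
rewrite /ell ltr_pdivlMr ?mulr_gt0 // mulrC -[ltLHS]expRK ltr_ln ?posrE ?expR_gt0 //; lra.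
Qed.

Lemma normc_sum_le n (F : 'I_n -> R[i]) (B : R) : (forall i, nc (F i) <= B) ->
  nc (\sum_i F i) <= n%:R * B.
Proof.
move=> H; apply: le_trans (normc_sum _) _.
rewrite -[n in n%:R]card_ord -sum1_card natr_sum mulr_suml; apply: ler_sum => j _.
by rewrite mul1r.
Qed.

Lemma px_le r t : 0 <= r -> `|px r t| <= r.
Proof. by move=> r0; rewrite normrM (ger0_norm r0) ler_piMr // cos_max. Qed.

Lemma py_le r t : 0 <= r -> `|py r t| <= r.
Proof. by move=> r0; rewrite normrM (ger0_norm r0) ler_piMr // sin_max. Qed.

Lemma normc_omV (N : nat) : nc (omV R N) = 1. Proof. exact: normc_cis. Qed.

Lemma normc_omVX (N : nat) i : nc (omV R N ^+ i) = 1.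
Proof. by rewrite normcX normc_omV expr1n. Qed.

(** N times a discrete Fourier coefficient of f on the circle of radius r, at frequency l. *)
Definition circ_coef (f : R -> R -> R[i]) (N l : nat) r :=
  \sum_(j < N) f (px r (angle R N j)) (py r (angle R N j)) * omV R N ^+ (l * j).

(** Monomials of degree below d are annihilated exactly at frequency d, where N >= 2d excludes
    aliasing; everything else is O(r^d) at each sample point. *)
Lemma circ_coef_bound m d (g : R -> R -> R) : taylor m d g ->
  exists e C : R, [/\ 0 < e, 0 <= C & forall (N : nat) r, (0 < N)%N -> (2 * d <= N)%N ->
    0 <= r -> r < e -> nc (circ_coef (fun x y => (g x y)%:C%C) N d r) <= N%:R * (C * r ^+ d)].
Proof.
elim=> [c a b ab|{}g C e e0 H|{}g h _ [e [C [e0 C0 H]]] _ [e' [C' [e0' C0' H']]]].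
- exists 1, `|c|; split=> // N r N0 dN r0 r1; rewrite /circ_coef.
  have [abd|abd] := ltnP (a + b) d.
    under eq_bigr do rewrite rmorphM /= -mulrA.
    rewrite -mulr_sumr sum_mono_om //; last by lia.
    by rewrite mulr0 Normc.normc0 !mulr_ge0 // exprn_ge0.
  apply: normc_sum_le => j; rewrite Normc.normcM normc_omVX mulr1 normc_real.
  rewrite normrM ler_wpM2l // normrM !normrX.
  apply: le_trans (_ : r ^+ a * r ^+ b <= _).
    by rewrite ler_pM ?exprn_ge0 // lerXn2r ?nnegrE ?px_le ?py_le.
  by rewrite -exprD ler_wiXn2l // ltW.
- exists e, (`|C| * 2 ^+ d); split; [exact: e0|by rewrite mulr_ge0 // exprn_ge0|].
  move=> N r N0 dN r0 re; apply: normc_sum_le => j.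
  rewrite Normc.normcM normc_omVX mulr1 normc_real.
  have hx := px_le (angle R N j) r0; have hy := py_le (angle R N j) r0.
  apply: le_trans (H _ _ _) _; first by split; exact: le_lt_trans re.
  rewrite -mulrA -exprMn.
  apply: le_trans (ler_wpM2r _ (ler_norm C)) _; first by rewrite exprn_ge0 // nrm_ge0.
  by rewrite ler_wpM2l // lerXn2r ?nnegrE ?nrm_ge0 ?mulr_ge0 //; lra.
- exists (Num.min e e'), (C + C'); split=> [||N r N0 dN r0].
  + by rewrite lt_min e0.
  + by rewrite addr_ge0.
  rewrite lt_min => /andP[re re'].
  have -> : circ_coef (fun x y => (g x y + h x y)%:C%C) N d r =
    circ_coef (fun x y => (g x y)%:C%C) N d r + circ_coef (fun x y => (h x y)%:C%C) N d r.
    by rewrite /circ_coef -big_split; apply: eq_bigr => j _ /=; rewrite rmorphD mulrDl.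
  apply: le_trans (normcD _ _) _; rewrite mulrDl mulrDr lerD ?H ?H' //.
Qed.

Lemma circ_coef_cbound m d (F : R -> R -> R[i]) : ctaylor m d F ->
  exists e C : R, [/\ 0 < e, 0 <= C & forall (N : nat) r, (0 < N)%N -> (2 * d <= N)%N ->
    0 <= r -> r < e -> nc (circ_coef F N d r) <= N%:R * (C * r ^+ d)].
Proof.
case=> /circ_coef_bound[e [C [e0 C0 H]]] /circ_coef_bound[e' [C' [e0' C0' H']]].
exists (Num.min e e'), (C + C'); split=> [||N r N0 dN r0].
- by rewrite lt_min e0.
- by rewrite addr_ge0.
rewrite lt_min => /andP[re re'].
have -> : circ_coef F N d r = circ_coef (fun x y => (Re (F x y))%:C%C) N d r +
   Complex 0 1 * circ_coef (fun x y => (Im (F x y))%:C%C) N d r.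
  rewrite /circ_coef mulr_sumr -big_split; apply: eq_bigr => j _ /=.
  by rewrite mulrA -mulrDl -complexE.
apply: le_trans (normcD _ _) _; rewrite Normc.normcM normc_i mul1r mulrDl mulrDr.
by rewrite lerD ?H ?H'.
Qed.

Lemma ctaylor_bound m d (F : R -> R -> R[i]) : (m <= d)%N -> ctaylor m d F ->
  exists e C : R, [/\ 0 < e, 0 <= C & forall r t, 0 <= r -> r < e ->
    nc (F (px r t) (py r t)) <= C * r ^+ m].
Proof.
move=> md [/(taylor_bound md)[e [C [e0 C0 H]]] /(taylor_bound md)[e' [C' [e0' C0' H']]]].
exists (Num.min e e'), ((C + C') * 2 ^+ m); split=> [||r t r0].
- by rewrite lt_min e0.
- by rewrite mulr_ge0 ?addr_ge0 // exprn_ge0.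
rewrite lt_min => /andP[re re'].
have hx := px_le t r0; have hy := py_le t r0.
have b : box e (px r t) (py r t) by split; exact: le_lt_trans re.
have b' : box e' (px r t) (py r t) by split; exact: le_lt_trans re'.
have B : (`|px r t| + `|py r t|) ^+ m <= 2 ^+ m * r ^+ m.
  by rewrite -exprMn lerXn2r ?nnegrE ?addr_ge0 ?mulr_ge0 //; lra.
have -> : F (px r t) (py r t) = Complex (Re (F (px r t) (py r t))) (Im (F (px r t) (py r t))).
  by case: (F _ _).
apply: le_trans (normc_le _ _) _.
apply: le_trans (lerD (H _ _ b) (H' _ _ b')) _.
by rewrite -mulrDl -mulrA ler_wpM2l // addr_ge0.
Qed.

Lemma sq2_polar r t : sq2 (px r t) (py r t) = r ^+ 2.
Proof.
have -> : sq2 (px r t) (py r t) = r ^+ 2 * (cos t ^+ 2 + sin t ^+ 2) by rewrite /sq2 /px /py; ring.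
by rewrite cos2Dsin2 mulr1.
Qed.

Lemma om_inv (N : nat) : (om R N)^-1 = omV R N.
Proof.
have h := omVK R N; have n0 : om R N != 0.
  by apply/eqP => z; move: h; rewrite z mulr0 => /eqP; rewrite eq_sym oner_eq0.
by apply: (mulIf n0); rewrite mulVf.
Qed.

Lemma Hk_circle (N j : nat) r :
  Hk (px r (angle R N j)) (py r (angle R N j)) =
  ((r^-1)%:C%C ^+ k * omV R N ^+ (k * j) - (k%:R * ell (r ^+ 2))%:C%C) ^+ 2.
Proof.
rewrite /Hk /Gk sq2_polar point_om invfM -exprVn om_inv exprMn -exprM [(j * k)%N]mulnC.
by rewrite fmorphV.
Qed.

(** On the circle [ell] is a constant L, and (p b' - L)^2 - (p b - L)^2 contains no L^2: there
    remain the pole at frequency 2k and the cross term, linear in L, at frequency k. *)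
Lemma circ_sum_Hk F (N : nat) r :
  circ_sum F Hk N r =
  (r^-1)%:C%C ^+ (2 * k) * (omV R N ^+ (2 * k) - 1) * circ_coef F N (2 * k) r
  - 2 * (k%:R * ell (r ^+ 2))%:C%C * (r^-1)%:C%C ^+ k * (omV R N ^+ k - 1) * circ_coef F N k r.
Proof.
rewrite /circ_sum /circ_coef !mulr_sumr -sumrB; apply: eq_bigr => j _.
have E2 i : (2 * k * i = k * i + k * i)%N by lia.
have E1 : (2 * k = k + k)%N by lia.
rewrite !Hk_circle mulnS E2 E1 !exprD.
set p := (_ ^+ k : R[i]); set a := omV R N ^+ k; set b := omV R N ^+ (k * j).
set L := (k%:R * _)%:C%C; set f := F _ _; ring.
Qed.

(** [kappa] does not depend on r, so it multiplies the difference of [ell] at two radii; C and the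
    lower bound for |kappa| do not depend on M, so the number of sample points can be chosen after
    the radii. *)
Lemma circ_sum_asymptotics F (c : R[i]) :
  ctaylor k.+1 (k + k) (fun x y => F x y - c * Complex x y ^+ k) ->
  exists e C : R, [/\ 0 < e, 0 <= C & forall M : nat, (2 <= M)%N ->
    exists2 kappa : R[i], nc c <= nc kappa & forall r, 0 < r -> r < e ->
      nc (circ_sum F Hk (2 * k * M) r - kappa * (ell (r ^+ 2))%:C%C) <= C].
Proof.
move=> Th.
have TF : ctaylor 0 (2 * k) F.
  have cz : ctaylor 0 (2 * k) (fun x y => c * Complex x y ^+ k).
    apply: (@ctaylor_weaken _ (0 + k)) => //.
    by apply: (@ctaylor_mul _ 0 (2 * k) k (2 * k)); [lia|lia|lia|lia|exact: ctaylor_cst|apply: ctaylor_zX; lia].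
  have Th0 := ctaylor_weaken (leq0n k.+1) Th.
  have -> : (2 * k = k + k)%N by lia.
  rewrite (_ : (2 * k = k + k)%N) in cz; last by lia.
  by apply: ctaylor_ext (ctaylor_add Th0 cz) _ => x y; rewrite subrK.
have [e1 [C1 [e10 C10 H1]]] := circ_coef_cbound TF.
have kk : (k.+1 <= k + k)%N by lia.
have [e2 [C2 [e20 C20 H2]]] := ctaylor_bound kk Th.
(* |omV^m - 1| <= 16 m / N is used with m = 2k for the pole and with m = k for the cross term, the
   latter carrying the further factor 2k and [ell] r <= 1. *)
exists (Num.min e1 e2), (32 * k%:R * C1 + 32 * k%:R ^+ 2 * C2); split=> [||M M2].
- by rewrite lt_min e10.
- by rewrite addr_ge0 // !mulr_ge0 // exprn_ge0.
set N := (2 * k * M)%N; have N0 : (0 < N)%N by rewrite /N; lia.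
have dN : (2 * (2 * k) <= N)%N by rewrite /N [(2 * (2 * k))%N]mulnC leq_mul2l M2 orbT.
have Np : 0 < N%:R :> R by rewrite ltr0n.
have kp : 0 < k%:R :> R by rewrite ltr0n.
have V1 : nc (omV R N - 1) <= 16 / N%:R.
  apply: le_trans (normc_cisB1 _) _; rewrite normrN ger0_norm ?divr_ge0 ?mulr_ge0 ?pi_ge0 //.
  rewrite mulrA ler_pM2r ?invr_gt0 //; have := @pihalf_lt2 R; lra.
have Vm m : nc (omV R N ^+ m - 1) <= m%:R * (16 / N%:R).
  by apply: le_trans (normc_expB1 _ (normc_omV N)) _; rewrite ler_wpM2l.
(* The coefficient of [ell] in the cross term once F is replaced by c z^k, whose sum at frequency k
   is c r^k N. *)
exists (- (2 * k%:R * (omV R N ^+ k - 1) * N%:R * c)).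
  (* N = 2kM makes the M-th power of omV^k equal to -1; as |u^M - 1| <= M |u - 1| for |u| = 1, this
     gives M |omV^k - 1| >= 2 and keeps [kappa] away from 0 for all M. *)
  have VM : (omV R N ^+ k) ^+ M = -1.
    rewrite -exprM omV_exp.
    have -> : (k * M)%:R * (2 * pi / N%:R) = pi :> R.
      by rewrite /N !natrM; field; rewrite !gt_eqF ?ltr0n //; lia.
    rewrite /cis cospi sinpi.
    have -> : Complex (-1) 0 = -1 :> R[i] by apply/eqP; rewrite eq_complex /= oppr0 !eqxx.
    by rewrite invrN invr1.
  have h := normc_expB1 M (normc_omVX N k).
  have two : nc ((-1 : R[i]) - 1) = 2.
    rewrite -opprD normcNE; have -> : 1 + 1 = (2 : R)%:C%C :> R[i] by rewrite rmorphD rmorph1.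
    by rewrite normc_real ger0_norm.
  rewrite VM two in h.
  have nR (a : R) : 0 <= a -> nc (a%:C%C) = a by move=> a0; rewrite normc_real ger0_norm.
  have nat_nc m : nc (m%:R) = m%:R.
    by rewrite -(rmorph_nat (real_complex R) m) nR.
  rewrite normcNE !Normc.normcM !nat_nc ler_peMl ?normc_ge0 //.
  set w := nc _ in h *.
  have k1 : 1 <= k%:R :> R by rewrite ler1n.
  have -> : 2 * k%:R * w * N%:R = 4 * k%:R ^+ 2 * (M%:R * w) by rewrite /N !natrM; ring.
  have k2 : 1 <= k%:R ^+ 2 :> R by rewrite exprn_ege1.
  nra.
move=> r r0; rewrite lt_min => /andP[re1 re2].
pose hs := circ_coef (fun x y => F x y - c * Complex x y ^+ k) N k r.
have Ek : circ_coef F N k r = c * r%:C%C ^+ k * N%:R + hs.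
  rewrite /hs /circ_coef.
  have -> : c * r%:C%C ^+ k * N%:R = \sum_(j < N) c * r%:C%C ^+ k.
    by rewrite sumr_const card_ord mulr_natr.
  rewrite -big_split; apply: eq_bigr => j _ /=; rewrite point_om exprMn.
  have : om R N ^+ j ^+ k * omV R N ^+ (k * j) = 1.
    by rewrite -exprM mulnC -exprMn [om R N * _]mulrC omVK expr1n.
  set p := om R N ^+ j ^+ k; set q := omV R N ^+ (k * j) => pq.
  by rewrite mulrBl -[X in _ = X + _]mulr1 -pq; ring.
have rk : (r^-1)%:C%C ^+ k * r%:C%C ^+ k = 1 :> R[i].
  by rewrite -exprMn -rmorphM mulVf ?rmorph1 ?expr1n // gt_eqF.
set l := ell (r ^+ 2).
have l0 : 0 <= l by rewrite ell_ge0 // exprn_gt0.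
have -> : circ_sum F Hk N r - - (2 * k%:R * (omV R N ^+ k - 1) * N%:R * c) * l%:C%C =
   (r^-1)%:C%C ^+ (2 * k) * (omV R N ^+ (2 * k) - 1) * circ_coef F N (2 * k) r
  - 2 * (k%:R * l)%:C%C * (r^-1)%:C%C ^+ k * (omV R N ^+ k - 1) * hs.
  rewrite circ_sum_Hk Ek -/l; set A := _ * circ_coef F N (2 * k) r.
  rewrite rmorphM rmorph_nat; move: rk; set p := (r^-1)%:C%C ^+ k; set q := r%:C%C ^+ k => pq.
  have -> : 2 * (k%:R * l%:C%C) * p * (omV R N ^+ k - 1) * (c * q * N%:R + hs) =
    2 * k%:R * (omV R N ^+ k - 1) * N%:R * c * l%:C%C * (p * q) +
    2 * (k%:R * l%:C%C) * p * (omV R N ^+ k - 1) * hs by ring.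
  by rewrite pq; ring.
have nR (a : R) : 0 <= a -> nc (a%:C%C) = a by move=> a0; rewrite normc_real ger0_norm.
have nat_nc m : nc (m%:R) = m%:R by rewrite -(rmorph_nat (real_complex R) m) nR.
apply: le_trans (normcB _ _) _; rewrite !Normc.normcM !normcX nat_nc.
have kl0 : 0 <= k%:R * l := mulr_ge0 (ltW kp) l0.
rewrite (nR _ kl0) !nR ?invr_ge0 ?(ltW r0) //.
have ri : 0 < r^-1 by rewrite invr_gt0.
have b1 : nc (circ_coef F N (2 * k) r) <= N%:R * (C1 * r ^+ (2 * k)).
  by exact: (H1 N r N0 dN (ltW r0) re1).
have b2 : nc hs <= N%:R * (C2 * r ^+ k.+1).
  apply: normc_sum_le => j; rewrite Normc.normcM normc_omVX mulr1.
  exact: (H2 r _ (ltW r0) re2).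
have P1 : r^-1 ^+ (2 * k) * nc (omV R N ^+ (2 * k) - 1) * nc (circ_coef F N (2 * k) r)
   <= 32 * k%:R * C1.
  apply: le_trans (_ : r^-1 ^+ (2 * k) * ((2 * k)%:R * (16 / N%:R)) * (N%:R * (C1 * r ^+ (2 * k))) <= _).
    apply: ler_pM => //; rewrite ?mulr_ge0 ?exprn_ge0 ?normc_ge0 ?(ltW ri) //.
    by rewrite ler_wpM2l ?exprn_ge0 ?(ltW ri).
  rewrite le_eqVlt; apply/orP; left; apply/eqP; rewrite exprVn natrM.
  by field; rewrite gt_eqF //= expf_neq0 // gt_eqF.
have P2 : 2 * (k%:R * l) * r^-1 ^+ k * nc (omV R N ^+ k - 1) * nc hs <= 32 * k%:R ^+ 2 * C2.
  have lr := ell_mul_le1 r0; rewrite -/l in lr.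
  apply: le_trans (_ : 2 * (k%:R * l) * r^-1 ^+ k * (k%:R * (16 / N%:R)) * (N%:R * (C2 * r ^+ k.+1)) <= _).
    have n0 : 0 <= 2 * (k%:R * l) * r^-1 ^+ k.
      by apply: mulr_ge0; [apply: mulr_ge0 => //; exact: mulr_ge0|rewrite exprn_ge0 // ltW].
    apply: ler_pM; [by rewrite mulr_ge0 // normc_ge0|exact: normc_ge0| |exact: b2].
    by rewrite ler_wpM2l.
  have -> : 2 * (k%:R * l) * r^-1 ^+ k * (k%:R * (16 / N%:R)) * (N%:R * (C2 * r ^+ k.+1)) =
     32 * k%:R ^+ 2 * C2 * (l * r).
    by rewrite exprVn exprS; field; rewrite gt_eqF //= expf_neq0 // gt_eqF.
  by rewrite ler_piMr // !mulr_ge0 // exprn_ge0.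
exact: lerD.
Qed.

End Asymptotics.

(** * Nonexistence of regular charts *)

Section Nonexistence.
Variables (R : realType) (k : nat).
Hypothesis k_gt0 : (0 < k)%N.
Local Notation nc := (@Normc.normc R).
Local Notation Ci := (Complex 0 1 : R[i]).
Implicit Types (x y r : R) (A : R -> R -> Prop).

Section OnAnnulus.
Variables (A : R -> R -> Prop) (rho : R).
Hypothesis rho_gt0 : 0 < rho.
Hypothesis A_far : forall x y, A x y -> rho <= sq2 x y.
Hypothesis A_box : forall x y, A x y -> box 1 x y.

Lemma quad_on_x : quad_on A (fun x _ => x%:C%C) (fun _ _ => 1) (fun _ _ => 0).
Proof.
exists 1; split=> // x y x' y' /A_box[/ltW bx _] _.
have d0 : `|x' - x| <= dist1 x y x' y' by rewrite lerDl.
have E : x'%:C%C - x%:C%C = (x' - x)%:C%C :> R[i] by rewrite rmorphB.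
have L : lin (fun _ _ => 1) (fun _ _ => 0) x y (x' - x) (y' - y) = (x' - x)%:C%C :> R[i].
  by rewrite /lin mul1r mul0r addr0.
rewrite L E subrr Normc.normc1 Normc.normc0 !normc_real !mul1r.
by split=> //; rewrite exprn_ge0 // dist1_ge0.
Qed.

Lemma quad_on_y : quad_on A (fun _ y => y%:C%C) (fun _ _ => 0) (fun _ _ => 1).
Proof.
exists 1; split=> // x y x' y' /A_box[_ /ltW bx] _.
have d0 : `|y' - y| <= dist1 x y x' y' by rewrite lerDr.
have E : y'%:C%C - y%:C%C = (y' - y)%:C%C :> R[i] by rewrite rmorphB.
have L : lin (fun _ _ => 0) (fun _ _ => 1) x y (x' - x) (y' - y) = (y' - y)%:C%C :> R[i].
  by rewrite /lin mul1r mul0r add0r.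
rewrite L E subrr Normc.normc1 Normc.normc0 !normc_real !mul1r.
by split=> //; rewrite exprn_ge0 // dist1_ge0.
Qed.

Lemma sq2_gt0 x y : A x y -> 0 < sq2 x y.
Proof. by move=> a; exact: lt_le_trans (A_far a). Qed.

Lemma complex_split x y : Complex x y = x%:C%C + Ci * y%:C%C.
Proof. by rewrite [LHS]complexE. Qed.

Lemma quad_on_z : quad_on A (fun x y => Complex x y) (fun _ _ => 1) (fun _ _ => Ci).
Proof.
apply: quad_on_ext (quad_on_add quad_on_x (quad_on_mul (quad_on_cst A Ci) quad_on_y)) _.
move=> x y _; rewrite complex_split; split=> //; first by ring.
by ring.
Qed.

Lemma quad_on_sq2 : quad_on A (fun x y => (sq2 x y)%:C%C) (fun x _ => (2 * x)%:C%C)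
  (fun _ y => (2 * y)%:C%C).
Proof.
apply: quad_on_ext (quad_on_add (quad_on_mul quad_on_x quad_on_x)
  (quad_on_mul quad_on_y quad_on_y)) _ => x y _.
rewrite /sq2 !expr2 rmorphD !rmorphM rmorph_nat /=.
by split=> //; ring.
Qed.

(** [ell] is assembled from |z|^2 by a power, an inverse and two logarithms; the arguments of both
    logarithms are at least 1, and the derivative given by the chain rule collapses to [psi]. *)
Lemma quad_on_kell : quad_on A (fun x y => (k%:R * ell k (sq2 x y))%:C%C)
  (fun x y => (2 * k%:R * x * psi k x y / sq2 x y)%:C%C)
  (fun x y => (2 * k%:R * y * psi k x y / sq2 x y)%:C%C).
Proof.
have tk x y : A x y -> rho ^+ k <= nc ((sq2 x y)%:C%C ^+ k).
  move=> a; rewrite normcX normc_real ger0_norm ?sq2_ge0 //.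
  by rewrite lerXn2r ?nnegrE ?sq2_ge0 ?A_far // ltW.
have q1 := quad_on_inv (exprn_gt0 k rho_gt0) tk (quad_on_pow k quad_on_sq2).
have q2 := quad_on_add (quad_on_cst A 1) q1.
pose u1 x y : R := 1 + (sq2 x y ^+ k)^-1.
have Eu1 x y : (u1 x y)%:C%C = 1 + ((sq2 x y)%:C%C ^+ k)^-1.
  by rewrite rmorphD rmorph1 /= fmorphV rmorphXn.
have u1_ge1 x y : A x y -> 1 <= u1 x y.
  by move=> a; rewrite lerDl invr_ge0 exprn_ge0 // sq2_ge0.
have q3 : quad_on A (fun x y => (u1 x y)%:C%C) _ _ := quad_on_ext q2 (fun x y _ => And3 (Eu1 x y) erefl erefl).
have q4 := quad_on_ln ltr01 u1_ge1 q3.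
have q5 := quad_on_add (quad_on_cst A 1) q4.
pose u2 x y : R := 1 + ln (u1 x y).
have Eu2 x y : (u2 x y)%:C%C = 1 + (ln (u1 x y))%:C%C by rewrite rmorphD rmorph1.
have u2_ge1 x y : A x y -> 1 <= u2 x y.
  by move=> a; rewrite lerDl ln_ge0 // u1_ge1.
have q6 : quad_on A (fun x y => (u2 x y)%:C%C) _ _ := quad_on_ext q5 (fun x y _ => And3 (Eu2 x y) erefl erefl).
have q7 := quad_on_ln ltr01 u2_ge1 q6.
apply: quad_on_ext (quad_on_mul (quad_on_cst A (2^-1)%:C%C) q7) _ => x y a.
have t0 := sq2_gt0 a; have k0 : 0 < k%:R :> R by rewrite ltr0n.
have key (v : R) : (2 * k%:R * v * psi k x y / sq2 x y) =
    2^-1 * (- (k%:R * sq2 x y ^+ k.-1 * (2 * v) * (sq2 x y ^+ k)^-1 ^+ 2) * (u1 x y)^-1 * (u2 x y)^-1).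
  rewrite /psi /lam gt_eqF // -/(u1 x y) -/(u2 x y).
  have v0 : u2 x y != 0 by rewrite gt_eqF // (lt_le_trans ltr01) // u2_ge1.
  have dE : damp k (sq2 x y) = (sq2 x y ^+ k)^-1 * (u1 x y)^-1.
    rewrite /damp /u1 -invfM mulrDr mulr1 divff ?gt_eqF ?exprn_gt0 //.
    by rewrite addrC.
  rewrite dE; have tE : sq2 x y ^+ k = sq2 x y * sq2 x y ^+ k.-1 by rewrite -exprS prednK.
  have w0 : u1 x y != 0 by rewrite gt_eqF // (lt_le_trans ltr01) // u1_ge1.
  have p0 : sq2 x y ^+ k.-1 != 0 by rewrite gt_eqF // exprn_gt0.
  have s0 : sq2 x y != 0 by rewrite gt_eqF.
  move: tE p0 s0 v0 w0; set P := sq2 x y ^+ k.-1; set T := sq2 x y; set U := u2 x y; set W := u1 x y.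
  by move=> -> p0 s0 v0 w0; field; rewrite v0 w0 p0 s0.
have E : k%:R * ell k (sq2 x y) = 2^-1 * ln (u2 x y).
  by rewrite /ell -/(u1 x y) -/(u2 x y); field; rewrite gt_eqF.
have push (v : R) (w : R[i]) : w = (2 * v)%:C%C ->
  (2^-1 * (- (k%:R * sq2 x y ^+ k.-1 * (2 * v) * (sq2 x y ^+ k)^-1 ^+ 2) * (u1 x y)^-1 * (u2 x y)^-1))%:C%C
  = 0 * (ln (u2 x y))%:C%C + (2^-1)%:C%C * ((0 + (0 + - (k%:R * (sq2 x y)%:C%C ^+ k.-1 * w * ((sq2 x y)%:C%C ^+ k)^-1 ^+ 2)) * ((u1 x y)^-1)%:C%C) * ((u2 x y)^-1)%:C%C).
  move=> ->; rewrite !(rmorphM (real_complex R), rmorphN (real_complex R),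
    fmorphV (real_complex R), rmorphXn (real_complex R), rmorph_nat (real_complex R)) /=; ring.
by split; [rewrite E rmorphM|rewrite key; exact: push|rewrite key; exact: push].
Qed.

Definition Gk1 x y : R[i] := k%:R * (Complex x y)^-1 ^+ k.-1 * (- (1 * (Complex x y)^-1 ^+ 2))
  - (2 * k%:R * x * psi k x y / sq2 x y)%:C%C.
Definition Gk2 x y : R[i] := k%:R * (Complex x y)^-1 ^+ k.-1 * (- (Ci * (Complex x y)^-1 ^+ 2))
  - (2 * k%:R * y * psi k x y / sq2 x y)%:C%C.

Lemma quad_on_Gk : quad_on A (Gk k) Gk1 Gk2.
Proof.
have zb x y : A x y -> Num.sqrt rho <= nc (Complex x y).
  by move=> a; rewrite /=; apply: ler_wsqrtr; exact: A_far a.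
have rs : 0 < Num.sqrt rho by rewrite sqrtr_gt0.
have q1 := quad_on_pow k (quad_on_inv rs zb quad_on_z).
have q2 := quad_on_add q1 (quad_on_mul (quad_on_cst A (-1)) quad_on_kell).
apply: quad_on_ext q2 _ => x y _; rewrite /Gk /Gk1 /Gk2.
by split; ring.
Qed.

End OnAnnulus.

(** Both partial derivatives share the factor s = -kk m^-1 z^-2: G1 = s (1 + q + Q) and G2 = i s (1
    + q - Q). Here m stands for z^(k-1), p for [psi], and z and zb are independent variables. *)
Lemma wedge_identity (K : fieldType) (i z zb m p kk : K) : (2 : K) != 0 -> z != 0 -> zb != 0 -> m != 0 ->
  let X := (z + zb) / 2 in let Y := - i * (z - zb) / 2 in let t := z * zb in
  let q := z * m * p in let Q := z * (z / t * q) in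
  let G1 := kk * m^-1 * (- (1 * z^-1 ^+ 2)) - 2 * kk * X * p / t in
  let G2 := kk * m^-1 * (- (i * z^-1 ^+ 2)) - 2 * kk * Y * p / t in
  (1 + q + Q) * G2 = i * (1 + q - Q) * G1.
Proof. by move=> h2 hz hzb hm /=; field; rewrite hz hzb hm h2. Qed.

Lemma denJ_Gk x y : 0 < sq2 x y -> denJ k x y * Gk2 x y = Ci * numJ k x y * Gk1 x y.
Proof.
move=> t0; set z : R[i] := Complex x y; set zb : R[i] := Complex x (- y).
have two : (2 : R[i]) != 0 by rewrite pnatr_eq0.
have zz : z * zb = (sq2 x y)%:C%C.
  by apply/eqP; rewrite eq_complex /sq2 /=; apply/andP; split; apply/eqP; ring.
have tn : (sq2 x y)%:C%C != 0 :> R[i] by rewrite eq_complex /= negb_and gt_eqF.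
have z0 : z != 0 by apply: contraNneq tn => e; rewrite -zz e mul0r.
have zb0 : zb != 0 by apply: contraNneq tn => e; rewrite -zz e mulr0.
have Xe : x%:C%C = (z + zb) / 2.
  apply: (mulIf two); rewrite divfK //.
  by apply/eqP; rewrite eq_complex /=; apply/andP; split; apply/eqP; ring.
have Ye : y%:C%C = - Ci * (z - zb) / 2.
  apply: (mulIf two); rewrite divfK //.
  by apply/eqP; rewrite eq_complex /=; apply/andP; split; apply/eqP; ring.
have m0 : z ^+ k.-1 != 0 by rewrite expf_neq0.
have := wedge_identity Ci (psi k x y)%:C%C k%:R two z0 zb0 m0; rewrite /= -Xe -Ye zz.
have -> : z * z ^+ k.-1 * (psi k x y)%:C%C = qb k x y.
  by rewrite -exprS prednK.
have -> : z * (z / (sq2 x y)%:C%C * qb k x y) = Qb k x y.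
  rewrite /Qb -/z; congr (_ * (_ * _)); rewrite /z (complex_split x y) (complex_split (x / _) (y / _)).
  by rewrite !(rmorphM (real_complex R)) /= !fmorphV; ring.
rewrite -/(denJ k x y) -/(numJ k x y) /Gk1 /Gk2 -/z.
have P (v : R) : (2 * k%:R * v * psi k x y / sq2 x y)%:C%C =
   2 * k%:R * v%:C%C * (psi k x y)%:C%C / (sq2 x y)%:C%C :> R[i].
  by rewrite !(rmorphM (real_complex R)) /= fmorphV !rmorph_nat.
by rewrite !P (exprVn z k.-1).
Qed.

Lemma denJ_neq0 x y : denJ k x y != 0.
Proof.
apply/eqP => d0; have := detJ_gt0 k x y; rewrite -detJE d0 /=.
by rewrite !mulr0 addr0 ltxx.
Qed.

Lemma no_holomorphic (f f1 f2 : R -> R -> R[i]) (c : R[i]) (e : R) : 0 < e -> c != 0 ->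
  quad_on (box e) f f1 f2 ->
  (forall x y, box e x y -> denJ k x y * f2 x y = Ci * numJ k x y * f1 x y) ->
  ctaylor 2 k.+1 (fun x y => f x y - c * Complex x y) -> False.
Proof.
move=> e0 c0 qf hol Tf.
have [e' [C [e0' C0 HS]]] := circ_sum_asymptotics k_gt0 (ctaylor_pow k_gt0 k_gt0 Tf).
pose r1 := Num.min (Num.min e e') 1 / 2.
have m0 : 0 < Num.min (Num.min e e') 1 by rewrite !lt_min e0 e0' ltr01.
have r10 : 0 < r1 by rewrite divr_gt0.
have rm : r1 < Num.min (Num.min e e') 1 by rewrite /r1; lra.
have /andP[/andP[r1e r1e'] r11] : (r1 < e) && (r1 < e') && (r1 < 1).
  by move: rm; rewrite !lt_min.
have cp : 0 < nc (c ^+ k).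
  rewrite lt_neqAle normc_ge0 andbT eq_sym; apply: contra c0 => /eqP/Normc.eq0_normc/eqP.
  by rewrite expf_eq0 => /andP[].
(* The inner radius makes [ell] grow by more than (2C + 2)/|c^k| between the circles, which beats
   the total error 2C + 1 below. *)
have [d d0 Hd] := ell_unbounded k_gt0 (ell k (r1 ^+ 2) + (2 * C + 2) / nc (c ^+ k)).
pose r0 := Num.min r1 (Num.min d 1 / 2).
have r00 : 0 < r0 by rewrite lt_min r10 divr_gt0 // lt_min d0 ltr01.
have r01 : r0 <= r1 by rewrite ge_min lexx.
have r0d : r0 ^+ 2 < d.
  have h1 : r0 <= Num.min d 1 / 2 by rewrite ge_min lexx orbT.
  have h2 : Num.min d 1 <= d by rewrite ge_min lexx.
  have h3 : r0 <= 1 by apply: le_trans r01 _; exact: ltW.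
  apply: le_lt_trans (_ : r0 < d); first by rewrite expr2 ler_piMr // ltW.
  lra.
pose A x y := r0 ^+ 2 <= sq2 x y /\ (box e x y /\ box 1 x y).
have A1 x y : A x y -> r0 ^+ 2 <= sq2 x y by case.
have A2 x y : A x y -> box 1 x y by case=> _ [].
have rp : 0 < r0 ^+ 2 by rewrite exprn_gt0.
have qF : quad_on A (fun x y => f x y ^+ k) (fun x y => k%:R * f x y ^+ k.-1 * f1 x y)
   (fun x y => k%:R * f x y ^+ k.-1 * f2 x y).
  apply: quad_on_pow; case: qf => K [K0 H]; exists K; split=> // x y x' y' [_ [b _]] [_ [b' _]].
  exact: H.
have qH := quad_on_pow 2 (quad_on_Gk rp A1 A2).
have HA r t : r0 <= r -> r <= r1 -> A (px r t) (py r t).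
  move=> h1 h2; have r_ge0 : 0 <= r by apply: le_trans h1; exact: ltW.
  split; first by rewrite sq2_polar lerXn2r // nnegrE // ltW.
  have hx := px_le t r_ge0; have hy := py_le t r_ge0.
  by split; split; lra.
(* f and G both solve [denJ] w_y = i [numJ] w_x with [denJ] nonzero, so their differentials are
   proportional, and hence those of f^k and G^2. *)
have W x y : A x y -> (k%:R * f x y ^+ k.-1 * f1 x y) * (2%:R * Gk k x y ^+ 1 * Gk2 x y) =
   (k%:R * f x y ^+ k.-1 * f2 x y) * (2%:R * Gk k x y ^+ 1 * Gk1 x y).
  case=> a [b _]; apply: (mulfI (denJ_neq0 x y)).
  have h1 := hol x y b; have h2 := denJ_Gk (lt_le_trans rp a).
  have -> : denJ k x y * (k%:R * f x y ^+ k.-1 * f1 x y * (2 * Gk k x y ^+ 1 * Gk2 x y)) =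
    (k%:R * f x y ^+ k.-1 * f1 x y * (2 * Gk k x y ^+ 1)) * (denJ k x y * Gk2 x y) by ring.
  have -> : denJ k x y * (k%:R * f x y ^+ k.-1 * f2 x y * (2 * Gk k x y ^+ 1 * Gk1 x y)) =
    (denJ k x y * f2 x y) * (k%:R * f x y ^+ k.-1 * (2 * Gk k x y ^+ 1 * Gk1 x y)) by ring.
  by rewrite h1 h2; ring.
have [C' [C0' HC']] := circ_sum_stokes r00 r01 (ltW r11) HA qF qH W.
(* The first summand provides the 16 sample points that the Stokes estimate asks for, the second
   brings its error C'/N to at most 1. *)
pose M := (16 + (Num.truncn C').+1)%N; pose N := (2 * k * M)%N.
have NM : (M <= N)%N by rewrite /N leq_pmull // muln_gt0.
have N16 : (16 <= N)%N by apply: leq_trans NM; rewrite leq_addr.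
have Np : 0 < N%:R :> R by rewrite ltr0n; exact: leq_trans N16.
have CN : C' / N%:R <= 1.
  rewrite ler_pdivrMr // mul1r.
  apply: le_trans (_ : (Num.truncn C').+1%:R <= _).
    by apply/ltW; exact: truncnS_gt.
  by rewrite ler_nat; apply: leq_trans NM; rewrite leq_addl.
have [kappa hk Hk'] := HS M isT.
have S0 := Hk' r0 r00 (le_lt_trans r01 r1e').
have S1 := Hk' r1 r10 r1e'.
have S01 := le_trans (HC' N N16) CN.
rewrite -/N in S0 S1.
pose D := ell k (r0 ^+ 2) - ell k (r1 ^+ 2).
have D1 : (2 * C + 2) / nc (c ^+ k) < D by have := Hd _ rp r0d; rewrite /D; lra.
have D0 : 0 <= D by apply: le_trans (ltW D1); rewrite divr_ge0 ?addr_ge0 ?mulr_ge0 // ltW.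
(* C for the asymptotics at each radius, 1 for the passage between the circles. *)
have E : nc (kappa * D%:C%C) <= 2 * C + 1.
  have -> : kappa * D%:C%C = (circ_sum (fun x y => f x y ^+ k) (Hk k) N r0 - circ_sum (fun x y => f x y ^+ k) (Hk k) N r1)
    - (circ_sum (fun x y => f x y ^+ k) (Hk k) N r0 - kappa * (ell k (r0 ^+ 2))%:C%C)
    + (circ_sum (fun x y => f x y ^+ k) (Hk k) N r1 - kappa * (ell k (r1 ^+ 2))%:C%C).
    by rewrite /D rmorphB /=; ring.
  apply: le_trans (normcD _ _) _.
  have := le_trans (normcB _ _) (lerD S01 S0); move=> h; have := lerD h S1; lra.
rewrite Normc.normcM normc_real (ger0_norm D0) in E.
have := ler_wpM2r D0 hk.
move: D1; rewrite ltr_pdivrMr // mulrC; lra.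
Qed.

End Nonexistence.

(** * From the eigenvector condition on a chart to an equation for its differentials *)

Section ChartToEquation.
Variable R : realType.
Local Notation Ci := (Complex 0 1 : R[i]).

Section Matrices.
Variables (n : nat) (u v : 'I_n -> 'rV[R]_(n + n) -> R) (p : 'rV[R]_(n + n)).
Local Notation W := (dw_matrix u v p).
Local Notation toC := (real_complex R).

Lemma dw_matrixE : W = block_mx 1%:M Ci%:M 1%:M (- Ci)%:M *m map_mx toC (real_jacobian u v p).
Proof.
rewrite /real_jacobian map_col_mx mul_block_col !mul1mx !mul_scalar_mx.
congr col_mx; apply/matrixP => i j; rewrite !mxE; apply/eqP; rewrite eq_complex /=;
  by apply/andP; split; apply/eqP; ring.
Qed.

Lemma dw_matrix_unit : real_jacobian u v p \in unitmx -> W \in unitmx.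
Proof.
move=> hJ; rewrite dw_matrixE unitmx_mul map_unitmx hJ andbT.
have two : (2 : R[i]) != 0 by rewrite pnatr_eq0.
have ii : Ci * Ci = -1 by apply/eqP; rewrite eq_complex /=; apply/andP; split; apply/eqP; ring.
(* The inverse of the change of frame: u = (w + conj w)/2 and v = -i (w - conj w)/2. *)
pose K' := block_mx (2^-1)%:M (2^-1)%:M (- Ci / 2)%:M (Ci / 2)%:M : 'M[R[i]]_(n + n).
have KK : block_mx 1%:M Ci%:M 1%:M (- Ci)%:M *m K' = 1%:M.
  rewrite mulmx_block !mul1mx -!scalar_mxM -!raddfD /= [RHS](@scalar_mx_block _ n n 1).
  have i1 : Ci * (- Ci / 2) = 2^-1 by rewrite mulrA mulrN ii opprK mul1r.
  have i2 : Ci * (Ci / 2) = - 2^-1 by rewrite mulrA ii mulN1r.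
  have h : 2^-1 + 2^-1 = 1 :> R[i] by field.
  have i3 : - Ci * (- Ci / 2) = - 2^-1 by rewrite mulNr i1.
  have i4 : - Ci * (Ci / 2) = 2^-1 by rewrite mulNr i2 opprK.
  by rewrite i1 i2 i3 i4 h !subrr !(raddf0 (@scalar_mx R[i] n)).
by case/mulmx1_unit: KK.
Qed.

Lemma dw_matrix_conj : map_mx (@conjc R) W = block_mx 0 1%:M 1%:M 0 *m W.
Proof.
rewrite /dw_matrix map_col_mx mul_block_col !mul1mx !mul0mx add0r addr0.
by congr col_mx; apply/matrixP => i j; rewrite !mxE /= ?opprK.
Qed.

(* The last [n] columns of [invmx W] are the conjugates of the first [n], hence
   eigenvectors of [J] for [-i]; so [J] is known on a basis. *)
Lemma dw_rows_eigen (J : 'M[R]_(n + n)) : real_jacobian u v p \in unitmx ->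
  (forall j : 'I_n, map_mx toC J *m d_dw u v p j = Ci *: d_dw u v p j) ->
  usubmx W *m map_mx toC J = Ci *: usubmx W.
Proof.
move=> hJ H; have Wu := dw_matrix_unit hJ.
set V := invmx W; set JC := map_mx toC J.
have H1 : JC *m lsubmx V = Ci *: lsubmx V.
  apply/matrixP => a j; have := H j; rewrite /d_dw -/V => /matrixP/(_ a 0).
  rewrite !mxE => E; rewrite -[RHS]/(Ci * _) -E.
  by apply: eq_bigr => c _; rewrite !mxE.
pose S : 'M[R[i]]_(n + n) := block_mx 0 1%:M 1%:M 0.
have SS : S *m S = 1%:M.
  by rewrite mulmx_block !mul0mx !mulmx0 !mulmx1 !add0r !addr0 -scalar_mx_block.
have Su : S \in unitmx by case/mulmx1_unit: SS.
have SV : invmx S = S by rewrite -[LHS]mulmx1 -SS mulKmx.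
(* Conjugation exchanges the upper and lower rows of W, hence the left and right columns of its
   inverse. *)
have VC : map_mx (@conjc R) V = V *m S.
  have cW : map_mx (@conjc R) W \in unitmx by rewrite map_unitmx.
  rewrite map_invmx.
  have E : map_mx (@conjc R) W *m (V *m S) = 1%:M.
    by rewrite dw_matrix_conj -mulmxA (mulmxA W) mulmxV // mul1mx.
  by rewrite -[LHS]mulmx1 -E (mulKmx cW).
have rV : rsubmx V = map_mx (@conjc R) (lsubmx V).
  have -> : map_mx (@conjc R) (lsubmx V) = lsubmx (map_mx (@conjc R) V).
    by apply/matrixP => a b; rewrite !mxE.
  rewrite VC -[in RHS](hsubmxK V) mul_row_block !mulmx0 !mulmx1 add0r addr0.
  by rewrite row_mxKl.
have JCC : map_mx (@conjc R) JC = JC by apply/matrixP => a b; rewrite !mxE /= oppr0.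
have H2 : JC *m rsubmx V = (- Ci) *: rsubmx V.
  rewrite rV -{1}JCC -map_mxM H1; apply/matrixP => a b; rewrite !mxE.
  case: (V _ _) => s t; apply/eqP; rewrite eq_complex /=.
  by apply/andP; split; apply/eqP; ring.
have WV : W *m V = 1%:M by rewrite mulmxV.
have W12 : usubmx W *m V = row_mx 1%:M 0.
  have := WV; rewrite -{1}(vsubmxK W) mul_col_mx (@scalar_mx_block _ n n 1) block_mxEv.
  by case/eq_col_mx.
have [W1 W2] : usubmx W *m lsubmx V = 1%:M /\ usubmx W *m rsubmx V = 0.
  by apply/eq_row_mx; rewrite -mul_mx_row hsubmxK.
(* Tested on the frame V: both sides are i times the identity on the left half, and 0 on the right
   half because dw annihilates the conjugate fields. *)
have E : (usubmx W *m JC) *m V = (Ci *: usubmx W) *m V.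
  rewrite -{1}(hsubmxK V) mul_mx_row -!mulmxA H1 H2 -!scalemxAr W1 W2 scaler0.
  by rewrite -scalemxAl W12 scale_row_mx scaler0.
by rewrite -[LHS]mulmx1 -[RHS]mulmx1 -(mulVmx Wu) !mulmxA E.
Qed.

End Matrices.
End ChartToEquation.

(** * The chart restricted to one coordinate plane *)

Section Assembly.
Variables (R : realType) (k n : nat) (i0 : 'I_n).
Local Notation Ci := (Complex 0 1 : R[i]).
Local Notation V := 'rV[R]_(n + n).
Local Notation l := (lshift n i0).
Local Notation r := (rshift n i0).
Implicit Types (u v : 'I_n -> V -> R) (p : V).

Definition dwx u v j p : R[i] := Complex (partial l (u j) p) (partial l (v j) p).
Definition dwy u v j p : R[i] := Complex (partial r (u j) p) (partial r (v j) p).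

Lemma Jst_col_entry (M : 'M[R[i]]_(n, n + n)) p j :
  (M *m map_mx (real_complex R) (Jst k p)) j l =
  M j l * (Jxx k (xc p i0) (yc p i0))%:C%C + M j r * (Jyx k (xc p i0) (yc p i0))%:C%C.
Proof.
rewrite mxE big_split_ord /= (bigD1 i0) //= [in X in _ + X](bigD1 i0) //=.
rewrite !big1 ?addr0 => [|i /negbTE ij|i /negbTE ij].
- by rewrite [map_mx _ _ _ _]mxE [map_mx _ _ (r) _]mxE /Jst block_mxEul block_mxEdl !mxE eqxx !mulr1n.
- by rewrite [map_mx _ _ _ _]mxE /Jst block_mxEdl !mxE ij mulr0n mulr0.
- by rewrite [map_mx _ _ _ _]mxE /Jst block_mxEul !mxE ij mulr0n mulr0.
Qed.

(** Reverses the derivation of [Jxx] and [Jyx]: after multiplication by [detJ] both sides contain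
    the conjugate of [denJ], which is nonzero and cancels. *)
Lemma holomorphic_equation (x y : R) (wx wy : R[i]) :
  wx * (Jxx k x y)%:C%C + wy * (Jyx k x y)%:C%C = Ci * wx ->
  denJ k x y * wy = Ci * numJ k x y * wx.
Proof.
move=> H; have D0 := detJ_gt0 k x y.
have Dn : (detJ k x y)%:C%C != 0 :> R[i] by rewrite eq_complex /= negb_and gt_eqF.
have dn : conjc (denJ k x y) != 0 by rewrite conjc_eq0 denJ_neq0.
have E1 : (Jxx k x y)%:C%C * (detJ k x y)%:C%C =
   (Im (numJ k x y) * Re (denJ k x y) - Re (numJ k x y) * Im (denJ k x y))%:C%C :> R[i].
  by rewrite -rmorphM divfK // gt_eqF.
have E2 : (Jyx k x y)%:C%C * (detJ k x y)%:C%C = denJ k x y * conjc (denJ k x y).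
  rewrite -rmorphM divfK ?gt_eqF // /nsq; case: (denJ k x y) => a b.
  by apply/eqP; rewrite eq_complex /=; apply/andP; split; apply/eqP; ring.
have E3 : Ci * (detJ k x y)%:C%C -
   (Im (numJ k x y) * Re (denJ k x y) - Re (numJ k x y) * Im (denJ k x y))%:C%C
   = Ci * (numJ k x y * conjc (denJ k x y)).
  rewrite -detJE; case: (denJ k x y) => a b; case: (numJ k x y) => c d.
  by apply/eqP; rewrite eq_complex /=; apply/andP; split; apply/eqP; ring.
apply: (mulIf dn).
have -> : denJ k x y * wy * conjc (denJ k x y) = wy * (denJ k x y * conjc (denJ k x y)) by ring.
have -> : Ci * numJ k x y * wx * conjc (denJ k x y) = Ci * (numJ k x y * conjc (denJ k x y)) * wx by ring.
rewrite -E2 -E3 -E1.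
have -> : (Ci * (detJ k x y)%:C%C - (Jxx k x y)%:C%C * (detJ k x y)%:C%C) * wx =
  (Ci * wx - wx * (Jxx k x y)%:C%C) * (detJ k x y)%:C%C by ring.
by rewrite -H addrC addKr mulrA.
Qed.

Lemma slice_xc x y : xc (slice l r x y : V) i0 = x.
Proof.
by rewrite /xc /slice !mxE !eqxx /= eq_lrshift /= mulr1 mulr0 addr0.
Qed.

Lemma slice_yc x y : yc (slice l r x y : V) i0 = y.
Proof.
by rewrite /yc /slice !mxE !eqxx /= eq_rlshift /= mulr1 mulr0 add0r.
Qed.

(** Otherwise the Jacobian would have a zero column, the one of the x-variable of the chosen
    pair. *)
Lemma jacobian_dwx_neq0 u v p : real_jacobian u v p \in unitmx ->
  exists j, dwx u v j p != 0.
Proof.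
move=> hJ; apply/existsP; rewrite -[X in is_true X]negbK negb_exists; apply/negP => /forallP H.
have E : real_jacobian u v p *m (delta_mx l 0 : 'cV[R]_(n + n)) = 0.
  rewrite -colE /real_jacobian; apply/colP => a; rewrite [LHS]mxE [RHS]mxE.
  case: (split_ordP a) => j ->; rewrite ?col_mxEu ?col_mxEd mxE.
    by have := H j; rewrite negbK eq_complex /= => /andP[/eqP].
  by have := H j; rewrite negbK eq_complex /= => /andP[_ /eqP].
have := mulKmx hJ (delta_mx l 0 : 'cV[R]_(n + n)); rewrite E mulmx0.
by move/matrixP/(_ l 0)/eqP; rewrite !mxE !eqxx /= eq_sym oner_eq0.
Qed.

Lemma quad_on_sub (A B : R -> R -> Prop) F F1 F2 : (forall x y, A x y -> B x y) ->
  quad_on B F F1 F2 -> quad_on A F F1 F2.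
Proof. by move=> AB [C [C0 H]]; exists C; split=> // x y x' y' /AB a /AB a'; exact: H. Qed.

Lemma quad_on_real (g gx gy : R -> R -> R) : lip_near g -> lip_near gx -> lip_near gy ->
  quad_near g gx gy -> exists2 e : R, 0 < e &
  quad_on (box e) (fun x y => (g x y)%:C%C) (fun x y => (gx x y)%:C%C) (fun x y => (gy x y)%:C%C).
Proof.
move=> Lg /lip_near_bounded[e1 [B1 [e10 B10 H1]]] /lip_near_bounded[e2 [B2 [e20 B20 H2]]].
case=> e3 [L3 [e30 L30 H3]].
have [e4 [B4 [e40 B40 H4]]] := lip_near_bounded Lg.
have [e5 [L5 [e50 L50 H5]]] := Lg.
exists (Num.min e1 (Num.min e2 (Num.min e3 (Num.min e4 e5)))).
  by rewrite !lt_min e10 e20 e30 e40.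
exists (B1 + B2 + L3 + B4 + L5); split; first by rewrite !addr_ge0.
move=> x y x' y' /box_min[b1 /box_min[b2 /box_min[b3 /box_min[b4 b5]]]].
move=> /box_min[_ /box_min[_ /box_min[b3' /box_min[_ b5']]]].
have dE (s t : R) : s%:C%C - t%:C%C = (s - t)%:C%C :> R[i] by rewrite rmorphB.
have -> : lin (fun x y => (gx x y)%:C%C) (fun x y => (gy x y)%:C%C) x y (x' - x) (y' - y)
   = (gx x y * (x' - x) + gy x y * (y' - y))%:C%C by rewrite /lin [RHS]rmorphD /= !(rmorphM (real_complex R)).
rewrite !dE !normc_real.
have h1 := H1 _ _ b1; have h2 := H2 _ _ b2; have h4 := H4 _ _ b4.
have h3 := H3 _ _ _ _ b3 b3'; have h5 := H5 _ _ _ _ b5' b5.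
have d0 := dist1_ge0 x y x' y'.
split; [lra|lra|lra| |].
  by apply: le_trans h5 _; rewrite ler_wpM2r //; lra.
have -> : g x' y' - g x y - (gx x y * (x' - x) + gy x y * (y' - y)) =
  g x' y' - g x y - gx x y * (x' - x) - gy x y * (y' - y) by ring.
by apply: le_trans h3 _; rewrite ler_wpM2r ?exprn_ge0 //; lra.
Qed.

Lemma quad_on_chart m (U : set V) u v j : open U -> U 0 ->
  Ckl_on m.+1 U (u j) -> Ckl_on m.+1 U (v j) -> exists2 e : R, 0 < e &
  quad_on (box e)
    (fun x y => Complex (u j (slice l r x y) - u j 0) (v j (slice l r x y) - v j 0))
    (fun x y => dwx u v j (slice l r x y)) (fun x y => dwy u v j (slice l r x y)).
Proof.
move=> oU U0 hu hv.
have [qu [[lu1 lu2] _]] := slice_taylor2 l r oU U0 hu.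
have [qv [[lv1 lv2] _]] := slice_taylor2 l r oU U0 hv.
have [lu _] := slice_taylor1 l r oU U0 hu.
have [lv _] := slice_taylor1 l r oU U0 hv.
have [e e0 He] := quad_on_real lu lu1 lu2 qu.
have [e' e0' He'] := quad_on_real lv lv1 lv2 qv.
exists (Num.min e e'); first by rewrite lt_min e0.
pose A := box (Num.min e e').
have Q1 : quad_on A _ _ _ := quad_on_sub (fun x y b => proj1 (box_min b)) He.
have Q2 : quad_on A _ _ _ := quad_on_sub (fun x y b => proj2 (box_min b)) He'.
rewrite -/A.
have Q3 := quad_on_add (quad_on_add Q1 (quad_on_mul (quad_on_cst A Ci) Q2))
  (quad_on_cst A (- Complex (u j 0) (v j 0))).
apply: quad_on_ext Q3 _ => x y _; rewrite /dwx /dwy.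
by split; apply/eqP; rewrite eq_complex /=; apply/andP; split; apply/eqP; ring.
Qed.

End Assembly.

Lemma no_chart (R : realType) (k n : nat) (U : set 'rV[R]_(n + n))
    (u v : 'I_n -> 'rV[R]_(n + n) -> R) : (0 < k)%N -> (0 < n)%N ->
  open U -> U 0 -> Ckl_chart k U u v ->
  (forall p, U p -> forall j : 'I_n,
     Jc (@Jst R k n) p *m d_dw u v p j = (Complex 0 1) *: d_dw u v p j) -> False.
Proof.
move=> k0 n0 oU U0 [hC [_ hJ]] hD; pose i0 := Ordinal n0.
(* With k + 1 in place of k the partial derivatives of the chart are of class C^(k,1), which gives
   Lipschitz gradients on the slice and Taylor accuracy k + 2. *)
case: k k0 hC hD => // k k0 hC hD.
have hol j x y : U (slice (lshift n i0) (rshift n i0) x y) ->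
  denJ k.+1 x y * dwy i0 u v j (slice (lshift n i0) (rshift n i0) x y) =
  Complex 0 1 * numJ k.+1 x y * dwx i0 u v j (slice (lshift n i0) (rshift n i0) x y).
  move=> Up; apply: holomorphic_equation.
  have E := dw_rows_eigen (hJ _ Up) (hD _ Up).
  have := Jst_col_entry k.+1 i0 (usubmx (dw_matrix u v (slice (lshift n i0) (rshift n i0) x y)))
    (slice (lshift n i0) (rshift n i0) x y) j.
  by rewrite E slice_xc slice_yc /dwx /dwy !mxE !(unsplitK (inl _)) !mxE => ->.
have [j hj] := jacobian_dwx_neq0 i0 (hJ _ U0).
have [hu hv] := hC j.
have [e1 e10 H1] := slice_near (lshift n i0) (rshift n i0) oU U0.
have [e2 e20 H2] := quad_on_chart i0 oU U0 hu hv.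
have [_ [_ Tu]] := slice_taylor2 (lshift n i0) (rshift n i0) oU U0 hu.
have [_ [_ Tv]] := slice_taylor2 (lshift n i0) (rshift n i0) oU U0 hv.
have e0 : 0 < Num.min e1 e2 by rewrite lt_min e10.
have b0 : box e1 0 0 by split; rewrite normr0.
(* At the origin mu = 0, so the equation there is the Cauchy-Riemann equation, and the linear part
   of the component is c z with c the nonzero entry [dwx]. *)
have q0 : qb k.+1 0 0 = 0 :> R[i].
  have z0 : Complex 0 0 = 0 :> R[i] by [].
  by rewrite /qb z0 expr0n /= mul0r.
have h0 := hol j 0 0 (H1 _ _ b0).
rewrite /denJ /numJ /Qb q0 !mulr0 subr0 !addr0 mul1r mulr1 slice00 in h0.
have [r1 r2] : partial (rshift n i0) (u j) 0 = - partial (lshift n i0) (v j) 0 /\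
   partial (rshift n i0) (v j) 0 = partial (lshift n i0) (u j) 0.
  move: h0; rewrite /dwx /dwy => /eqP; rewrite eq_complex /= => /andP[/eqP -> /eqP ->].
  by split; ring.
apply: (@no_holomorphic R k.+1 k0 _ _ _ _ _ e0 hj (quad_on_sub _ H2)).
- by move=> x y /box_min[].
- by move=> x y /box_min[b _]; apply: hol; exact: H1.
- split; [apply: taylor_ext Tu _|apply: taylor_ext Tv _] => x y; rewrite /dwx /= ?r1 ?r2; ring.
Qed.
Theorem theorem2 (R : realType) (k n : nat) :
  (0 < k)%N -> (0 < n)%N ->
  exists J : 'rV[R]_(n + n) -> 'M[R]_(n + n),
    almost_complex J /\ Ck_structure k J /\ J_integrable J /\
    ~ (exists (U : set 'rV[R]_(n + n)) (u v : 'I_n -> 'rV[R]_(n + n) -> R),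
         open U /\ U 0 /\ Ckl_chart k U u v /\
         forall p, U p -> forall j : 'I_n,
           Jc J p *m d_dw u v p j = (Complex 0 1) *: d_dw u v p j).
Proof.
move=> k0 n0; exists (@Jst R k n); split; first exact: Jst_almost_complex.
split; first exact: Jst_Ck.
split; first exact: Jst_integrable.
case=> U [u [v [oU [U0 [hC hD]]]]].
exact: no_chart k0 n0 oU U0 hC hD.
Qed.
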